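(* Let $t_0\in[0,1]$. Assume that $\|(\mathcal A_t-\mathbf i)^{-1}-(\mathcal A_{t_0}-\mathbf i)^{-1}\|_{\mathcal B(\mathcal H,\mathcal D)}=o(1)$ as $t\to t_0$, that $\lambda=\lambda(t_0)$ is an isolated eigenvalue of $H_{t_0}$ of finite multiplicity $m\in\mathbb N$, and that the mappings $t\mapsto\mathrm T_t$, $t\mapsto V_t$, $t\mapsto Q_t$ are differentiable at $t_0$. Let $P(t_0)$ be the Riesz (orthogonal) projection onto $\ker(H_{t_0}-\lambda)$. Introduce the operator $$T^{(1)}:=P(t_0)\dot V_{t_0}P(t_0)-(\mathrm T_{t_0}P(t_0))^*\dot Q_{t_0}J\,\mathrm T_{t_0}P(t_0)-(\mathrm T_{t_0}P(t_0))^*J\,\dot{\mathrm T}_{t_0}P(t_0),$$ and denote the eigenvalues and orthonormal eigenvectors of this $m$-dimensional operator (acting in $\mathrm{ran}(P(t_0))$) by $\{\lambda_j^{(1)}\}_{j=1}^m$ and $\{u_j\}_{j=1}^m\subset\mathrm{ran}(P(t_0))=\ker(H_{t_0}-\lambda)$, respectively. Then there exists a labeling $\{\lambda_j(t)\}_{j=1}^m$ of the eigenvalues of $H_t$ inside the disc $B$, for $t$ near $t_0$, such that $$\lambda_j(t)=\lambda+\lambda_j^{(1)}(t-t_0)+o(t-t_0),\qquad t\to t_0,$$ and, moreover, for each $1\le j\le m$, $$\dot\lambda_j(t_0)=\langle\dot V_{t_0}u_j,u_j\rangle_{\mathcal H}+\omega(\dot Q_{t_0}\mathrm T_{t_0}u_j,\mathrm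 T_{t_0}u_j)+\omega(\mathrm T_{t_0}u_j,\dot{\mathrm T}_{t_0}u_j).$$
   Context: Inner products are linear in the first argument. $\mathcal H,\mathfrak H$ are complex separable Hilbert spaces; $A$ is a densely defined, closed, symmetric operator in $\mathcal H$ with equal (possibly infinite) deficiency indices; $\mathcal H_+:=\mathrm{dom}(A^* )$ carries the graph inner product $\langle u,v\rangle_{\mathcal H}+\langle A^*u,A^*v\rangle_{\mathcal H}$. $\mathcal D$ is a dense subspace of $\mathcal H_+$ with $\mathrm{dom}(A)\subset\mathcal D$, equipped with a Banach norm $\|\cdot\|_{\mathcal D}$ for which the embedding $\mathcal D\hookrightarrow\mathcal H_+$ is bounded. For each $t\in[0,1]$, the trace operator $\mathrm T_t=[\Gamma_{0t},\Gamma_{1t}]^\top\in\mathcal B(\mathcal D,\mathfrak H\times\mathfrak H)$ has dense range and satisfies $\langle A^*u,v\rangle_{\mathcal H}-\langle u,A^*v\rangle_{\mathcal H}=\langle\Gamma_{1t}u,\Gamma_{0t}v\rangle_{\mathfrak H}-\langle\Gamma_{0t}u,\Gamma_{1t}v\rangle_{\mathfrak H}$ for $u,v\in\mathcal D$. $J=\begin{bmatrix}0&I_{\mathfrak H}\\-I_{\mathfrak H}&0\end{bmatrix}$, $\omega(f,g)=\langle Jf,g\rangle_{\mathfrak H\times\mathfrak H}$; a subspace $\mathcal F\subset\mathfrak H\times\mathfrak H$ is Lagrangian if it equals $\{f:\omega(f,g)=0\ \forall g\in\mathcal F\}$. For each $t\in[0,1]$: $Q_t$ is an orthogonal projection in $\mathfrak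 H\times\mathfrak H$ whose range is Lagrangian; $\mathcal A_t$ is a self-adjoint extension of $A$ with $\mathrm{dom}(\mathcal A_t)\subset\mathcal D$ and $\overline{\mathrm T_t(\mathrm{dom}(\mathcal A_t))}=\mathrm{ran}(Q_t)$; $V_t\in\mathcal B(\mathcal H)$ is self-adjoint; $H_t:=\mathcal A_t+V_t$. Differentiability of $\mathrm T_t,V_t,Q_t$ is in the norms of $\mathcal B(\mathcal D,\mathfrak H\times\mathfrak H)$, $\mathcal B(\mathcal H)$, $\mathcal B(\mathfrak H\times\mathfrak H)$; the dot is the $t$-derivative. $B\subset\mathbb C$ is the disc centered at $\lambda$ bounded by the circle $\gamma=\{z:2|z-\lambda|=\mathrm{dist}(\lambda,\mathrm{Spec}(H_{t_0})\setminus\{\lambda\})\}$; for $t$ near $t_0$ it contains exactly $m$ eigenvalues of $H_t$ counted with multiplicity. $\mathrm T_{t_0}P(t_0)\in\mathcal B(\mathcal H,\mathfrak H\times\mathfrak H)$ and its adjoint lies in $\mathcal B(\mathfrak H\times\mathfrak H,\mathcal H)$. *)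

(* Defs.v *)
From HB Require Import structures.
From mathcomp Require Import all_boot all_order all_algebra.
From mathcomp Require Import sesquilinear complex.
From mathcomp Require Import ring.
From mathcomp Require Import all_classical all_reals all_analysis.

Set Implicit Arguments.
Unset Strict Implicit.
Unset Printing Implicit Defensive.

Import Order.TTheory GRing.Theory Num.Theory.
Import numFieldNormedType.Exports.

Local Open Scope classical_set_scope.
Local Open Scope card_scope.
Local Open Scope complex_scope.
Local Open Scope ring_scope.

(* Complex Hilbert spaces. A form in {dot H for conjC} is linear in its first
   argument, conjugate-linear in the second, and positive definite. *)
HB.mixin Record isHilbert (R : realType) H & CompleteNormedModule R[i] H := {
  dotform : {dot H for @Num.conj R[i]};
  dotform_norm : forall u : H, `|u| ^+ 2 = dotform u u
}.

#[short(type="hilbertType")]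
HB.structure Definition Hilbert (R : realType) :=
  {H of isHilbert R H & CompleteNormedModule R[i] H}.

Notation "'⟨' u , v '⟩'" := (dotform u v)
  (at level 0, u at level 99, v at level 99, format "'⟨' u ,  v '⟩'").

(* The orthogonal sum G x G. The library's norm on G * G is the maximum norm,
   so the Hilbert norm is put on an alias. *)
Definition hsum (G : Type) : Type := (G * G)%type.

Section HilbertSum.
Context (R : realType) (G : hilbertType R).
Local Notation C := R[i].
Local Notation GG := (hsum G).

HB.instance Definition _ := GRing.Lmodule.copy GG (G * G)%type.

Definition hsum_dot (f g : GG) : C := ⟨f.1, g.1⟩ + ⟨f.2, g.2⟩.

Fact hsum_dot_bilinear :
  bilinear_for (GRing.Scale.Law.clone _ _ *%R _)
    (GRing.Scale.Law.clone _ _ (@Num.conj C \; *%R) _) hsum_dot.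
Proof.
split=> f a g h; rewrite /hsum_dot /=.
  by rewrite !linearPl /= mulrDr addrACA.
by rewrite !linearPr /= mulrDr addrACA.
Qed.
HB.instance Definition _ := bilinear_isBilinear.Build C GG GG C
  (GRing.Scale.Law.clone _ _ *%R _)
  (GRing.Scale.Law.clone _ _ (@Num.conj C \; *%R) _) hsum_dot hsum_dot_bilinear.

Fact hsum_dot_herm (f g : GG) :
  hsum_dot f g = (-1) ^+ false * Num.conj (hsum_dot g f).
Proof.
by rewrite /hsum_dot hermC [X in _ + X]hermC !expr0 !mul1r rmorphD.
Qed.
HB.instance Definition _ :=
  isHermitianSesquilinear.Build C GG false (@Num.conj C) hsum_dot hsum_dot_herm.

Fact hsum_dot_gt0 (f : GG) : f != 0 -> 0 < hsum_dot f f.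
Proof.
case: f => a b; rewrite -pair_eqE negb_and /hsum_dot /= -!dotform_norm => ab.
by case/orP: ab => n0; [apply: ltr_wpDr|apply: ltr_wpDl];
  rewrite ?exprn_ge0 ?exprn_gt0 ?normr_gt0.
Qed.
HB.instance Definition _ := isDotProduct.Build C GG hsum_dot hsum_dot_gt0.

Definition hsum_norm (f : GG) : C := sqrtC (hsum_dot f f).

Fact hsum_normE (f : GG) : hsum_norm f = sqrtC (`|f.1| ^+ 2 + `|f.2| ^+ 2).
Proof. by rewrite /hsum_norm /hsum_dot !dotform_norm. Qed.

Fact hsum_normD (f g : GG) : hsum_norm (f + g) <= hsum_norm f + hsum_norm g.
Proof.
rewrite !hsum_normE; move: f g => [a b] [c d] /=.
set s := `|a + c| ^+ 2 + `|b + d| ^+ 2; set p := `|a| ^+ 2 + `|b| ^+ 2.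
set q := `|c| ^+ 2 + `|d| ^+ 2; change (sqrtC s <= sqrtC p + sqrtC q).
have p0 : 0 <= p by rewrite addr_ge0 ?exprn_ge0.
have q0 : 0 <= q by rewrite addr_ge0 ?exprn_ge0.
have s0 : 0 <= s by rewrite addr_ge0 ?exprn_ge0.
have sp0 : 0 <= sqrtC p by rewrite sqrtC_ge0.
have sq0 : 0 <= sqrtC q by rewrite sqrtC_ge0.
rewrite -(@ler_pXn2r _ 2) ?nnegrE ?sqrtC_ge0 ?addr_ge0 //.
rewrite sqrrD !sqrtCK.
have cs : `|a| * `|c| + `|b| * `|d| <= sqrtC p * sqrtC q.
  rewrite -(@ler_pXn2r _ 2) ?nnegrE ?mulr_ge0 ?addr_ge0 ?mulr_ge0 //.
  rewrite exprMn !sqrtCK -subr_ge0.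
  have -> : p * q - (`|a| * `|c| + `|b| * `|d|) ^+ 2 =
            (`|a| * `|d| - `|b| * `|c|) ^+ 2 by rewrite /p /q; ring.
  by rewrite real_exprn_even_ge0 // rpredB ?rpredM ?normr_real.
have -> : p + sqrtC p * sqrtC q *+ 2 + q = p + q + sqrtC p * sqrtC q *+ 2.
  by rewrite addrAC.
apply: le_trans (_ : p + q + (`|a| * `|c| + `|b| * `|d|) *+ 2 <= _); last first.
  by rewrite lerD2l ler_wMn2r.
have -> : p + q + (`|a| * `|c| + `|b| * `|d|) *+ 2 =
          (`|a| + `|c|) ^+ 2 + (`|b| + `|d|) ^+ 2 by rewrite /p /q; ring.
by rewrite lerD // ler_pXn2r ?nnegrE ?addr_ge0 // ler_normD.
Qed.

Fact hsum_normZ (a : C) (f : GG) : hsum_norm (a *: f) = `|a| * hsum_norm f.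
Proof.
rewrite !hsum_normE /= !normrZ !exprMn -mulrDr sqrtCM ?nnegrE ?addr_ge0 ?exprn_ge0 //.
by rewrite sqrCK.
Qed.

Fact hsum_norm_eq0 (f : GG) : hsum_norm f = 0 -> f = 0.
Proof.
move=> /eqP; rewrite sqrtC_eq0; have [//|/hsum_dot_gt0] := eqVneq f 0.
by rewrite lt0r => /andP[/negPf ->].
Qed.

HB.instance Definition _ :=
  Lmodule_isNormed.Build C GG hsum_normD hsum_normZ hsum_norm_eq0.

Fact hsum_complete (F : set_system GG) : ProperFilter F -> cauchy F -> cvg F.
Proof.
move=> FF Fc.
have fle (f : GG) : `|f.1| <= `|f|.
  rewrite [`|f|]hsum_normE -[X in X <= _]sqrCK // ler_sqrtC ?nnegrE
    ?addr_ge0 ?exprn_ge0 //.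
  by rewrite lerDl exprn_ge0.
have sle (f : GG) : `|f.2| <= `|f|.
  rewrite [`|f|]hsum_normE -[X in X <= _]sqrCK // ler_sqrtC ?nnegrE
    ?addr_ge0 ?exprn_ge0 //.
  by rewrite lerDr exprn_ge0.
have c1 : cvg ((fst : GG -> G) @ F).
  apply: cauchy_cvg; apply/cauchyP => e e0.
  have /cauchyP /(_ e e0)[x Fx] := Fc; exists x.1.
  change (F ((fst : GG -> G) @^-1` ball x.1 e)).
  apply: filterS Fx => y /=; rewrite -!ball_normE /=.
  by apply: le_lt_trans; exact: (fle (x - y)).
have c2 : cvg ((snd : GG -> G) @ F).
  apply: cauchy_cvg; apply/cauchyP => e e0.
  have /cauchyP /(_ e e0)[x Fx] := Fc; exists x.2.
  change (F ((snd : GG -> G) @^-1` ball x.2 e)).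
  apply: filterS Fx => y /=; rewrite -!ball_normE /=.
  by apply: le_lt_trans; exact: (sle (x - y)).
apply/cvg_ex; exists ((lim ((fst : GG -> G) @ F), lim ((snd : GG -> G) @ F)) : GG).
apply/cvgrPdist_lt => e e0.
have e20 : 0 < e / 2 by rewrite divr_gt0.
move/cvgrPdist_lt : c1 => /(_ _ e20) n1.
move/cvgrPdist_lt : c2 => /(_ _ e20) n2.
near=> y.
have h1 : `|lim ((fst : GG -> G) @ F) - y.1| < e / 2 by near: y; exact: n1.
have h2 : `|lim ((snd : GG -> G) @ F) - y.2| < e / 2 by near: y; exact: n2.
rewrite [`|_|]hsum_normE /=.
have e_ge0 := ltW e0.
rewrite -[X in _ < X]sqrCK // ltr_sqrtC ?nnegrE ?exprn_ge0 ?addr_ge0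
  ?exprn_ge0 //.
apply: lt_le_trans (_ : (e / 2) ^+ 2 + (e / 2) ^+ 2 <= _).
  by apply: ltrD; rewrite ltr_pXn2r ?nnegrE // ltW.
rewrite [in leRHS](splitr e) sqrrD addrAC lerDl mulrn_wge0 //.
by rewrite mulr_ge0 // ltW.
Unshelve. all: by end_near. Qed.

HB.instance Definition _ := Uniform_isComplete.Build GG hsum_complete.

Fact hsum_dot_norm (f : GG) : `|f| ^+ 2 = hsum_dot f f.
Proof. by rewrite -[RHS]sqrtCK. Qed.

HB.instance Definition _ := isHilbert.Build R GG hsum_dot_norm.

End HilbertSum.

Definition separable_space (T : topologicalType) :=
  exists2 S : set T, countable S & dense S.

Section BoundedOperators.
Context (R : realType).
Local Notation C := R[i].

(* Norms take their values in R[i]; Re brings them back to R. The supremum is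
   taken in \bar R, so that an unbounded map has norm +oo. *)
Definition opnorm (U V : normedModType C) (f : U -> V) : \bar R :=
  ereal_sup [set (complex.Re `|f x|)%:E | x in [set x | `|x| <= 1]].

Definition unit_itv : set R := `[0, 1].

(* t --> t0 with t != t0 in [0, 1]: one-sided when t0 is an endpoint *)
Local Notation to_unit t0 := (within unit_itv t0^').

Definition opnorm_derivative (U V : normedModType C)
    (F : R -> {linear U -> V}) (t0 : R) (F' : {linear U -> V}) :=
  continuous F' /\
  opnorm (fun x => (t - t0)%:C^-1 *: (F t x - F t0 x) - F' x)
    @[t --> to_unit t0] --> 0%E.

Definition derivative_at (f : R -> C^o) (t0 : R) (d : C^o) :=
  (t - t0)%:C^-1 *: (f t - f t0) @[t --> to_unit t0] --> d.

Context (U V : hilbertType R).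

Definition bounded_adjoint (S : U -> V) (f : V) : U :=
  xget 0 [set w | forall u, ⟨S u, f⟩ = ⟨u, w⟩].

Definition bounded_self_adjoint (S : {linear U -> U}) :=
  continuous S /\ forall u v, ⟨S u, v⟩ = ⟨u, S v⟩.

Definition orthogonal_projection (S : {linear U -> U}) :=
  bounded_self_adjoint S /\ forall u, S (S u) = S u.

End BoundedOperators.

Arguments unit_itv {R}.
Notation to_unit t0 := (within unit_itv t0^').

Section Operators.
Context (R : realType) (H : hilbertType R).
Local Notation C := R[i].

(* Linear operators defined on a subspace of H; the values of opfun outside dom
   carry no meaning. *)
Record operator := Operator {
  dom : set H;
  opfun :> H -> H;
  dom0 : dom 0;
  dom_linear : forall (a : C) u v, dom u -> dom v -> dom (a *: u + v);
  op_linear : forall (a : C) u v, dom u -> dom v ->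
    opfun (a *: u + v) = a *: opfun u + opfun v
}.

Definition extends (A B : operator) :=
  dom A `<=` dom B /\ forall u, dom A u -> B u = A u.

Definition closed_operator (A : operator) :=
  closed [set p : H * H | dom A p.1 /\ A p.1 = p.2].

Definition symmetric_operator (A : operator) :=
  dense (dom A) /\
  forall u v, dom A u -> dom A v -> ⟨A u, v⟩ = ⟨u, A v⟩.

(* When dom A is dense there is at most one w for each v. *)
Definition adjoint_graph (A : operator) (v : H) : set H :=
  [set w | forall u, dom A u -> ⟨A u, v⟩ = ⟨u, w⟩].

Definition adjoint_dom (A : operator) : set H :=
  [set v | adjoint_graph A v !=set0].

Definition adjoint (A : operator) (v : H) : H := xget 0 (adjoint_graph A v).

Definition self_adjoint (A : operator) :=
  [/\ dense (dom A), adjoint_dom A = dom A &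
      forall u, dom A u -> adjoint A u = A u].

Definition lin_span (E : set H) : set H :=
  [set v | exists n (c : 'I_n -> C) (e : 'I_n -> H),
     (forall k, E (e k)) /\ v = \sum_k c k *: e k].

Definition orthonormal_basis (N E : set H) :=
  [/\ E `<=` N, forall u v, E u -> E v -> ⟨u, v⟩ = (u == v)%:R &
      N `<=` closure (lin_span E)].

Definition deficiency_space (A : operator) (z : C) : set H :=
  [set u | adjoint_dom A u /\ adjoint A u = z *: u].

Definition equal_deficiency_indices (A : operator) :=
  exists E F : set H,
    [/\ orthonormal_basis (deficiency_space A 'i%C) E,
        orthonormal_basis (deficiency_space A (- 'i%C)) F & E #= F].

Definition graph_norm (A : operator) (u : H) : C :=
  sqrtC (⟨u, u⟩ + ⟨adjoint A u, adjoint A u⟩).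

Fact add_op_linear (A : operator) (V : {linear H -> H}) (a : C) u v :
  dom A u -> dom A v ->
  A (a *: u + v) + V (a *: u + v) = a *: (A u + V u) + (A v + V v).
Proof. by move=> Au Av; rewrite op_linear // linearP scalerDr addrACA. Qed.

Definition add_op (A : operator) (V : {linear H -> H}) : operator :=
  Operator (opfun := fun u => A u + V u) (dom0 A) (@dom_linear A)
    (@add_op_linear A V).

Definition resolvent_set (A : operator) : set C :=
  [set z | exists S : {linear H -> H},
    [/\ continuous S,
        forall v, dom A (S v) /\ A (S v) - z *: S v = v &
        forall u, dom A u -> S (A u - z *: u) = u]].

Definition spectrum (A : operator) : set C := ~` resolvent_set A.

(* (A - z)^-1 *)
Definition resolvent (A : operator) (z : C) (v : H) : H :=
  xget 0 [set u | dom A u /\ A u - z *: u = v].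

Definition eigspace (A : operator) (z : C) : set H :=
  [set u | dom A u /\ A u = z *: u].

Definition eigval (A : operator) (z : C) :=
  exists2 u, eigspace A z u & u != 0.

Definition has_dim (S : set H) (n : nat) :=
  exists e : 'I_n -> H,
    (forall c : 'I_n -> C, \sum_k c k *: e k = 0 -> forall k, c k = 0) /\
    S = [set \sum_k c k *: e k | c in [set: 'I_n -> C]].

(* +oo when S is empty *)
Definition dist_to (z : C) (S : set C) : \bar R :=
  ereal_inf [set (complex.Re `|z - w|)%:E | w in S].

Definition spectral_disc (A : operator) (lam : C) : set C :=
  [set z | ((2 * complex.Re `|z - lam|)%:E
             < dist_to lam (spectrum A `\ lam))%E].

(* l lists the eigenvalues of A in B, each repeated according to its
   multiplicity. *)
Definition lists_eigenvalues (A : operator) (B : set C) m (l : 'I_m -> C) :=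
  (forall j, B (l j)) /\
  forall z, B z -> has_dim (eigspace A z) #|[pred j | l j == z]|.

End Operators.

Section Symplectic.
Context (R : realType) (G : hilbertType R).

Definition J (f : hsum G) : hsum G := (f.2, - f.1).

Definition omega (f g : hsum G) : R[i] := ⟨J f, g⟩.

Definition Lagrangian (F : set (hsum G)) :=
  F = [set f | forall g, F g -> omega f g = 0].

End Symplectic.

Section FirstOrder.
Context (R : realType) (H G : hilbertType R) (D : completeNormedModType R[i]).

(* The subspace D of H, with its own norm, is given by an injection i. *)
Definition emb_inv (i : D -> H) (u : H) : D := xget 0 [set x | i x = u].

Definition first_order_operator (i : D -> H) (P V' : H -> H)
    (T T' : D -> hsum G) (Q' : hsum G -> hsum G) (u : H) : H :=
  let TP v := T (emb_inv i (P v)) in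
  P (V' (P u)) - bounded_adjoint TP (Q' (J (TP u)))
  - bounded_adjoint TP (J (T' (emb_inv i (P u)))).

Definition orthonormal_eigenbasis (M : H -> H) (S : set H) m
    (l : 'I_m -> R[i]) (u : 'I_m -> H) :=
  [/\ forall j k, ⟨u j, u k⟩ = (j == k)%:R,
      S = [set \sum_k c k *: u k | c in [set: 'I_m -> R[i]]] &
      forall j, M (u j) = l j *: u j].

End FirstOrder.

(* Main.v *)
(* Write H t = AA t + V t and let K be the eigenspace of H t0 at lam.

   No contour integrals are used. If lam is isolated in the spectrum of H t0 then
   |(H t0 - lam) y| >= c |y| on the complement of K, and convergence of the
   resolvents makes the graphs of H t and H t0 close. Hence, for t near t0, every
   unit eigenvector w of H t with eigenvalue in the disc is close to its
   projection p on K, first in H and then, the resolvent of AA t0 being bounded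
   from H to D by the closed graph theorem, in D. Exactly m orthonormal
   eigenvectors occur: the next one is found by minimising |(H t - lam) u| / |u|
   on the complement of those already found.

   For u in K and an eigenpair (nu, w) of H t, Green's identity gives
     (nu - lam) <u, w> = <(V t - V t0) u, w> - omega (T t u) (T t w),
   and the boundary term equals <J (1 - Q t) T t u, T t w>, where (1 - Q t) T t u
   vanishes at t0 and is differentiable. So for an eigenvector u k of T1 the
   number ((nu - lam) / (t - t0) - l1 k) <u k, w> tends to 0. Since the matrix of
   the <u k, w j> is nearly unitary, its determinant is bounded below, and some
   permutation picks entries that are bounded away from 0; it provides the
   labelling. *)

Require Import Defs.
From HB Require Import structures.
From mathcomp Require Import all_boot all_order all_algebra fingroup perm.
From mathcomp Require Import sesquilinear complex.
From mathcomp Require Import ring lra.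
From mathcomp Require Import all_classical all_reals all_analysis.

Set Implicit Arguments.
Unset Strict Implicit.
Unset Printing Implicit Defensive.

Import Order.TTheory GRing.Theory Num.Theory.
Import numFieldNormedType.Exports.

Local Open Scope classical_set_scope.
Local Open Scope complex_scope.
Local Open Scope ring_scope.

(** * Linear expressions *)

(** The hypotheses give only [o(1)] convergence of the resolvents, so neither eigenvectors nor
    spectral projections of [H t] can be differentiated. Every difference quotient therefore acts on
    a fixed vector of [K], and the moving eigenvector enters only through its distance to [K],
    measured in [D] because the traces are bounded on [D] only. No continuous choice of eigenvectors
    is available either: the labelling is chosen anew at each [t], which suffices because the
    estimate is uniform over all eigenpairs in the disc. [T1] is diagonalisable because its form is
    Hermitian: the left side of Green's identity is free of [t], so [omega (T t x) (T t y)] is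
    constant, and a Lagrangian projection satisfies [Q J = J (1 - Q)]; both relations are
    differentiated at [t0]. The radius of the disc is half the distance [d] to the rest of the
    spectrum, so the gap constant has to exceed [d / 2]. Cauchy-Schwarz arguments for quadratic
    forms yield [d / sqrt 2], which is enough though not optimal. *)

Section LinearExpressions.
Context (K : comPzRingType) (V : lmodType K).

Inductive lexpr :=
  | LVar of nat | LZero | LAdd of lexpr & lexpr | LOpp of lexpr
  | LScale of K & lexpr.

Fixpoint leval (env : seq V) (t : lexpr) : V :=
  match t with
  | LVar n => nth 0 env n
  | LZero => 0
  | LAdd a b => leval env a + leval env b
  | LOpp a => - leval env a
  | LScale c a => c *: leval env a
  end.

(** [eqn] stands in place of [==] so that the [cbv] call of the tactic evaluates the comparison of
    indices. *)
Fixpoint lcoef (t : lexpr) (n : nat) : K :=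
  match t with
  | LVar k => if eqn k n then 1 else 0
  | LZero => 0
  | LAdd a b => lcoef a n + lcoef b n
  | LOpp a => - lcoef a n
  | LScale c a => c * lcoef a n
  end.

Fixpoint same_lcoef (k : nat) (s t : lexpr) : Prop :=
  if k is j.+1 then lcoef s j = lcoef t j /\ same_lcoef j s t else True.

Lemma levalE env t :
  leval env t = \sum_(n < size env) lcoef t n *: nth 0 env n.
Proof.
elim: t => [k||a iha b ihb|a iha|c a iha] /=.
- have eqbE n : eqn k n = (k == n) by [].
  have [kn|kn] := ltnP k (size env); last first.
    rewrite nth_default // big1 // => n _; rewrite eqbE ifN ?scale0r //.
    by apply: contraTneq kn => ->; rewrite -ltnNge.
  rewrite (bigD1 (Ordinal kn)) //= eqbE eqxx scale1r big1 ?addr0 // => n kn'.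
  by rewrite eqbE ifN ?scale0r // eq_sym.
- by rewrite big1 // => n _; rewrite scale0r.
- by rewrite iha ihb -big_split; apply: eq_bigr => n _; rewrite scalerDl.
- by rewrite iha -sumrN; apply: eq_bigr => n _; rewrite scaleNr.
- by rewrite iha scaler_sumr; apply: eq_bigr => n _; rewrite scalerA.
Qed.

Lemma leval_eq env s t :
  same_lcoef (size env) s t -> leval env s = leval env t.
Proof.
move=> h; rewrite !levalE; apply: eq_bigr => -[n nk] _ /=; congr (_ *: _).
elim: (size env) h nk => // k ih /= [hk h]; rewrite ltnS leq_eqVlt.
by case/orP => [/eqP -> //|]; exact: ih.
Qed.

End LinearExpressions.

Ltac lindex x env :=
  lazymatch env with
  | x :: _ => constr:(0%N)
  | _ :: ?e => let n := lindex x e in constr:(n.+1)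
  end.

Ltac latoms t env :=
  lazymatch t with
  | (?a + ?b)%R => let e := latoms a env in latoms b e
  | (- ?a)%R => latoms a env
  | (?c *: ?a)%R => latoms a env
  | 0%R => env
  | _ => let rec mem e :=
           lazymatch e with
           | t :: _ => env
           | _ :: ?e' => mem e'
           | _ => constr:(t :: env)
           end in mem env
  end.

Ltac lreify K t env :=
  lazymatch t with
  | (?a + ?b)%R =>
      let a' := lreify K a env in let b' := lreify K b env in
      constr:(@LAdd K a' b')
  | (- ?a)%R => let a' := lreify K a env in constr:(@LOpp K a')
  | (?c *: ?a)%R => let a' := lreify K a env in constr:(@LScale K c a')
  | 0%R => constr:(@LZero K)
  | _ => let n := lindex t env in constr:(@LVar K n)
  end.

(* Decides equalities in a module, up to commutative ring identities between
   the coefficients of the atoms. *)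
Ltac lmod_in K V :=
  lazymatch goal with
  | |- ?s = ?t =>
      let e := latoms s (@nil V) in
      let e := latoms t e in
      let s' := lreify K s e in
      let t' := lreify K t e in
      refine (@leval_eq K V e s' t' _);
      cbv [same_lcoef lcoef size eqn]; repeat split; ring
  end.

Tactic Notation "lmod" constr(R) constr(V) :=
  lmod_in (R[i] : comPzRingType) (V : lmodType R[i]).

(** * Real norms and inner products *)

Section RealNorm.
Context (R : realType).
Local Notation C := R[i].

(** The order of [R[i]] is partial; real values make [lra] and [nra] applicable. *)
Definition rnorm (V : normedZmodType C) (x : V) : R := complex.Re `|x|.

End RealNorm.

Notation "`‖ x ‖" := (rnorm x) (at level 0, x at level 99, format "`‖ x ‖").

Section RealNormTheory.
Context (R : realType).
Local Notation C := R[i].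

Lemma rcD (a b : R) : (a + b)%:C = a%:C + b%:C.
Proof. exact: rmorphD. Qed.

Lemma rcN (a : R) : (- a)%:C = - a%:C.
Proof. exact: rmorphN. Qed.

Lemma rcB (a b : R) : (a - b)%:C = a%:C - b%:C.
Proof. exact: rmorphB. Qed.

Lemma rcM (a b : R) : (a * b)%:C = a%:C * b%:C.
Proof. exact: rmorphM. Qed.

Lemma rcX (a : R) n : (a ^+ n)%:C = a%:C ^+ n.
Proof. exact: rmorphXn. Qed.

Lemma rcV (a : R) : (a^-1)%:C = a%:C^-1.
Proof. exact: fmorphV. Qed.

Section Zmod.
Context (V : normedZmodType C).
Implicit Types x y : V.

Lemma rnormE x : `|x| = `‖x‖%:C.
Proof. by rewrite RRe_real ?normr_real. Qed.

Lemma rnorm_ge0 x : 0 <= `‖x‖.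
Proof. by rewrite -ler0c -rnormE. Qed.

Lemma rnormD x y : `‖x + y‖ <= `‖x‖ + `‖y‖.
Proof. by rewrite -lecR rcD -!rnormE ler_normD. Qed.

Lemma rnormN x : `‖- x‖ = `‖x‖.
Proof. by rewrite /rnorm normrN. Qed.

Lemma rdistC x y : `‖x - y‖ = `‖y - x‖.
Proof. by rewrite /rnorm distrC. Qed.

Lemma rnormB x y : `‖x - y‖ <= `‖x‖ + `‖y‖.
Proof. by rewrite -(rnormN y) rnormD. Qed.

Lemma rdist_triangle z x y : `‖x - y‖ <= `‖x - z‖ + `‖z - y‖.
Proof. by rewrite (le_trans _ (rnormD _ _)) // addrA subrK. Qed.

Lemma rnorm_le_dist x y : `‖x‖ <= `‖x - y‖ + `‖y‖.
Proof. by rewrite -{1}(subrK y x) rnormD. Qed.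

Lemma rnorm0 : `‖0 : V‖ = 0.
Proof. by rewrite /rnorm normr0. Qed.

Lemma rnorm_eq0 x : (`‖x‖ == 0) = (x == 0).
Proof. by rewrite -(inj_eq (@complexI R)) -rnormE normr_eq0. Qed.

Lemma rnorm_gt0 x : (0 < `‖x‖) = (x != 0).
Proof. by rewrite lt0r rnorm_eq0 rnorm_ge0 andbT. Qed.

Lemma rnorm_sum (I : Type) (r : seq I) (P : pred I) (F : I -> V) :
  `‖\sum_(k <- r | P k) F k‖ <= \sum_(k <- r | P k) `‖F k‖.
Proof.
elim/big_ind2 : _ => [|x a y b xa yb|//]; first by rewrite rnorm0.
by rewrite (le_trans (rnormD _ _)) // lerD.
Qed.

End Zmod.

Lemma rnormM (a b : C) : `‖a * b‖ = `‖a‖ * `‖b‖.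
Proof. by apply: complexI; rewrite rcM -!rnormE normrM. Qed.

Lemma rnorm_real (r : R) : `‖r%:C‖ = `|r|.
Proof. by rewrite /rnorm normc_def /= expr0n /= addr0 sqrtr_sqr. Qed.

Lemma rnorm1 : `‖1 : C‖ = 1.
Proof. by rewrite /rnorm normr1. Qed.

Lemma rnorm_i : `‖'i%C : C‖ = 1.
Proof. by rewrite /rnorm normc_def /= expr0n expr1n /= add0r sqrtr1. Qed.

Lemma rnorm_conj (a : C) : `‖a^*%C‖ = `‖a‖.
Proof. by rewrite /rnorm normcJ. Qed.

Lemma ler_normRe (a : C) : `|complex.Re a| <= `‖a‖.
Proof. by rewrite -lecR -rnormE; exact: normc_ge_Re. Qed.

Lemma ler_normIm (a : C) : `|complex.Im a| <= `‖a‖.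
Proof.
have -> : complex.Im a = - complex.Re (a * 'i%C) by rewrite ReiNIm opprK.
by rewrite normrN (le_trans (ler_normRe _)) // rnormM rnorm_i mulr1.
Qed.

Lemma rnorm_le_ReIm (a : C) : `‖a‖ <= `|complex.Re a| + `|complex.Im a|.
Proof.
rewrite {1}[a]complexE; apply: le_trans (rnormD _ _) _.
by rewrite rnormM !rnorm_real rnorm_i mul1r.
Qed.

Lemma rnorm_sqr (a : C) : a * a^*%C = (`‖a‖ ^+ 2)%:C.
Proof. by rewrite -sqr_normc rnormE rcX. Qed.

Lemma rnormZ (V : normedModType C) (a : C) (x : V) : `‖a *: x‖ = `‖a‖ * `‖x‖.
Proof. by apply: complexI; rewrite rcM -!rnormE normrZ. Qed.

Lemma conjE (a : C) : Num.conj a = a^*%C.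
Proof.
have [->|a0] := eqVneq a 0; first by rewrite rmorph0 conjc0.
by apply: (mulfI a0); rewrite -normCK sqr_normc.
Qed.

End RealNormTheory.

(** * Inner products and the Cauchy-Schwarz inequality *)

Section Dot.
Context (R : realType) (H : hilbertType R).
Local Notation C := R[i].
Implicit Types (u v w : H) (a : C) (r : R).

Lemma dotC u v : ⟨u, v⟩ = ⟨v, u⟩^*%C.
Proof. by apply: etrans (hermC _ _ _) _; rewrite expr0 mul1r -conjE. Qed.

Lemma dot0l v : ⟨0, v⟩ = 0. Proof. exact: linear0l. Qed.
Lemma dot0r v : ⟨v, 0⟩ = 0. Proof. exact: linear0r. Qed.
Lemma dotDl u v w : ⟨u + v, w⟩ = ⟨u, w⟩ + ⟨v, w⟩.
Proof. exact: linearDl. Qed.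
Lemma dotDr u v w : ⟨w, u + v⟩ = ⟨w, u⟩ + ⟨w, v⟩.
Proof. exact: linearDr. Qed.
Lemma dotBl u v w : ⟨u - v, w⟩ = ⟨u, w⟩ - ⟨v, w⟩.
Proof. exact: linearBl. Qed.
Lemma dotBr u v w : ⟨w, u - v⟩ = ⟨w, u⟩ - ⟨w, v⟩.
Proof. exact: linearBr. Qed.
Lemma dotNl u w : ⟨- u, w⟩ = - ⟨u, w⟩. Proof. exact: linearNl. Qed.
Lemma dotNr u w : ⟨w, - u⟩ = - ⟨w, u⟩. Proof. exact: linearNr. Qed.
Lemma dotZl a u w : ⟨a *: u, w⟩ = a * ⟨u, w⟩.
Proof. exact: linearZl_LR. Qed.
Lemma dotZr a u w : ⟨w, a *: u⟩ = a^*%C * ⟨w, u⟩.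
Proof. by apply: etrans (linearZr_LR _ _ _ _) _; rewrite /= conjE. Qed.

Lemma dot_suml (I : Type) (r : seq I) (P : pred I) (F : I -> H) w :
  ⟨\sum_(k <- r | P k) F k, w⟩ = \sum_(k <- r | P k) ⟨F k, w⟩.
Proof.
by apply: (big_morph (fun u => ⟨u, w⟩)) => [u v|]; [exact: dotDl|exact: dot0l].
Qed.

Lemma dot_sumr (I : Type) (r : seq I) (P : pred I) (F : I -> H) w :
  ⟨w, \sum_(k <- r | P k) F k⟩ = \sum_(k <- r | P k) ⟨w, F k⟩.
Proof.
by apply: (big_morph (fun u => ⟨w, u⟩)) => [u v|]; [exact: dotDr|exact: dot0r].
Qed.

Lemma dotE u : ⟨u, u⟩ = (`‖u‖ ^+ 2)%:C.
Proof. by rewrite -dotform_norm rnormE rcX. Qed.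

Lemma dot_eq0 u : ⟨u, u⟩ = 0 -> u = 0.
Proof.
by rewrite dotE => /complexI /eqP; rewrite expf_eq0 /= rnorm_eq0 => /eqP.
Qed.

(** The underlying real inner product: the extremal arguments vary a real parameter, and [dot_rdot]
    recovers the complex product. *)
Definition rdot u v : R := complex.Re ⟨u, v⟩.

Lemma rdotC u v : rdot u v = rdot v u.
Proof. by rewrite /rdot dotC; case: ⟨v, u⟩. Qed.
Lemma rdotDl u v w : rdot (u + v) w = rdot u w + rdot v w.
Proof. by rewrite /rdot dotDl raddfD. Qed.
Lemma rdotDr u v w : rdot w (u + v) = rdot w u + rdot w v.
Proof. by rewrite /rdot dotDr raddfD. Qed.
Lemma rdotBl u v w : rdot (u - v) w = rdot u w - rdot v w.
Proof. by rewrite /rdot dotBl raddfB. Qed.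
Lemma rdotBr u v w : rdot w (u - v) = rdot w u - rdot w v.
Proof. by rewrite /rdot dotBr raddfB. Qed.
Lemma rdotZl r u w : rdot (r%:C *: u) w = r * rdot u w.
Proof. by rewrite /rdot dotZl; case: ⟨u, w⟩ => x y /=; rewrite mul0r subr0. Qed.
Lemma rdotZr r u w : rdot w (r%:C *: u) = r * rdot w u.
Proof. by rewrite rdotC rdotZl rdotC. Qed.
Lemma rdotE u : rdot u u = `‖u‖ ^+ 2.
Proof. by rewrite /rdot dotE. Qed.

Lemma rnormD_sqr u v :
  `‖u + v‖ ^+ 2 = `‖u‖ ^+ 2 + 2 * rdot u v + `‖v‖ ^+ 2.
Proof. by rewrite -!rdotE rdotDl !rdotDr (rdotC v u); ring. Qed.

Lemma rnormB_sqr u v :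
  `‖u - v‖ ^+ 2 = `‖u‖ ^+ 2 - 2 * rdot u v + `‖v‖ ^+ 2.
Proof. by rewrite -!rdotE rdotBl !rdotBr (rdotC v u); ring. Qed.

Lemma parallelogram u v :
  `‖u + v‖ ^+ 2 + `‖u - v‖ ^+ 2 = 2 * `‖u‖ ^+ 2 + 2 * `‖v‖ ^+ 2.
Proof. by rewrite rnormD_sqr rnormB_sqr; ring. Qed.

(** Applied to [r |-> q (u + r v)], this is the Cauchy-Schwarz inequality of a nonnegative form
    [q]. *)
Lemma quadratic_disc (a b c : R) :
  (forall r, 0 <= a + 2 * b * r + c * r ^+ 2) -> b ^+ 2 <= a * c.
Proof.
move=> h; have [c0|c0|c0] := ltgtP c 0.
- have a0 : 0 <= a by have := h 0; rewrite expr0n /= !mulr0 !addr0.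
  (* A negative [c] is impossible: the values at [1 + t] and [- (1 + t)] add up to
     [2 (c - a - a t) < 0]. *)
  set t := a / - c; have t0 : 0 <= t by rewrite divr_ge0 // oppr_ge0 ltW.
  have tc : t * c = - a by rewrite /t; field; rewrite lt_eqF.
  have := h (1 + t); have := h (- (1 + t)).
  have -> : a + 2 * b * - (1 + t) + c * (- (1 + t)) ^+ 2 =
    a - 2 * b * (1 + t) + c + (t * c) * (2 + t) by ring.
  have -> : a + 2 * b * (1 + t) + c * (1 + t) ^+ 2 =
    a + 2 * b * (1 + t) + c + (t * c) * (2 + t) by ring.
  by rewrite tc; nra.
- have := h (- b / c); have -> : a + 2 * b * (- b / c) + c * (- b / c) ^+ 2 =
    (a * c - b ^+ 2) / c by field; rewrite gt_eqF.
  by rewrite pmulr_lge0 ?invr_gt0 // subr_ge0.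
- have [-> |b0] := eqVneq b 0; first by rewrite c0 expr0n mulr0.
  have := h (- (a + 1) / (2 * b)).
  have -> : a + 2 * b * (- (a + 1) / (2 * b)) + c * (- (a + 1) / (2 * b)) ^+ 2
     = -1 by rewrite c0; field.
  by lra.
Qed.

Lemma rdot_cauchy u v : `|rdot u v| <= `‖u‖ * `‖v‖.
Proof.
rewrite -(@ler_pXn2r _ 2) ?nnegrE ?mulr_ge0 ?rnorm_ge0 // real_normK ?num_real //.
rewrite exprMn; apply: quadratic_disc => r.
have : 0 <= `‖u + r%:C *: v‖ ^+ 2 by rewrite exprn_ge0 ?rnorm_ge0.
by rewrite rnormD_sqr rdotZr rnormZ rnorm_real exprMn real_normK ?num_real //; lra.
Qed.

Lemma dot_cauchy u v : `‖⟨u, v⟩‖ <= `‖u‖ * `‖v‖.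
Proof.
have [->|c0] := eqVneq `‖⟨u, v⟩‖ 0; first by rewrite mulr_ge0 ?rnorm_ge0.
have cp : 0 < `‖⟨u, v⟩‖ by rewrite lt0r c0 rnorm_ge0.
rewrite -(ler_pM2l cp) mulrA -[leLHS]expr2.
have -> : `‖⟨u, v⟩‖ ^+ 2 = rdot (⟨u, v⟩^*%C *: u) v.
  by rewrite /rdot dotZl mulrC rnorm_sqr.
by rewrite (le_trans (ler_norm _)) // (le_trans (rdot_cauchy _ _)) // rnormZ rnorm_conj.
Qed.

Lemma dot_rdot u v : ⟨u, v⟩ = (rdot u v)%:C + 'i%C * (rdot u ('i%C *: v))%:C.
Proof.
rewrite {1}[⟨u, v⟩]complexE; congr (_ + 'i%C * _%:C).
by rewrite /rdot dotZr; case: ⟨u, v⟩ => x y /=; rewrite mul0r; ring.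
Qed.

End Dot.

(** * Completeness *)

Section Completeness.
Context (R : realType).
Local Notation C := R[i].

(** Stated for an arbitrary filter, since it serves for sequences, for filters of approximate
    solutions and for an ultrafilter. *)
Lemma rcomplete (U : completeNormedModType C) (T : Type) (F : set_system T)
    (FF : ProperFilter F) (u : T -> U) :
  (forall e : R, 0 < e ->
    exists2 A, F A & forall x y, A x -> A y -> `‖u x - u y‖ < e) ->
  exists l, forall e : R, 0 < e -> F [set x | `‖u x - l‖ < e].
Proof.
move=> h; have : cvg (u @ F).
  apply: cauchy_cvg; apply: cauchy_exP => e.
  rewrite ltcE => /andP[/eqP /= e0 ep].
  have [A FA hA] := h _ ep; have [x Ax] := filter_ex FA.
  exists (u x); apply: filterS FA => y Ay /=.
  by rewrite -ball_normE /= rnormE ltcE /= e0 eqxx hA.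
move=> /cvg_ex[l /cvgrPdist_lt hl]; exists l => e e0.
have := hl e%:C; rewrite ltcR => /(_ e0).
by apply: filterS => x; rewrite rnormE ltcR rdistC.
Qed.

Lemma rcomplete_seq (U : completeNormedModType C) (u : nat -> U) :
  (forall e : R, 0 < e ->
    exists n, forall p q, (n <= p)%N -> (n <= q)%N -> `‖u p - u q‖ < e) ->
  exists l, forall e : R, 0 < e ->
    exists n, forall p, (n <= p)%N -> `‖u p - l‖ < e.
Proof.
move=> h; have [|l hl] := @rcomplete U nat \oo _ u.
  by move=> e /h[n hn]; exists [set p | (n <= p)%N] => //; exists n.
exists l => e e0; have [n _ hn] := hl _ e0.
by exists n => p np; exact: hn.
Qed.

(** The sets of near-minimisers at level [e] form a filter base, which takes the place of a
    minimising sequence. *)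
Lemma eps_filter_proper (T : Type) (S : R -> set T) :
  (forall e, 0 < e -> S e !=set0) ->
  (forall e e', e <= e' -> S e `<=` S e') ->
  ProperFilter (filter_from [set e : R | 0 < e] S).
Proof.
move=> S0 Sle; apply: filter_from_proper => //.
apply: filter_from_filter; first by exists 1 => /=.
move=> e e' /= e0 e'0; exists (Num.min e e'); first by rewrite /= lt_min e0.
by move=> x Sx; split; apply: Sle Sx; rewrite ge_min lexx ?orbT.
Qed.

Lemma rcomplete_eps (U : completeNormedModType C) (S : R -> set U) :
  (forall e, 0 < e -> S e !=set0) ->
  (forall e e', e <= e' -> S e `<=` S e') ->
  (forall e, 0 < e -> exists2 d, 0 < d &
    forall x y, S d x -> S d y -> `‖x - y‖ < e) ->
  exists l, forall e d, 0 < e -> 0 < d -> exists2 x, S d x & `‖x - l‖ < e.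
Proof.
move=> S0 Sle Sc; have FF := eps_filter_proper S0 Sle.
have [|l hl] := @rcomplete U U _ FF id.
  by move=> e /Sc[d d0 hd]; exists (S d) => //; exists d.
exists l => e d e0 d0.
have [x [xl Sx]] := filter_ex (filterI (hl _ e0)
  (ex_intro2 _ _ d d0 (fun=> id) : filter_from _ S (S d))).
by exists x.
Qed.

(** [M] is not assumed closed, so the nearest point [l] is only a limit of points of [M]. *)
Lemma orthogonal_decomposition (H : hilbertType R) (M : set H) (w : H) :
  M 0 -> (forall (a : C) u v, M u -> M v -> M (a *: u + v)) ->
  exists l, (forall e : R, 0 < e -> exists2 m, M m & `‖m - l‖ < e) /\
    forall m, M m -> ⟨w - l, m⟩ = 0.
Proof.
move=> M0 ML; pose E := [set `‖w - m‖ | m in M].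
have Einf : has_inf E.
  by split; [exists `‖w - 0‖, 0|exists 0 => _ [m _ <-]; exact: rnorm_ge0].
set d := inf E.
have dle m : M m -> d <= `‖w - m‖ by move=> Mm; apply: ge_inf; [exact: Einf.2|exists m].
have d0 : 0 <= d.
  by apply: lb_le_inf; [exact: Einf.1|move=> _ [m _ <-]; exact: rnorm_ge0].
pose S (e : R) := [set m | M m /\ `‖w - m‖ < d + e].
have S_neq0 e : 0 < e -> S e !=set0.
  by move=> e0; have [_ [m Mm <-] hm] := inf_adherent e0 Einf; exists m.
have Sle e e' : e <= e' -> S e `<=` S e'.
  by move=> ee' m [Mm hm]; split=> //; apply: lt_le_trans hm _; rewrite lerD2l.
have [|l hl] := rcomplete_eps S_neq0 Sle.
  (* The parallelogram law gives [‖m - m'‖^2 < 4 (d + h)^2 - 4 d^2 = 8 d h + 4 h^2], at most [e^2]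
     once [h <= 1] and [h (8 d + 4) <= e^2]. *)
  move=> e e0; pose h := e ^+ 2 / (8 * d + 4 + e ^+ 2).
  have D0 : 0 < 8 * d + 4 + e ^+ 2 by nra.
  have h0 : 0 < h by rewrite divr_gt0 // exprn_gt0.
  have h1 : h <= 1 by rewrite ler_pdivrMr // mul1r; lra.
  have hE : h * (8 * d + 4 + e ^+ 2) = e ^+ 2 by rewrite divfK // gt_eqF.
  exists h => //.
  move=> m m' [Mm hm] [Mm' hm']; rewrite -(@ltr_pXn2r _ 2) ?nnegrE ?rnorm_ge0 ?ltW //.
  have := parallelogram (w - m) (w - m').
  have -> : w - m - (w - m') = - (m - m') by lmod R H.
  have Mh : M ((2^-1)%:C *: m + (2^-1)%:C *: m').
    by apply: (ML) => //; rewrite -[_ *: m']addr0; exact: ML.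
  have -> : w - m + (w - m') = 2%:C *: (w - ((2^-1)%:C *: m + (2^-1)%:C *: m')).
    rewrite !scalerBr !scalerDr !scalerA -!rcM mulfV ?pnatr_eq0 // rcD; lmod R H.
  rewrite rnormZ rnorm_real rnormN exprMn normr_nat.
  have := dle _ Mh; set q := `‖w - _‖ in hm *; set q' := `‖w - _‖ in hm' *.
  set q2 := `‖w - _‖; move=> dq2.
  have := rnorm_ge0 (w - m); have := rnorm_ge0 (w - m'); rewrite -/q -/q'.
  by nra.
have lM e : 0 < e -> exists2 m, M m & `‖m - l‖ < e.
  by move=> e0; have [m [Mm _] ml] := hl _ _ e0 ltr01; exists m.
exists l; split=> // m Mm.
have wl : `‖w - l‖ <= d.
  apply/ler_addgt0Pr => e e0; have e2 : 0 < e / 2 by rewrite divr_gt0.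
  have [m' [Mm' wm'] ml] := hl _ _ e2 e2.
  by have := rdist_triangle m' w l; lra.
(* Moving [l] by [r m1] does not decrease the distance, so a quadratic in [r] without constant term
   stays nonnegative and its linear term vanishes. *)
have key m1 : M m1 -> rdot (w - l) m1 = 0.
  move=> Mm1; have : (- rdot (w - l) m1) ^+ 2 <= 0 * `‖m1‖ ^+ 2.
    apply: quadratic_disc => r.
    have : d <= `‖w - l - r%:C *: m1‖.
      apply/ler_addgt0Pr => e /lM[m' Mm' m'l].
      have /dle : M (r%:C *: m1 + m') by exact: ML.
      have -> : w - (r%:C *: m1 + m') = w - l - r%:C *: m1 - (m' - l) by lmod R H.
      by move=> h; apply: le_trans h _; rewrite (le_trans (rnormB _ _)) // lerD2l ltW.
    have := rnorm_ge0 (w - l); have := rnormB_sqr (w - l) (r%:C *: m1).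
    rewrite rdotZr rnormZ rnorm_real exprMn real_normK ?num_real //.
    by set x := `‖_‖; set y := `‖w - l‖; nra.
  by rewrite mul0r sqrrN => h; apply/eqP; rewrite -sqrf_eq0 eq_le h sqr_ge0.
rewrite dot_rdot !key //=; first by rewrite mulr0 addr0.
by rewrite -[_ *: m]addr0; exact: ML.
Qed.

End Completeness.

(** * Self-adjoint operators *)

Section SelfAdjoint.
Context (R : realType) (H : hilbertType R).
Local Notation C := R[i].
Implicit Types (A : operator H) (u v w y : H).

Lemma dom_add A u v : dom A u -> dom A v -> dom A (u + v).
Proof. by move=> Au Av; rewrite -[u]scale1r; exact: dom_linear. Qed.

Lemma dom_scale A (a : C) u : dom A u -> dom A (a *: u).
Proof. by move=> Au; rewrite -[_ *: u]addr0; exact: dom_linear (dom0 A). Qed.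

Lemma dom_sub A u v : dom A u -> dom A v -> dom A (u - v).
Proof. by move=> Au Av; apply: dom_add => //; rewrite -scaleN1r; exact: dom_scale. Qed.

Lemma dom_sum A (I : Type) (r : seq I) (P : pred I) (F : I -> H) :
  (forall k, P k -> dom A (F k)) -> dom A (\sum_(k <- r | P k) F k).
Proof. by move=> h; elim/big_ind : _ => //; [exact: dom0|exact: dom_add]. Qed.

Lemma op_add A u v : dom A u -> dom A v -> A (u + v) = A u + A v.
Proof. by move=> Au Av; rewrite -{1}[u]scale1r op_linear // scale1r. Qed.

Lemma op0 A : A 0 = 0.
Proof.
apply: (@addrI _ (A 0)); rewrite -(op_add (dom0 A) (dom0 A)) !addr0.
by [].
Qed.

Lemma op_scale A (a : C) u : dom A u -> A (a *: u) = a *: A u.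
Proof.
by move=> Au; rewrite -[_ *: u]addr0 op_linear ?op0 ?addr0 //; exact: dom0.
Qed.

Lemma op_sub A u v : dom A u -> dom A v -> A (u - v) = A u - A v.
Proof.
move=> Au Av; rewrite op_add //; last by rewrite -scaleN1r; exact: dom_scale.
by rewrite -scaleN1r op_scale // scaleN1r.
Qed.

Lemma op_sum A (I : Type) (r : seq I) (P : pred I) (F : I -> H) :
  (forall k, P k -> dom A (F k)) ->
  A (\sum_(k <- r | P k) F k) = \sum_(k <- r | P k) A (F k).
Proof.
move=> h; elim: r => [|k r ih]; first by rewrite !big_nil op0.
rewrite !big_cons; case: ifPn => // Pk; rewrite op_add ?ih //; first exact: h.
exact: dom_sum.
Qed.

(* The second clause is dom A^* <= dom A, stated without the adjoint. *)
Definition selfadj A :=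
  (forall u v, dom A u -> dom A v -> ⟨A u, v⟩ = ⟨u, A v⟩) /\
  (forall u y, (forall v, dom A v -> ⟨A v, u⟩ = ⟨v, y⟩) -> dom A u /\ A u = y).

Lemma dense_rnorm (S : set H) : dense S ->
  forall x (e : R), 0 < e -> exists2 s, S s & `‖s - x‖ < e.
Proof.
move=> Sd x e e0; have e0C : 0 < e%:C by rewrite ltcR.
have [|s [+ Ss]] := Sd (ball x e%:C) _ (ball_open x _).
  by exists x; exact: ballxx.
by rewrite -ball_normE /= rnormE ltcR rdistC; exists s.
Qed.

(** The factor [c] absorbs the constants of an estimate, so that [e] need not be divided by them
    beforehand. *)
Lemma rnorm_eq0_eps (V : normedZmodType C) (x : V) (c : R) :
  (forall e : R, 0 < e -> `‖x‖ <= e * c) -> x = 0.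
Proof.
move=> h; apply/eqP; rewrite -rnorm_eq0 eq_le rnorm_ge0 andbT.
apply/ler_addgt0Pr => e e0; rewrite add0r.
have c0 : 0 < `|c| + 1 by rewrite ltr_wpDl.
apply: le_trans (h (e / (`|c| + 1)) (divr_gt0 e0 c0)) _.
rewrite mulrAC ler_pdivrMr // ler_pM2l //.
by rewrite (le_trans (ler_norm _)) // lerDl.
Qed.

Lemma dense_orth (S : set H) y : dense S ->
  (forall v, S v -> ⟨v, y⟩ = 0) -> y = 0.
Proof.
move=> Sd Sy; have [->//|y0] := eqVneq y 0.
have yp : 0 < `‖y‖ by rewrite rnorm_gt0.
have [s Ss sy] := dense_rnorm Sd y yp.
have : ⟨y, y⟩ = ⟨y - s, y⟩ by rewrite dotBl (Sy s) // subr0.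
rewrite dotE => /(congr1 (@complex.Re R)) /= yE.
have := rdot_cauchy (y - s) y; rewrite /rdot -yE rdistC.
rewrite ger0_norm ?exprn_ge0 ?rnorm_ge0 // expr2 ler_pM2r // => h.
by have := le_lt_trans h sy; rewrite ltxx.
Qed.

Lemma self_adjoint_selfadj A : self_adjoint A -> selfadj A.
Proof.
case=> Ad Adom AE; have Agr u : dom A u -> adjoint_graph A u (A u).
  move=> Au; rewrite -[X in adjoint_graph _ _ X]AE //.
  by have [w] : adjoint_dom A u; [rewrite Adom|exact: xgetI].
split=> [u v Au Av|u y h]; first exact: Agr.
have Au : dom A u by rewrite -Adom; exists y.
split=> //; apply/eqP; rewrite -subr_eq0; apply/eqP; apply: (dense_orth Ad) => v Av.
by rewrite dotBr -h // -(Agr u Au) // subrr.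
Qed.

Lemma adjoint_extends A B v : dense (dom A) -> extends A B -> selfadj B ->
  dom B v -> adjoint A v = B v.
Proof.
move=> Ad [AB BE] [Bs _] Bv.
have h : adjoint_graph A v (B v) by move=> u Au; rewrite -BE // Bs //; exact: AB.
have h' : adjoint_graph A v (adjoint A v) by exact: xgetI h.
apply/eqP; rewrite -subr_eq0; apply/eqP; apply: (dense_orth Ad) => u Au.
by rewrite dotBr -h // -h' // subrr.
Qed.

Lemma selfadj_add_op A (V : {linear H -> H}) : selfadj A ->
  (forall u v, ⟨V u, v⟩ = ⟨u, V v⟩) -> selfadj (add_op A V).
Proof.
move=> [As Am] Vs; split=> [u v Au Av|u y h] /=.
  by rewrite dotDl dotDr As // Vs.
have [|Au AE] := Am u (y - V u); last by rewrite AE subrK.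
by move=> v Av; rewrite dotBr -Vs -h //= dotDl addrK.
Qed.

Lemma selfadj_closed A u y : selfadj A ->
  (forall e : R, 0 < e ->
    exists w, [/\ dom A w, `‖w - u‖ < e & `‖A w - y‖ < e]) ->
  dom A u /\ A u = y.
Proof.
move=> [As Am] h; apply: Am => v Av; apply/eqP; rewrite -subr_eq0; apply/eqP.
apply: (@rnorm_eq0_eps _ _ (`‖A v‖ + `‖v‖)) => e /h[w [Aw wu wy]].
have -> : ⟨A v, u⟩ - ⟨v, y⟩ = ⟨A v, u - w⟩ + ⟨v, A w - y⟩.
  by rewrite !dotBr (As v w) // addrA subrK.
apply: le_trans (rnormD _ _) _; rewrite mulrDr !(mulrC e).
by apply: lerD; apply: le_trans (dot_cauchy _ _) _;
  rewrite ler_wpM2l ?rnorm_ge0 // ?(rdistC u) ltW.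
Qed.

Lemma selfadj_shift_sqr A u : selfadj A -> dom A u ->
  `‖A u - 'i%C *: u‖ ^+ 2 = `‖A u‖ ^+ 2 + `‖u‖ ^+ 2.
Proof.
move=> [As _] Au; rewrite rnormB_sqr rnormZ rnorm_i mul1r.
suff -> : rdot (A u) ('i%C *: u) = 0 by rewrite mulr0 subr0.
have : complex.Im ⟨A u, u⟩ = 0.
  by have := congr1 (@complex.Im R) (As _ _ Au Au); rewrite [in RHS]dotC /=;
    case: ⟨A u, u⟩ => a b /=; lra.
by rewrite /rdot dotZr; case: ⟨A u, u⟩ => a b /= ->; rewrite mulr0 mul0r subr0.
Qed.

(** The range of [A - i] is dense, since a vector orthogonal to it would be an eigenvector of [A]
    for [-i]; it is closed, since [selfadj_shift_sqr] bounds preimages by images. *)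
Lemma selfadj_surj A h : selfadj A ->
  exists u, dom A u /\ A u - 'i%C *: u = h.
Proof.
move=> sA; have [As Am] := sA.
pose M := [set A u - 'i%C *: u | u in dom A].
have M0 : M 0 by exists 0; [exact: dom0|rewrite op0 scaler0 subr0].
have ML (a : C) u v : M u -> M v -> M (a *: u + v).
  move=> [u' Au <-] [v' Av <-]; exists (a *: u' + v'); first exact: dom_linear.
  by rewrite op_linear //; lmod R H.
have [l [lM lo]] := orthogonal_decomposition h M0 ML.
have hl0 : h - l = 0.
  have [|Ad AE] := Am (h - l) (- 'i%C *: (h - l)).
    move=> v Av; have := lo _ (ex_intro2 _ _ v Av erefl).
    rewrite dotC => /(congr1 (@conjc R)); rewrite conjcK conjc0 dotBl dotZl.
    move/eqP; rewrite subr_eq0 => /eqP ->.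
    by rewrite dotZr; congr (_ * _); apply/eqP; rewrite eq_complex /= oppr0 opprK !eqxx.
  apply/eqP; rewrite -rnorm_eq0 -sqrf_eq0 -(inj_eq (@complexI R)) -dotE.
  have := As _ _ Ad Ad; rewrite AE dotZl dotZr.
  case: ⟨_, _⟩ => a b /eqP; rewrite !eq_complex /= => /andP[/eqP h1 /eqP h2].
  by apply/andP; split; apply/eqP; lra.
move/eqP : hl0; rewrite subr_eq0 => /eqP hl; rewrite -hl in lM.
pose S (e : R) := [set u | dom A u /\ `‖A u - 'i%C *: u - h‖ < e].
have [|e e' ee' u [Au uh]|e e0|u hu] := @rcomplete_eps R H S.
- by move=> e /lM[_ [u Au <-] uh]; exists u.
- by split=> //; exact: lt_le_trans ee'.
- exists (e / 2) => [|u v [Au hu] [Av hv]]; first by rewrite divr_gt0.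
  have := selfadj_shift_sqr sA (dom_sub Au Av); rewrite op_sub //.
  have := rnormB (A u - 'i%C *: u - h) (A v - 'i%C *: v - h).
  have -> : A u - 'i%C *: u - h - (A v - 'i%C *: v - h) =
    A u - A v - 'i%C *: (u - v) by lmod R H.
  have := rnorm_ge0 (u - v); have := rnorm_ge0 (A u - A v).
  have := rnorm_ge0 (A u - A v - 'i%C *: (u - v)).
  by move: hu hv; nra.
have [|Au AE] := @selfadj_closed A u (h + 'i%C *: u) sA.
  move=> e e0; have e2 : 0 < e / 2 by rewrite divr_gt0.
  have [w [Aw wh] wu] := hu _ _ e2 e2; exists w; split=> //; first by lra.
  have -> : A w - (h + 'i%C *: u) = A w - 'i%C *: w - h + 'i%C *: (w - u).
    by lmod R H.
  by apply: le_lt_trans (rnormD _ _) _; rewrite rnormZ rnorm_i mul1r; lra.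
by exists u; rewrite AE addrK.
Qed.

End SelfAdjoint.

(** * Spectral gaps *)

Section SpectralGap.
Context (R : realType).
Local Notation C := R[i].

Lemma continuous_rbounded (U V : normedModType C) (f : {linear U -> V}) :
  continuous f -> exists2 c : R, 0 < c & forall x, `‖f x‖ <= c * `‖x‖.
Proof.
move=> /(_ 0) /cvgrPdist_lt /(_ 1 ltr01).
move=> /(@nbhs_ballP C U) [d /= + hd]; rewrite ltcE => /andP[/eqP /= d0 dp].
set e := complex.Re d in dp.
have de : d = e%:C by rewrite [d]complexE d0 mulr0 addr0.
have small x : `‖x‖ < e -> `‖f x‖ < 1.
  move=> xe; have /hd : ball 0 d x.
    by rewrite -ball_normE /= sub0r normrN rnormE de ltcR.
  by rewrite /= linear0 sub0r normrN rnormE (ltcR _ 1).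
exists (2 / e); first by rewrite divr_gt0.
move=> x; have [->|x0] := eqVneq x 0; first by rewrite linear0 !rnorm0 mulr0.
have xp : 0 < `‖x‖ by rewrite rnorm_gt0.
have tp : 0 < e / (2 * `‖x‖) by rewrite divr_gt0 // mulr_gt0.
have := small ((e / (2 * `‖x‖))%:C *: x).
rewrite linearZ /= !rnormZ !rnorm_real (ger0_norm (ltW tp)).
have -> : e / (2 * `‖x‖) * `‖x‖ = e / 2 by field; rewrite gt_eqF.
move=> /(_ _)/ltW h; have e2 : e / 2 < e by lra.
have := h e2; rewrite -ler_pdivlMl // mulr1 invf_div => /le_trans; apply.
by rewrite mulrAC.
Qed.

Context (H : hilbertType R) (A : operator H) (sA : selfadj A).
Implicit Types (u v w y : H).

(* With r0 the best constant, q(y) = |(A - mu) y|^2 - r0^2 |y|^2 is a nonnegative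
   form; since mu - r0 and mu + r0 lie in the resolvent set, Cauchy-Schwarz
   bounds q below by a multiple of |y|^2, so r0 could be increased. *)
Lemma resolvent_real_bound (mu s : R) :
  (forall z : R, `|z - mu| < s -> resolvent_set A z%:C) ->
  forall y, dom A y -> s * `‖y‖ <= `‖A y - mu%:C *: y‖.
Proof.
move=> res y0 Ay0; have [As Am] := sA; rewrite leNgt; apply/negP => lty0.
have y0p : 0 < `‖y0‖.
  rewrite lt0r rnorm_ge0 andbT; apply: contraTneq lty0 => ->.
  by rewrite mulr0 -leNgt rnorm_ge0.
pose E := [set r : R | forall y, dom A y -> r * `‖y‖ <= `‖A y - mu%:C *: y‖].
have E0 : E 0 by move=> y _; rewrite mul0r rnorm_ge0.
have Eub y r : dom A y -> 0 < `‖y‖ -> E r -> r <= `‖A y - mu%:C *: y‖ / `‖y‖.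
  by move=> Ay yp Er; rewrite ler_pdivlMr // Er.
have Esup : has_sup E by split; [exists 0|exists (`‖A y0 - mu%:C *: y0‖ / `‖y0‖) => r; exact: Eub].
set r0 := sup E; have r0_ge0 : 0 <= r0 by apply: ub_le_sup => //; exact: Esup.2.
have r0s : r0 < s.
  apply: (@le_lt_trans _ _ (`‖A y0 - mu%:C *: y0‖ / `‖y0‖)); last by rewrite ltr_pdivrMr.
  by apply: ge_sup => [|r]; [exact: Esup.1|exact: Eub].
have [Sp [/continuous_rbounded[cp cp0 Sp_le] Spd _]] : resolvent_set A (mu + r0)%:C.
  by apply: res; rewrite addrC addKr ger0_norm.
have [Sm [/continuous_rbounded[cm cm0 Sm_le] Smd _]] : resolvent_set A (mu - r0)%:C.
  by apply: res; rewrite addrC addKr normrN ger0_norm.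
have Er0 : E r0.
  move=> y Ay; have [->|y_neq0] := eqVneq `‖y‖ 0; first by rewrite mulr0 rnorm_ge0.
  have yp : 0 < `‖y‖ by rewrite lt0r y_neq0 rnorm_ge0.
  rewrite -ler_pdivlMr //; apply: ge_sup => [|r]; [exact: Esup.1|exact: Eub].
pose k := cm + r0 * (cp * cm).
have kp : 0 < k by rewrite ltr_wpDr // !mulr_ge0 // ltW.
suff Er1 : E (Num.sqrt (r0 ^+ 2 + k ^- 2)).
  have : Num.sqrt (r0 ^+ 2 + k ^- 2) <= r0 by apply: ub_le_sup => //; exact: Esup.2.
  apply/negP; rewrite -ltNge -{1}[r0](ger0_norm r0_ge0) -sqrtr_sqr ltr_sqrt.
    by rewrite ltrDl invr_gt0 exprn_gt0.
  by rewrite ltr_wpDl ?sqr_ge0 // invr_gt0 exprn_gt0.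
move=> u Au; pose Z y := A y - mu%:C *: y.
have ZB y v r : dom A y -> dom A v -> Z (y + r%:C *: v) = Z y + r%:C *: Z v.
  by move=> Ay Av; rewrite /Z op_add ?op_scale //; [lmod R H|exact: dom_scale].
(* Here [(Z + r0) x = u] and [(Z - r0) v = x], so [(Z^2 - r0^2) v = u] and the form [q] pairs [u]
   with [v] to [‖u‖^2]. *)
pose x := Sm u; pose v := Sp x.
have [Ax xE] := Smd u; have [Av vE] := Spd x; rewrite -/x -/v in Ax xE Av vE.
have Zx : Z x = u - r0%:C *: x by rewrite -xE /Z rcB; lmod R H.
have Zv : Z v = x + r0%:C *: v by rewrite -{1}vE /Z rcD; lmod R H.
have Zs y y' : dom A y -> dom A y' -> rdot (Z y) y' = rdot y (Z y').
  by move=> Ay Ay'; rewrite /Z rdotBl rdotBr rdotZl rdotZr /rdot As.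
have quv : rdot (Z u) (Z v) - r0 ^+ 2 * rdot u v = `‖u‖ ^+ 2.
  rewrite {1}Zv rdotDr rdotZr Zs // Zs // Zx Zv !rdotBr !rdotDr !rdotZr rdotE; ring.
have Zv_le : `‖Z v‖ <= k * `‖u‖.
  rewrite Zv; apply: le_trans (rnormD _ _) _; rewrite rnormZ rnorm_real (ger0_norm r0_ge0).
  rewrite mulrDl; apply: lerD; first exact: Sm_le.
  rewrite -!mulrA ler_wpM2l //; apply: le_trans (Sp_le _) _.
  by rewrite ler_wpM2l ?Sm_le // ltW.
have disc : (`‖u‖ ^+ 2) ^+ 2 <=
    (`‖Z u‖ ^+ 2 - r0 ^+ 2 * `‖u‖ ^+ 2) * (`‖Z v‖ ^+ 2 - r0 ^+ 2 * `‖v‖ ^+ 2).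
  apply: quadratic_disc => r.
  have := Er0 (u + r%:C *: v) (dom_add Au (dom_scale r%:C Av)).
  rewrite -/(Z _) ZB // => h.
  have h2 : r0 ^+ 2 * `‖u + r%:C *: v‖ ^+ 2 <= `‖Z u + r%:C *: Z v‖ ^+ 2.
    by rewrite -exprMn ler_pXn2r ?nnegrE ?mulr_ge0 ?rnorm_ge0.
  move: h2; rewrite (rnormD_sqr u) (rnormD_sqr (Z u)) !rnormZ !rnorm_real !exprMn !rdotZr.
  rewrite !real_normK ?num_real //; move: (congr1 ( *%R r) quv); lra.
have [u0|u_neq0] := eqVneq `‖u‖ 0; first by rewrite u0 mulr0 rnorm_ge0.
have up : 0 < `‖u‖ by rewrite lt0r u_neq0 rnorm_ge0.
have gap : `‖u‖ ^+ 2 <= (`‖Z u‖ ^+ 2 - r0 ^+ 2 * `‖u‖ ^+ 2) * k ^+ 2.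
  have u2p : 0 < `‖u‖ ^+ 2 by rewrite exprn_gt0.
  rewrite -(ler_pM2r u2p) -expr2; apply: le_trans disc _.
  set D := `‖Z u‖ ^+ 2 - _.
  have -> : D * k ^+ 2 * `‖u‖ ^+ 2 = D * (k * `‖u‖) ^+ 2 by ring.
  apply: ler_wpM2l.
    rewrite /D subr_ge0 -exprMn ler_pXn2r ?nnegrE ?mulr_ge0 ?rnorm_ge0 //; exact: Er0.
  have : `‖Z v‖ ^+ 2 <= (k * `‖u‖) ^+ 2.
    by rewrite ler_pXn2r ?nnegrE ?mulr_ge0 ?rnorm_ge0 // ltW.
  by apply: le_trans; rewrite gerBl mulr_ge0 // sqr_ge0.
have sq0 : 0 <= r0 ^+ 2 + k ^- 2.
  by rewrite addr_ge0 ?sqr_ge0 // invr_ge0 exprn_ge0 // ltW.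
rewrite -(@ler_pXn2r _ 2) ?nnegrE ?mulr_ge0 ?rnorm_ge0 ?sqrtr_ge0 //.
rewrite exprMn sqr_sqrtr // mulrDl -/(Z u).
by rewrite -lerBrDl mulrC ler_pdivrMr // exprn_gt0.
Qed.

(** * The gap at an isolated point of the spectrum *)

Section IsolatedPoint.
Context (lam d : R).
Context (res : forall z : R, z != lam -> `|z - lam| < d -> resolvent_set A z%:C).
Let Z y := A y - lam%:C *: y.

(** No spectrum lies strictly between [lam] and [lam + e]. In the bound of [resolvent_real_bound] at
    the midpoint, squared, the [‖y‖^2] terms cancel. *)
Lemma isolated_quadratic_bound (e : R) y : `|e| <= d -> dom A y ->
  e * rdot (Z y) y <= `‖Z y‖ ^+ 2.
Proof.
move=> ed Ay; have h z : `|z - (lam + e / 2)| < `|e / 2| -> resolvent_set A z%:C.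
  move=> hz; apply: res.
    by apply: contraTneq hz => ->; rewrite opprD addrA subrr sub0r normrN ltxx.
  have -> : z - lam = (z - (lam + e / 2)) + e / 2 by ring.
  apply: le_lt_trans (ler_normD _ _) _; apply: lt_le_trans (_ : `|e / 2| + `|e / 2| <= _).
    by rewrite ltrD2r.
  by rewrite normrM (gtr0_norm (_ : 0 < 2^-1)) ?invr_gt0 //; lra.
have := resolvent_real_bound h Ay.
have -> : A y - (lam + e / 2)%:C *: y = Z y - (e / 2)%:C *: y.
  by rewrite /Z rcD; lmod R H.
rewrite -(@ler_pXn2r _ 2) ?nnegrE ?mulr_ge0 ?rnorm_ge0 //.
rewrite rnormB_sqr rdotZr rnormZ rnorm_real !exprMn !real_normK ?num_real //.
lra.
Qed.

(** [Y = Z (Z - eta)^-1] is bounded and symmetric, and its kernel is the eigenspace. As the nonzero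
    spectrum of [Z] has modulus at least [2 |eta|], that of [Y] is at least [2/3], so
    [2 ‖h‖^2 <= 3 <Y h, h>] for [h] orthogonal to the eigenspace. The claim is this inequality for
    [h = (Z - eta) y], where [Y h = Z y]. Boundedness of [Y] lets it pass from the range of [Y] to
    its closure. *)
Lemma isolated_one_sided (eta : R) y : eta != 0 -> 2 * `|eta| <= d -> dom A y ->
  (forall k, eigspace A lam%:C k -> ⟨y, k⟩ = 0) ->
  2 * eta ^+ 2 * `‖y‖ ^+ 2 <= `‖Z y‖ ^+ 2 + eta * rdot (Z y) y.
Proof.
move=> eta0 etad Ay yK; have [As Am] := sA.
have eta_gt0 : 0 < `|eta| by rewrite normr_gt0.
have [S [/continuous_rbounded[c c0 S_le] Sd SK]] : resolvent_set A (lam + eta)%:C.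
  apply: res; first by rewrite -subr_eq0 addrC addKr.
  by rewrite addrC addKr; lra.
have [Y Yd] : exists Y : H -> H, forall h, Y h = h + eta%:C *: S h.
  by exists (fun h => h + eta%:C *: S h).
have YE h : Y h = Z (S h).
  by have [_] := Sd h; rewrite Yd /Z rcD => {1}<-; lmod R H.
have hE h : h = Z (S h) - eta%:C *: S h by rewrite -YE Yd addrK.
have ZS h : dom A (S h) by have [] := Sd h.
have YB h h' (a : C) : Y (h + a *: h') = Y h + a *: Y h'.
  by rewrite !Yd linearD linearZ /=; lmod R H.
have Ysym h h' : ⟨Y h, h'⟩ = ⟨h, Y h'⟩.
  transitivity ⟨Z (S h), Z (S h') - eta%:C *: S h'⟩; first by rewrite -hE -YE.
  transitivity ⟨Z (S h) - eta%:C *: S h, Z (S h')⟩; last by rewrite -hE -YE.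
  rewrite dotBl dotBr dotZl dotZr conjc_real; congr (_ - _ * _).
  by rewrite /Z dotBl dotBr dotZl dotZr conjc_real As.
have Ysymr h h' : rdot (Y h) h' = rdot h (Y h') by rewrite /rdot Ysym.
have Yge0 h : 0 <= rdot (Y h) h.
  rewrite {2}(hE h) YE rdotBr rdotZr rdotE subr_ge0 isolated_quadratic_bound //.
  by lra.
have Yge h : 2 * rdot (Y h) h <= 3 * `‖Y h‖ ^+ 2.
  rewrite {2}(hE h) YE rdotBr rdotZr rdotE.
  have := @isolated_quadratic_bound (- (2 * eta)) (S h).
  by rewrite normrN normrM ger0_norm // => /(_ etad (ZS h)); lra.
(* With c = 2/3: Y^2 (Y - c) = (Y - c) Y (Y - c) + c Y (Y - c) >= 0 *)
have Yran u : 2 * `‖Y u‖ ^+ 2 <= 3 * rdot (Y (Y u)) (Y u).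
  have := Yge0 (Y u + (- (2 / 3))%:C *: u); have := Yge u.
  rewrite YB !rdotDl !rdotDr !rdotZl !rdotZr (Ysymr (Y u) u) !rdotE.
  by lra.
have Ybd h : `‖Y h‖ <= (1 + `|eta| * c) * `‖h‖.
  rewrite Yd; apply: le_trans (rnormD _ _) _; rewrite rnormZ rnorm_real mulrDl mul1r.
  by rewrite lerD2l -mulrA ler_wpM2l // S_le.
pose h := Z y - eta%:C *: y.
have hK k : eigspace A lam%:C k -> ⟨h, k⟩ = 0.
  move=> Kk; have [Ak kE] := Kk; rewrite /h /Z !dotBl !dotZl yK // As // kE.
  by rewrite dotZr yK // !mulr0 !subr0.
have Sh : S h = y.
  rewrite -[RHS]SK //; congr (S _).
  by rewrite /h /Z rcD; lmod R H.
(* [h] is orthogonal to the kernel of the symmetric operator [Y], hence in the closure of its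
   range. *)
have h_lim (e : R) : 0 < e -> exists u, `‖Y u - h‖ < e.
  have [||l [lM lo]] := @orthogonal_decomposition R H (range Y) h.
  - by exists 0 => //; rewrite Yd linear0 scaler0 addr0.
  - move=> a u v [u' _ <-] [v' _ <-]; exists (v' + a *: u') => //.
    by rewrite YB addrC.
  have Yk : Y (h - l) = 0.
    apply: dot_eq0; rewrite Ysym; apply: lo.
    by exists (Y (h - l)).
  have K0 : eigspace A lam%:C (h - l).
    have E : h - l = (- eta)%:C *: S (h - l).
      by apply/eqP; rewrite -subr_eq0 rcN scaleNr opprK -Yd Yk.
    have A1 : dom A (h - l) by rewrite E; exact: dom_scale.
    split=> //; apply/eqP; rewrite -subr_eq0 -/(Z _) E.
    have -> : Z ((- eta)%:C *: S (h - l)) = (- eta)%:C *: Z (S (h - l)).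
      by rewrite /Z op_scale //; lmod R H.
    by rewrite -YE Yk scaler0.
  have l0 : ⟨l, h - l⟩ = 0.
    apply: (@rnorm_eq0_eps _ _ _ `‖h - l‖) => e' e'0.
    have [_ [u _ <-] ul] := lM _ e'0.
    have -> : ⟨l, h - l⟩ = ⟨l - Y u, h - l⟩.
      by rewrite dotBl Ysym Yk dot0r subr0.
    apply: le_trans (dot_cauchy _ _) _.
    by rewrite ler_wpM2r ?rnorm_ge0 // rdistC ltW.
  have hl : h - l = 0 by apply: dot_eq0; rewrite dotBl hK // l0 subr0.
  move=> /lM[_ [u _ <-] ul]; exists u.
  by move/eqP : hl; rewrite subr_eq0 => /eqP ->.
have : 2 * `‖h‖ ^+ 2 <= 3 * rdot (Y h) h.
  pose b := 1 + `|eta| * c; have b0 : 0 <= b by rewrite addr_ge0 // mulr_ge0 // ltW.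
  (* For [Y u = h + r] with [‖r‖ <= 1] the errors are at most a multiple of [‖r‖]; [N] collects the
     coefficients. *)
  pose N := 6 * b * `‖h‖ + 3 * b + 4 * `‖h‖ + 1.
  have N0 : 0 < N by rewrite /N; have := rnorm_ge0 h; nra.
  apply/ler_addgt0Pr => e e0; have e'0 : 0 < Num.min 1 (e / N).
    by rewrite lt_min ltr01 divr_gt0.
  have [u uh] := h_lim _ e'0.
  move: uh; rewrite lt_min => /andP[r1 re].
  move: (Yran u); have -> : Y u = h + 1 *: (Y u - h) by rewrite scale1r addrC subrK.
  move: (Y u - h) r1 re => r r1 re.
  clearbody h; rewrite YB !scale1r rnormD_sqr !rdotDl !rdotDr (Ysymr r h) (rdotC r).
  rewrite ltr_pdivlMr // /N in re.
  have := rdot_cauchy (Y h) r; have := rdot_cauchy (Y r) r; have := rdot_cauchy h r.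
  have := Ybd h; have := Ybd r; rewrite -/b.
  have := rnorm_ge0 h; have := rnorm_ge0 r.
  have := ler_norm (rdot (Y h) r); have := ler_norm (rdot (Y r) r).
  have := ler_norm (- rdot h r); rewrite normrN.
  set x := `‖r‖ in r1 re *; set z := `‖h‖ in re *.
  set p := `‖Y r‖; set q := `‖Y h‖.
  move=> l1 l2 l3 x0 z0 px qz c1 c2 c3 main.
  have e1 : p * x <= b * x.
    by rewrite ler_wpM2r // (le_trans px) // ler_piMr // ltW.
  have e2 : q * x <= b * z * x by rewrite ler_wpM2r.
  have x2 := sqr_ge0 x.
  have {}re : 6 * (b * z * x) + 3 * (b * x) + 4 * (z * x) + x < e.
    by apply: le_lt_trans re; rewrite le_eqVlt; apply/orP; left; apply/eqP; ring.
  move: (b * z * x) (b * x) (p * x) (q * x) e1 e2 re c2 c3 => bzx bx px' qx' e1 e2 re c2 c3.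
  by lra.
rewrite YE Sh {1 2}/h rnormB_sqr rdotBr !rdotZr rdotE rnormZ rnorm_real exprMn.
rewrite real_normK ?num_real //; lra.
Qed.

(** Adding the one-sided bounds for [d / 2] and [- (d / 2)] cancels the indefinite term
    [rdot (Z y) y]. *)
Lemma isolated_gap y : 0 < d -> dom A y ->
  (forall k, eigspace A lam%:C k -> ⟨y, k⟩ = 0) ->
  d ^+ 2 * `‖y‖ ^+ 2 <= 2 * `‖A y - lam%:C *: y‖ ^+ 2.
Proof.
move=> d0 Ay yK; have d2 : 0 < d / 2 by rewrite divr_gt0.
have := @isolated_one_sided (d / 2) y; have := @isolated_one_sided (- (d / 2)) y.
rewrite oppr_eq0 gt_eqF // normrN gtr0_norm //.
have -> : 2 * (d / 2) = d by field.
move=> /(_ isT (lexx _) Ay yK) h1 /(_ isT (lexx _) Ay yK) h2.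
by move: h1 h2; rewrite /Z; lra.
Qed.

End IsolatedPoint.
End SpectralGap.

(** * Finite orthonormal families *)

Section FiniteFamilies.
Context (R : realType).
Local Notation C := R[i].

(** A bounded function converges along an ultrafilter, to the supremum of the levels it eventually
    exceeds; this replaces the extraction of a subsequence. *)
Lemma ultra_osc (T : Type) (F : set_system T) (f : T -> R) (M e : R) :
  UltraFilter F -> F [set x | `|f x| <= M] -> 0 < e ->
  exists2 A, F A & forall x y, A x -> A y -> `|f x - f y| < e.
Proof.
move=> FU fM e0; pose E := [set r | F [set x | r <= f x]].
have Es : has_sup E.
  split.
    by exists (- M); apply: filterS fM => x /=; rewrite ler_norml => /andP[].
  exists M => r /= /(filterI fM) /filter_ex[x [/= h]] /le_trans; apply.
  by move: h; rewrite ler_norml => /andP[].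
have e4 : 0 < e / 4 by rewrite divr_gt0.
have [r Er re] := sup_adherent e4 Es.
have [|nE] := in_ultra_setVsetC [set x | sup E + e / 4 <= f x] FU.
  by move=> h; have : sup E + e / 4 <= sup E; [apply: ub_le_sup => //; exact: Es.2|lra].
exists [set x | r <= f x /\ f x < sup E + e / 4].
  by apply: filterS (filterI Er nE) => x /= [h /negP]; rewrite -ltNge.
by move=> x y [h1 h2] [h3 h4]; rewrite ltr_norml; apply/andP; split; lra.
Qed.

(** The dimension count behind each choice of a nonzero combination of [n] vectors orthogonal to
    [k < n] others. *)
Lemma exists_left_kernel (k n : nat) (A : 'M[C]_(n, k)) : (k < n)%N ->
  exists v : 'I_n -> C, (exists j, v j != 0) /\
    forall l, \sum_j v j * A j l = 0.
Proof.
move=> kn; have : kermx A != 0.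
  rewrite kermx_eq0; apply: contraTN kn => /eqP rA.
  by rewrite -leqNgt -rA rank_leq_col.
case/rowV0Pn => v /sub_kermxP vA v0; exists (fun j => v 0 j); split.
  by have [j vj] := rV0Pn _ v0; exists j.
by move=> l; have := congr1 (fun M : 'M[C]_(1, k) => M 0 l) vA; rewrite !mxE.
Qed.

Context (H : hilbertType R).
Implicit Types (u v w : H).

Definition orthonormal_family n (e : 'I_n -> H) :=
  forall j k, ⟨e j, e k⟩ = (j == k)%:R.

Definition proj n (e : 'I_n -> H) u := \sum_k ⟨u, e k⟩ *: e k.

Lemma orthonormal_norm n (e : 'I_n -> H) j : orthonormal_family e -> `‖e j‖ = 1.
Proof.
move=> eo; have := eo j j; rewrite dotE eqxx => /complexI /eqP.
by rewrite sqrf_eq1 => /orP[/eqP //|/eqP h]; have := rnorm_ge0 (e j); rewrite h; lra.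
Qed.

Lemma dot_combl n (e : 'I_n -> H) (c : 'I_n -> C) k : orthonormal_family e ->
  ⟨\sum_j c j *: e j, e k⟩ = c k.
Proof.
move=> eo; rewrite dot_suml (bigD1 k) //= dotZl eo eqxx mulr1 big1 ?addr0 // => j jk.
by rewrite dotZl eo (negPf jk) mulr0.
Qed.

Lemma rnorm_coef n (e : 'I_n -> H) (c : 'I_n -> C) k : orthonormal_family e ->
  `‖c k‖ <= `‖\sum_j c j *: e j‖.
Proof.
move=> eo; rewrite -{1}(dot_combl c k eo) (le_trans (dot_cauchy _ _)) //.
by rewrite (orthonormal_norm k eo) mulr1.
Qed.

Lemma proj_sum n m (e : 'I_n -> H) (c : 'I_m -> C) (x : 'I_m -> H) :
  proj e (\sum_j c j *: x j) = \sum_j c j *: proj e (x j).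
Proof.
rewrite /proj; under [RHS]eq_bigr do rewrite scaler_sumr.
rewrite exchange_big; apply: eq_bigr => l _.
by rewrite dot_suml scaler_suml; apply: eq_bigr => j _; rewrite dotZl scalerA.
Qed.

Section Proj.
Context (n : nat) (e : 'I_n -> H) (eo : orthonormal_family e).

Lemma projB u v : proj e (u - v) = proj e u - proj e v.
Proof.
by rewrite /proj -sumrB; apply: eq_bigr => k _; rewrite dotBl scalerBl.
Qed.

Lemma proj_comb (c : 'I_n -> C) : proj e (\sum_j c j *: e j) = \sum_j c j *: e j.
Proof. by apply: eq_bigr => k _; rewrite dot_combl. Qed.

Lemma dot_proj u k : ⟨proj e u, e k⟩ = ⟨u, e k⟩.
Proof. exact: dot_combl. Qed.

Lemma dot_compl u k : ⟨u - proj e u, e k⟩ = 0.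
Proof. by rewrite dotBl dot_proj subrr. Qed.

Lemma dot_compl_comb u (c : 'I_n -> C) : ⟨u - proj e u, \sum_k c k *: e k⟩ = 0.
Proof. by rewrite dot_sumr big1 // => k _; rewrite dotZr dot_compl mulr0. Qed.

Lemma proj_projl u v : ⟨proj e u, proj e v⟩ = ⟨u, proj e v⟩.
Proof.
by apply/esym/eqP; rewrite -subr_eq0 -dotBl; apply/eqP; exact: dot_compl_comb.
Qed.

Lemma proj_pythagoras u : `‖u‖ ^+ 2 = `‖proj e u‖ ^+ 2 + `‖u - proj e u‖ ^+ 2.
Proof.
have := rnormD_sqr (u - proj e u) (proj e u); rewrite subrK => ->.
have -> : rdot (u - proj e u) (proj e u) = 0.
  by rewrite /rdot [X in complex.Re X](_ : _ = 0) //; exact: dot_compl_comb.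
by ring.
Qed.

Lemma rnorm_proj u : `‖proj e u‖ <= `‖u‖.
Proof.
rewrite -(@ler_pXn2r _ 2) ?nnegrE ?rnorm_ge0 // (proj_pythagoras u).
by rewrite lerDl sqr_ge0.
Qed.

Lemma rnorm_compl u : `‖u - proj e u‖ <= `‖u‖.
Proof.
rewrite -(@ler_pXn2r _ 2) ?nnegrE ?rnorm_ge0 // (proj_pythagoras u).
by rewrite lerDr sqr_ge0.
Qed.

Lemma rnorm_proj_sum u : `‖proj e u‖ <= \sum_k `‖⟨u, e k⟩‖.
Proof.
apply: le_trans (rnorm_sum _ _ _) _; apply: ler_sum => k _.
by rewrite rnormZ orthonormal_norm // mulr1.
Qed.

End Proj.

(** If [m < n], a nonzero combination [w] of the [e j] is orthogonal to all [f l], so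
    [w = w - proj f w]; but the coordinates of [w] are at most [‖w‖], which bounds the right side by
    [n d ‖w‖ < ‖w‖]. *)
Lemma orthonormal_near_card n m (e : 'I_n -> H) (f : 'I_m -> H) (d : R) :
  orthonormal_family e -> orthonormal_family f -> (forall j, `‖e j - proj f (e j)‖ <= d) ->
  n%:R * d < 1 -> (n <= m)%N.
Proof.
move=> eo fo ed nd; rewrite leqNgt; apply/negP => mn.
have [v [[j vj] vA]] := exists_left_kernel (\matrix_(j, l) ⟨e j, f l⟩) mn.
pose w := \sum_j v j *: e j.
have wp : 0 < `‖w‖ by apply: lt_le_trans (rnorm_coef v j eo); rewrite rnorm_gt0.
have Pw : proj f w = 0.
  rewrite /proj big1 // => l _; rewrite dot_suml.
  rewrite (_ : \sum_j _ = 0) ?scale0r // -[RHS](vA l).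
  by apply: eq_bigr => j' _; rewrite mxE dotZl.
have wE : w = \sum_j v j *: (e j - proj f (e j)).
  transitivity (w - proj f w); first by rewrite Pw subr0.
  rewrite /w proj_sum -sumrB.
  by apply: eq_bigr => l _; rewrite scalerBr.
have : `‖w‖ <= n%:R * d * `‖w‖.
  rewrite {1}wE; apply: le_trans (rnorm_sum _ _ _) _.
  rewrite -mulrA -[n in n%:R]card_ord mulr_natl -sumr_const.
  apply: ler_sum => l _; rewrite rnormZ mulrC.
  by apply: ler_pM; rewrite ?rnorm_ge0 // rnorm_coef.
by rewrite ler_pMl // leNgt nd.
Qed.

End FiniteFamilies.

(** * Perturbation of an isolated eigenvalue *)

Section Perturbation.
Context (R : realType) (H : hilbertType R).
Local Notation C := R[i].
Implicit Types (u v w y : H) (B : operator H).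

(* For self-adjoint operators, graph closeness in both directions amounts to
   closeness of the resolvents in norm. *)
Definition graph_close (eps : R) (A B : operator H) :=
  forall w, dom A w -> exists f, [/\ dom B f,
    `‖w - f‖ <= eps * (`‖A w‖ + `‖w‖) &
    `‖A w - B f‖ <= eps * (`‖A w‖ + `‖w‖)].

Context (A : operator H) (sA : selfadj A) (lam g rho : R) (m : nat).
Context (e0 : 'I_m -> H) (e0o : orthonormal_family e0).
Context (e0A : forall k, dom A (e0 k) /\ A (e0 k) = lam%:C *: e0 k).
Context (rho0 : 0 < rho) (rho_g : rho < g).
Context (gap : forall y, dom A y -> (forall k, ⟨y, e0 k⟩ = 0) ->
  g * `‖y‖ <= `‖A y - lam%:C *: y‖).

Let c := `|lam| + rho.
(** [c] bounds [|mu|] when [|mu - lam| <= rho]. The factor [1 + c] bounds [‖B w‖ + ‖w‖] in terms of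
    [r + ‖w‖]; the factor [1 + c + g] joins the error of [A - mu] at the partner [f] of [w] to [g]
    times [‖w - f‖]. *)
Definition perturb_const := (1 + c + g) * (1 + c).
Local Notation kappa := perturb_const.

Lemma perturb_const_gt0 : 0 < kappa.
Proof. by apply: mulr_gt0; rewrite /c; have := normr_ge0 lam; move: rho0 rho_g; lra. Qed.

(** [w] is replaced by its partner [f] in [dom A], and [f] is split into [p] in the eigenspace and
    [f'] orthogonal to it. [A - mu] keeps the two parts orthogonal, so Pythagoras bounds each by the
    residual; on [f'] the gap loses at most [rho]. *)
Lemma near_eigenspace B (eps mu : R) w : 0 <= eps -> graph_close eps B A ->
  dom B w -> `|mu - lam| <= rho ->
  let r := `‖B w - mu%:C *: w‖ in
  (g - rho) * `‖w - proj e0 w‖ <= r + eps * kappa * (r + `‖w‖) /\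
  `|mu - lam| * `‖proj e0 w‖ <= r + eps * kappa * (r + `‖w‖).
Proof.
move=> eps0 BA Bw mul r; have [As _] := sA.
have g0 : 0 < g by exact: lt_trans rho_g.
have c0 : 0 <= c by rewrite addr_ge0 // ltW.
have mu_c : `|mu| <= c.
  by rewrite -(subrK lam mu) (le_trans (ler_normD _ _)) // addrC lerD2l.
have [f [Af wf Bwf]] := BA _ Bw; set n := `‖B w‖ + `‖w‖ in wf Bwf.
have n0 : 0 <= n by rewrite addr_ge0 ?rnorm_ge0.
have r0 : 0 <= r := rnorm_ge0 _; have w0 := rnorm_ge0 w.
have n_le : n <= (1 + c) * (r + `‖w‖).
  have : `‖B w‖ <= r + `|mu| * `‖w‖.
    by rewrite -rnorm_real -rnormZ rnorm_le_dist.
  by have := ler_wpM2r w0 mu_c; have := mulr_ge0 c0 r0; rewrite /n; lra.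
pose Z y := A y - mu%:C *: y.
have Zf_le : `‖Z f‖ <= r + eps * (1 + c) * n.
  have -> : Z f = (B w - mu%:C *: w) - (B w - A f) + mu%:C *: (w - f).
    by rewrite /Z; lmod R H.
  apply: le_trans (rnormD _ _) _; rewrite rnormZ rnorm_real.
  have := rnormB (B w - mu%:C *: w) (B w - A f); rewrite -/r.
  have : `|mu| * `‖w - f‖ <= c * (eps * n) by apply: ler_pM; rewrite ?rnorm_ge0.
  by lra.
set p := proj e0 f; set f' := f - p.
have Ap : dom A p by apply: dom_sum => k _; apply: dom_scale; exact: (e0A k).1.
have Af' : dom A f' by exact: dom_sub.
have ApE : A p = lam%:C *: p.
  rewrite op_sum => [|k _]; last by apply: dom_scale; exact: (e0A k).1.
  rewrite scaler_sumr; apply: eq_bigr => k _.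
  have [Ak AkE] := e0A k; rewrite op_scale // AkE; lmod R H.
have ZE : Z f = Z f' + (lam - mu)%:C *: p.
  by rewrite /Z /f' op_sub // ApE rcB; lmod R H.
have f'e k : ⟨f', e0 k⟩ = 0 by exact: dot_compl.
have pyth : `‖Z f‖ ^+ 2 = `‖Z f'‖ ^+ 2 + `|lam - mu| ^+ 2 * `‖p‖ ^+ 2.
  rewrite ZE rnormD_sqr rdotZr rnormZ rnorm_real exprMn.
  suff -> : rdot (Z f') p = 0 by ring.
  rewrite /rdot (_ : ⟨_, _⟩ = 0) // dot_sumr big1 // => k _.
  rewrite dotZr dotBl dotZl f'e mulr0 subr0 As //; last exact: (e0A k).1.
  by rewrite (e0A k).2 dotZr f'e !mulr0.
have Zf'_le : `‖Z f'‖ <= `‖Z f‖.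
  by rewrite -(@ler_pXn2r _ 2) ?nnegrE ?rnorm_ge0 // pyth lerDl mulr_ge0 ?sqr_ge0.
have p_le : `|mu - lam| * `‖p‖ <= `‖Z f‖.
  rewrite distrC -(@ler_pXn2r _ 2) ?nnegrE ?mulr_ge0 ?rnorm_ge0 //.
  by rewrite exprMn pyth lerDr sqr_ge0.
have gap' : (g - rho) * `‖f'‖ <= `‖Z f'‖.
  have := gap Af' f'e.
  have -> : A f' - lam%:C *: f' = Z f' + (mu - lam)%:C *: f'.
    by rewrite /Z rcB; lmod R H.
  move=> /le_trans /(_ (rnormD _ _)); rewrite rnormZ rnorm_real.
  by have := ler_wpM2r (rnorm_ge0 f') mul; lra.
have tail : eps * (1 + c) * n + g * (eps * n) <= eps * kappa * (r + `‖w‖).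
  have -> : eps * (1 + c) * n + g * (eps * n) = eps * (1 + c + g) * n by ring.
  rewrite /kappa mulrA -[leRHS]mulrA; apply: ler_wpM2l => //.
  by rewrite mulr_ge0 // !addr_ge0 // ltW.
split.
  have : `‖w - proj e0 w‖ <= `‖f'‖ + `‖w - f‖.
    have -> : w - proj e0 w = f' + ((w - f) - proj e0 (w - f)).
      by rewrite /f' /p projB; lmod R H.
    by rewrite (le_trans (rnormD _ _)) // lerD2l rnorm_compl.
  move: (rnorm_ge0 (w - f)) (rnorm_ge0 f') => a0 b0 h.
  have : (g - rho) * `‖w - proj e0 w‖ <= (g - rho) * (`‖f'‖ + `‖w - f‖).
    by rewrite ler_wpM2l // subr_ge0 ltW.
  have : (g - rho) * `‖w - f‖ <= g * (eps * n).
    by apply: ler_pM => //; [rewrite subr_ge0 ltW|rewrite gerBl ltW].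
  by lra.
have : `‖proj e0 w‖ <= `‖p‖ + `‖w - f‖.
  have -> : proj e0 w = p + proj e0 (w - f) by rewrite projB addrC subrK.
  by rewrite (le_trans (rnormD _ _)) // lerD2l rnorm_proj.
move=> h; have : `|mu - lam| * `‖proj e0 w‖ <= `|mu - lam| * (`‖p‖ + `‖w - f‖).
  by rewrite ler_wpM2l.
have : `|mu - lam| * `‖w - f‖ <= g * (eps * n).
  by apply: ler_pM; rewrite ?rnorm_ge0 // (le_trans mul) // ltW.
by lra.
Qed.

(** * Eigenvectors of one perturbed operator *)

Section OnePerturbation.
Context (B : operator H) (sB : selfadj B) (eps : R).
Context (eps0 : 0 <= eps) (BA : graph_close eps B A) (AB : graph_close eps A B).
Let g1 := g - rho.
Context (eps_small : eps * kappa <= g1 / 4) (eps_small1 : eps * kappa <= 1).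
(** Each of the [m] vectors [e0 j] satisfies [‖A (e0 j)‖ + ‖e0 j‖ = 1 + |lam|], so moving a unit
    vector of the eigenspace into [dom B] costs at most [tau]. *)
Let tau := m%:R * (eps * (1 + `|lam|)).
Context (tau_small : 2 * tau <= 1).
Context (tau_small' : 2 * tau * (1 + `|lam|) * 8 <= g1).
Context (tau_small_rho : 2 * tau * (1 + `|lam|) <= rho).
Let Z u := B u - lam%:C *: u.

Context (k : nat) (e : 'I_k -> H) (nu : 'I_k -> R) (km : (k < m)%N).
Context (eo : orthonormal_family e).
Context (eB : forall l, dom B (e l) /\ B (e l) = (nu l)%:C *: e l).

(** The eigenspace is moved into [dom B] by graph closeness; as [k < m], some combination is
    orthogonal to the [e l]. It makes the infimum in [next_eigenvector] small. *)
Lemma test_vector : exists u, [/\ dom B u, forall l, ⟨u, e l⟩ = 0, u != 0 &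
  `‖Z u‖ <= 2 * tau * (1 + `|lam|) * `‖u‖].
Proof.
have lam0 := normr_ge0 lam.
have n0 j : `‖A (e0 j)‖ + `‖e0 j‖ = 1 + `|lam|.
  by rewrite (e0A j).2 rnormZ rnorm_real orthonormal_norm // mulr1 addrC.
have /choice[f fP] : forall j, exists f, [/\ dom B f,
    `‖e0 j - f‖ <= eps * (1 + `|lam|) &
    `‖A (e0 j) - B f‖ <= eps * (1 + `|lam|)].
  by move=> j; have := AB (e0A j).1; rewrite n0.
have [v [[j vj] vA]] := exists_left_kernel (\matrix_(j, l) ⟨f j, e l⟩) km.
pose u0 := \sum_j v j *: e0 j; pose u := \sum_j v j *: f j.
have u0p : 0 < `‖u0‖ by apply: lt_le_trans (rnorm_coef v j e0o); rewrite rnorm_gt0.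
have bnd (x : 'I_m -> H) b : 0 <= b -> (forall j, `‖x j‖ <= b) ->
    `‖\sum_j v j *: x j‖ <= m%:R * b * `‖u0‖.
  move=> b0 xb; apply: le_trans (rnorm_sum _ _ _) _.
  rewrite -mulrA -[m in m%:R]card_ord mulr_natl -sumr_const.
  apply: ler_sum => l _; rewrite rnormZ mulrC.
  by apply: ler_pM; rewrite ?rnorm_ge0 // rnorm_coef.
have e1 : 0 <= eps * (1 + `|lam|) by rewrite mulr_ge0 // addr_ge0.
have Bu : dom B u by apply: dom_sum => l _; apply: dom_scale; have [] := fP l.
have u0u : `‖u0 - u‖ <= tau * `‖u0‖.
  rewrite /u0 /u -sumrB; under eq_bigr do rewrite -scalerBr.
  by apply: bnd => // l; have [] := fP l.
have Zu : `‖Z u‖ <= tau * (1 + `|lam|) * `‖u0‖.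
  have -> : Z u = \sum_j v j *: (lam%:C *: (e0 j - f j) - (A (e0 j) - B (f j))).
    rewrite /Z op_sum => [|l _]; last by apply: dom_scale; have [] := fP l.
    rewrite scaler_sumr -sumrB; apply: eq_bigr => l _.
    have [Bf _ _] := fP l; rewrite op_scale // (e0A l).2; lmod R H.
  rewrite /tau -(mulrA m%:R); apply: bnd => [|l]; first by rewrite mulr_ge0 // addr_ge0.
  have [_ h1 h2] := fP l; apply: le_trans (rnormB _ _) _.
  rewrite rnormZ rnorm_real.
  by have := ler_wpM2l lam0 h1; lra.
have u_u0 : `‖u0‖ <= 2 * `‖u‖.
  have := rnorm_le_dist u0 u; have : tau * `‖u0‖ <= 2^-1 * `‖u0‖.
    by rewrite ler_pM2r //; move: tau_small; lra.
  by lra.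
exists u; split=> // [l||].
- rewrite dot_suml -[RHS](vA l); apply: eq_bigr => j' _.
  by rewrite mxE dotZl.
- by rewrite -rnorm_gt0; lra.
- apply: le_trans Zu _.
  have t0 : 0 <= tau by rewrite mulr_ge0.
  have : 0 <= tau * (1 + `|lam|) by rewrite mulr_ge0 // addr_ge0.
  by move=> h; have := ler_wpM2l h u_u0; lra.
Qed.

(* Minimise the quotient |Z u| / |u| on the complement of the e l. Differences of
   near-minimisers are controlled by their m coordinates along e0, so the
   infimum s is attained; a minimiser satisfies Z^2 u = s^2 u, and either
   Z u + s u or u is an eigenvector, with eigenvalue lam + s or lam - s. *)
Lemma next_eigenvector : exists u (mu : R), [/\ dom B u, `‖u‖ = 1,
  forall l, ⟨u, e l⟩ = 0, B u = mu%:C *: u & `|mu - lam| <= rho].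
Proof.
have [Bs Bm] := sB.
have ZB u v (a : C) : dom B u -> dom B v -> Z (a *: u + v) = a *: Z u + Z v.
  by move=> Bu Bv; rewrite /Z op_linear //; lmod R H.
have Zsym u v : dom B u -> dom B v -> ⟨Z u, v⟩ = ⟨u, Z v⟩.
  by move=> Bu Bv; rewrite /Z dotBl dotBr dotZl dotZr conjc_real Bs.
pose L := [set u | dom B u /\ forall l, ⟨u, e l⟩ = 0].
have LL (a : C) u v : L u -> L v -> L (a *: u + v).
  move=> [Bu ue] [Bv ve]; split=> [|l]; first exact: dom_linear.
  by rewrite dotDl dotZl ue ve mulr0 addr0.
have L0 : L 0 by split=> [|l]; [exact: dom0|rewrite dot0l].
have LZ (a : C) u : L u -> L (a *: u).
  by move=> Lu; rewrite -[_ *: u]addr0; exact: LL.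
have ZZ (a : C) u : dom B u -> Z (a *: u) = a *: Z u.
  by move=> Bu; rewrite /Z op_scale //; lmod R H.
pose E := [set `‖Z u‖ | u in [set u | L u /\ `‖u‖ = 1]].
have [u1 [Bu1 u1e u1_neq0 Zu1]] := test_vector.
have u1p : 0 < `‖u1‖ by rewrite rnorm_gt0.
have normalize u : u != 0 -> `‖(`‖u‖^-1)%:C *: u‖ = 1.
  move=> u0; rewrite rnormZ rnorm_real ger0_norm ?invr_ge0 ?rnorm_ge0 //.
  by rewrite mulVf // rnorm_eq0.
have Einf : has_inf E.
  split; last by exists 0 => _ [u _ <-]; exact: rnorm_ge0.
  by exists `‖Z ((`‖u1‖^-1)%:C *: u1)‖, ((`‖u1‖^-1)%:C *: u1) => //; split; [exact: LZ|exact: normalize].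
set s := inf E.
have s0 : 0 <= s by apply: lb_le_inf; [exact: Einf.1|move=> _ [u _ <-]; exact: rnorm_ge0].
have s_le u : L u -> s * `‖u‖ <= `‖Z u‖.
  move=> Lu; have [->|u0] := eqVneq u 0; first by rewrite rnorm0 mulr0 rnorm_ge0.
  have up : 0 < `‖u‖ by rewrite rnorm_gt0.
  have : s <= `‖Z ((`‖u‖^-1)%:C *: u)‖.
    by apply: ge_inf; [exact: Einf.2|exists ((`‖u‖^-1)%:C *: u) => //; split; [exact: LZ|exact: normalize]].
  rewrite ZZ; last exact: Lu.1.
  rewrite rnormZ rnorm_real ger0_norm ?invr_ge0 ?rnorm_ge0 // mulrC.
  by rewrite ler_pdivlMr.
have s_small : s <= 2 * tau * (1 + `|lam|).
  have := le_trans (s_le u1 (conj Bu1 u1e)) Zu1.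
  by rewrite ler_pM2r.
have s_rho : s <= rho by exact: le_trans tau_small_rho.
have s8 : 8 * s <= g1 by apply: le_trans tau_small'; rewrite [leRHS]mulrC ler_pM2l.
have g1p : 0 < g1 by rewrite subr_gt0.
pose q u := `‖Z u‖ ^+ 2 - s ^+ 2 * `‖u‖ ^+ 2.
have q0 u : L u -> 0 <= q u.
  move=> /s_le h; rewrite subr_ge0 -exprMn.
  by rewrite ler_pXn2r ?nnegrE ?mulr_ge0 ?rnorm_ge0.
pose S (h : R) := [set u | [/\ L u, `‖u‖ = 1 & q u <= h]].
have S_neq0 h : 0 < h -> S h !=set0.
  move=> h0; have h'0 : 0 < Num.min 1 (h / (2 * s + 1)).
    by rewrite lt_min ltr01 divr_gt0 // ltr_wpDl // mulr_ge0.
  have [_ [u [Lu u1'] <-]] := inf_adherent h'0 Einf.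
  rewrite -/s -ltrBlDl lt_min ltr_pdivlMr ?ltr_wpDl ?mulr_ge0 // => /andP[h1 h2].
  exists u; split=> //; rewrite /q u1' expr1n mulr1.
  by have := s_le u Lu; rewrite u1' mulr1; nra.
have Sle h h' : h <= h' -> S h `<=` S h'.
  by move=> hh' u [Lu uu qu]; split=> //; exact: le_trans hh'.
(* Along an ultrafilter of near-minimisers the bounded coordinates [⟨u, e0 j⟩] converge; this stands
   for compactness of the unit ball of the eigenspace. *)
have [F [FU SF]] := ultraFilterLemma (eps_filter_proper S_neq0 Sle).
have FS h : 0 < h -> F (S h) by move=> h0; apply: SF; exists h.
have wP w : dom B w -> 3 * g1 * `‖w‖ <= 8 * `‖Z w‖ + 4 * g1 * `‖proj e0 w‖.
  move=> Bw; have [] := @near_eigenspace B eps lam w eps0 BA Bw.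
    by rewrite subrr normr0 ltW.
  rewrite -/(Z w) -/g1 => h _; have := rnorm_le_dist w (proj e0 w).
  have := ler_wpM2r (rnorm_ge0 (Z w)) eps_small1.
  have := ler_wpM2r (rnorm_ge0 w) eps_small.
  move: h; set z := `‖Z w‖; set n := `‖w‖; set d := `‖_ - _‖; set p := `‖proj _ _‖.
  move=> h h1 h2 h3; have := ler_wpM2l (ltW g1p) h3.
  by lra.
have Scauchy (a : R) : 0 < a -> exists2 U, F U & forall u v, U u -> U v ->
    [/\ `‖u - v‖ <= a, `‖Z u - Z v‖ <= a & L u].
  move=> a0.
  (* The differences will satisfy [‖u - v‖ <= b] and [‖Z u - Z v‖ <= s b + b], both at most [a]. *)
  pose b := a / (2 + s) ; have s2 : 0 < 2 + s by rewrite ltr_wpDr.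
  have b0 : 0 < b by rewrite divr_gt0.
  have bE : b * (2 + s) = a by rewrite divfK // gt_eqF.
  (* [Zw] is used with [beta = b] and with [beta = g1 b / 8]. The latter, [8 s <= g1] and [wP] give
     [3 g1 n <= g1 n + g1 b + g1 b] for [n = ‖u - v‖]. *)
  pose h := Num.min (b ^+ 2) ((g1 * b / 8) ^+ 2) / 4.
  have gb : 0 < g1 * b / 8 by rewrite divr_gt0 // mulr_gt0.
  have h0 : 0 < h by rewrite divr_gt0 // lt_min !exprn_gt0.
  have h4 : 4 * h <= b ^+ 2 /\ 4 * h <= (g1 * b / 8) ^+ 2.
    by rewrite /h mulrC divfK //; split; rewrite ge_min lexx ?orbT.
  pose a8 := b / (8 * (m%:R + 1)).
  have m1 : 0 < m%:R + 1 :> R by rewrite ltr_wpDl.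
  have a80 : 0 < a8 by rewrite divr_gt0 // mulr_gt0.
  have a8E : 4 * (m%:R * (a8 + a8)) <= b.
    have : a8 * (8 * (m%:R + 1)) = b by rewrite divfK // gt_eqF // mulr_gt0.
    by lra.
  have osc (f : C -> R) : (forall z, `|f z| <= `‖z‖) -> forall j, exists U, F U /\
      forall x y, U x -> U y -> `|f ⟨x, e0 j⟩ - f ⟨y, e0 j⟩| < a8.
    move=> fM j; have [||U FU' UP] := @ultra_osc R H F (fun x => f ⟨x, e0 j⟩) 1 a8 FU;
      [|exact: a80|by exists U].
    apply: filterS (FS 1 ltr01) => x [_ x1 _] /=; apply: le_trans (fM _) _.
    by apply: le_trans (dot_cauchy _ _) _; rewrite x1 orthonormal_norm // mulr1.
  have [Ur UrP] := choice (osc _ (@ler_normRe R)).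
  have [Ui UiP] := choice (osc _ (@ler_normIm R)).
  exists [set u | S h u /\ forall j, Ur j u /\ Ui j u].
    apply: filterI; first exact: FS.
    by apply: filter_forall => j; apply: filterI; [case: (UrP j)|case: (UiP j)].
  move=> u v [Su Uu] [Sv Uv].
  have [Lu u_1 qu] := Su; have [Lv v_1 qv] := Sv.
  have ZuvE : Z (u - v) = Z u - Z v.
    by have [[Bu _] [Bv _]] := (Lu, Lv); rewrite /Z op_sub //; lmod R H.
  have Luv : L (u - v) by rewrite -scaleN1r addrC; exact: LL.
  have Lupv : L (u + v) by rewrite -[u]scale1r; exact: LL.
  have Pw : 4 * `‖proj e0 (u - v)‖ <= b.
    apply: le_trans a8E; rewrite ler_pM2l //; apply: le_trans (rnorm_proj_sum e0o _) _.
    rewrite -[m in m%:R]card_ord mulr_natl -sumr_const; apply: ler_sum => j _.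
    apply: le_trans (rnorm_le_ReIm _) _; rewrite dotBl !raddfB.
    by have [[h1 h2] [h3 h5]] := (Uu j, Uv j); apply: lerD; apply: ltW;
      [case: (UrP j) => _; apply|case: (UiP j) => _; apply].
  have quv : `‖Z (u - v)‖ ^+ 2 <= s ^+ 2 * `‖u - v‖ ^+ 2 + 4 * h.
    have := q0 _ Lupv; rewrite /q.
    have -> : Z (u + v) = Z u + Z v.
      by have [[Bu _] [Bv _]] := (Lu, Lv); rewrite /Z op_add //; lmod R H.
    have := parallelogram (Z u) (Z v); have := parallelogram u v.
    move: qu qv; rewrite /q ZuvE u_1 v_1 !expr1n !mulr1.
    move: (s ^+ 2) => s2'.
    move: (`‖u + v‖ ^+ 2) (`‖u - v‖ ^+ 2) => x1 x2.
    move: (`‖Z u + Z v‖ ^+ 2) (`‖Z u - Z v‖ ^+ 2) (`‖Z u‖ ^+ 2) (`‖Z v‖ ^+ 2).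
    move=> y1 y2 y3 y4 h1 h2 h3 h5 h6.
    by have -> : x2 = 4 - x1 by [lra]; lra.
  have Zw (beta : R) : 0 <= beta -> 4 * h <= beta ^+ 2 ->
      `‖Z (u - v)‖ <= s * `‖u - v‖ + beta.
    move=> be0 be; rewrite -(@ler_pXn2r _ 2) ?nnegrE ?addr_ge0 ?mulr_ge0 ?rnorm_ge0 //.
    apply: le_trans quv _; rewrite sqrrD exprMn -addrA lerD2l.
    by rewrite (le_trans be) // lerDr mulrn_wge0 // !mulr_ge0 ?rnorm_ge0.
  have w_b : `‖u - v‖ <= b.
    have := wP _ Luv.1; have := Zw _ (ltW gb) h4.2.
    have := ler_wpM2r (rnorm_ge0 (u - v)) s8.
    have := ler_wpM2l (ltW g1p) Pw.
    move: (`‖u - v‖) (`‖Z (u - v)‖) (`‖proj e0 (u - v)‖) => n z p h1 h2 h3 h5.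
    rewrite -(ler_pM2l g1p); lra.
  split=> //; first by nra.
  rewrite -ZuvE; apply: le_trans (Zw _ (ltW b0) h4.1) _.
  by have := ler_wpM2l s0 w_b; lra.
have [|us usP] := @rcomplete R H H F _ id.
  move=> a a0; have a2 : 0 < a / 2 by rewrite divr_gt0.
  have [U FU' UP] := Scauchy _ a2; exists U => // u v Uu Uv.
  by have [h1 _ _] := UP u v Uu Uv; lra.
have [|zs zsP] := @rcomplete R H H F _ Z.
  move=> a a0; have a2 : 0 < a / 2 by rewrite divr_gt0.
  have [U FU' UP] := Scauchy _ a2; exists U => // u v Uu Uv.
  by have [_ h1 _] := UP u v Uu Uv; lra.
have ap (a : R) : 0 < a ->
    exists u, [/\ S (a ^+ 2) u, `‖u - us‖ < a & `‖Z u - zs‖ < a].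
  move=> a0; have a20 : 0 < a ^+ 2 by rewrite exprn_gt0.
  have [u [[/= h1 h2] h3]] := filter_ex (filterI (filterI (usP _ a0) (zsP _ a0)) (FS _ a20)).
  by exists u.
have [Bus BusE] : dom B us /\ B us = zs + lam%:C *: us.
  apply: selfadj_closed => // a a0.
  have l1 : 0 < 1 + `|lam| by rewrite ltr_wpDr.
  have a'0 : 0 < a / (1 + `|lam|) by rewrite divr_gt0.
  have [u [[[Bu _] _ _] h1 h2]] := ap _ a'0.
  have aE : a / (1 + `|lam|) * (1 + `|lam|) = a by rewrite divfK // gt_eqF.
  exists u; split=> //; first by have := normr_ge0 lam; nra.
  have -> : B u - (zs + lam%:C *: us) = (Z u - zs) + lam%:C *: (u - us).
    by rewrite /Z; lmod R H.
  apply: le_lt_trans (rnormD _ _) _; rewrite rnormZ rnorm_real.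
  by have := ler_wpM2l (normr_ge0 lam) (ltW h1); lra.
have Zus : Z us = zs by rewrite /Z BusE addrK.
have us1 : `‖us‖ = 1.
  apply/eqP; rewrite eq_le; apply/andP; split; apply/ler_addgt0Pr => a /ap[u [[_ u1' _] h1 _]].
    by have := rnorm_le_dist us u; rewrite rdistC u1'; lra.
  by have := rnorm_le_dist u us; rewrite u1'; lra.
have use l : ⟨us, e l⟩ = 0.
  apply: (@rnorm_eq0_eps _ _ _ 1) => a /ap[u [[[_ ue] _ _] h1 _]].
  have -> : ⟨us, e l⟩ = ⟨us - u, e l⟩ by rewrite dotBl ue subr0.
  by apply: le_trans (dot_cauchy _ _) _; rewrite orthonormal_norm // rdistC !mulr1 ltW.
have Lus : L us by [].
have zs_le : `‖zs‖ <= s.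
  apply/ler_addgt0Pr => a a0; have a2 : 0 < a / 2 by rewrite divr_gt0.
  have [u [[_ u1' qu] _ h2]] := ap _ a2.
  have : `‖Z u‖ <= s + a / 2.
    rewrite -(@ler_pXn2r _ 2) ?nnegrE ?addr_ge0 ?rnorm_ge0 ?(ltW a2) //.
    move: qu; rewrite /q u1' expr1n mulr1 lerBlDr => /le_trans; apply.
    by rewrite sqrrD addrC lerD2r lerDl mulrn_wge0 // mulr_ge0 // ltW.
  by have := rnorm_le_dist zs (Z u); rewrite rdistC; lra.
have qus : q us <= 0.
  by rewrite /q us1 expr1n mulr1 Zus subr_le0 ler_pXn2r ?nnegrE ?rnorm_ge0.
(* [us] is a null vector of the form [q], nonnegative on [L]; by Cauchy-Schwarz it pairs to 0 with
   all of [L]. *)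
have rcrit v : L v -> rdot (Z us) (Z v) = s ^+ 2 * rdot us v.
  move=> Lv; apply/eqP; rewrite -subr_eq0 -sqrf_eq0 eq_le sqr_ge0 andbT.
  rewrite -(mul0r (q v)).
  apply: quadratic_disc => r.
  have := q0 _ (LL r%:C _ _ Lv Lus); rewrite /q ZB //; last exact: Lv.1.
  move: qus; rewrite /q [r%:C *: Z v + _]addrC [r%:C *: v + _]addrC.
  rewrite (rnormD_sqr us) (rnormD_sqr (Z us)) !rnormZ !rnorm_real !exprMn !rdotZr.
  by rewrite !real_normK ?num_real //; lra.
have crit v : L v -> ⟨Z us, Z v⟩ = (s ^+ 2)%:C * ⟨us, v⟩.
  move=> Lv; have Liv : L ('i%C *: v) by exact: LZ.
  rewrite dot_rdot [⟨us, v⟩]dot_rdot (rcrit _ Lv) -ZZ ?(rcrit _ Liv) ?rcM; last exact: Lv.1.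
  by ring.
have Zuse l : ⟨Z us, e l⟩ = 0.
  rewrite Zsym //; last exact: (eB l).1.
  by rewrite /Z (eB l).2 dotBr !dotZr use !mulr0 subr0.
have crit' v : dom B v -> ⟨Z us, Z v⟩ = (s ^+ 2)%:C * ⟨us, v⟩.
  move=> Bv; have Bp : dom B (proj e v).
    by apply: dom_sum => l _; apply: dom_scale; exact: (eB l).1.
  have Lv' : L (v - proj e v) by split=> [|l]; [exact: dom_sub|exact: dot_compl].
  have Zp : ⟨Z us, Z (proj e v)⟩ = 0.
    have -> : Z (proj e v) = \sum_l (⟨v, e l⟩ * (nu l - lam)%:C) *: e l.
      rewrite /Z op_sum => [|l _]; last by apply: dom_scale; exact: (eB l).1.
      rewrite scaler_sumr -sumrB; apply: eq_bigr => l _.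
      have [Bl BlE] := eB l; rewrite op_scale // BlE rcB; lmod R H.
    by rewrite dot_sumr big1 // => l _; rewrite dotZr Zuse mulr0.
  have usp : ⟨us, proj e v⟩ = 0.
    by rewrite dot_sumr big1 // => l _; rewrite dotZr use mulr0.
  have -> : Z v = Z (v - proj e v) + Z (proj e v).
    by rewrite /Z op_sub //; lmod R H.
  by rewrite dotDr Zp addr0 crit // dotBr usp subr0.
(* [crit'] holds against all of [dom B], so the maximality clause of [selfadj] puts [Z us] into the
   domain. *)
have [BZ BZE] : dom B (Z us) /\ B (Z us) = lam%:C *: Z us + (s ^+ 2)%:C *: us.
  apply: Bm => v Bv.
  have -> : B v = Z v + lam%:C *: v by rewrite /Z subrK.
  rewrite (dotDl (Z v)) (dotDr (lam%:C *: Z us)) (dotZl _ v).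
  rewrite (dotZr _ us) (dotZr _ (Z us)) !conjc_real addrC; congr (_ + _).
  rewrite dotC crit' // rmorphM /= [in RHS]dotC; congr (_ * _).
  by rewrite oppr0.
pose y := Z us + s%:C *: us.
have By : dom B y by apply: dom_add => //; exact: dom_scale.
have [y0|y0] := eqVneq y 0.
  exists us, (lam - s); split=> //.
    have : B us = lam%:C *: us + Z us by rewrite /Z addrC subrK.
    by move=> ->; move/eqP: y0; rewrite addr_eq0 => /eqP ->; rewrite rcB; lmod R H.
  by rewrite addrC addKr normrN ger0_norm.
exists ((`‖y‖^-1)%:C *: y), (lam + s); split.
- exact: dom_scale.
- exact: normalize.
- by move=> l; rewrite dotZl dotDl dotZl Zuse use mulr0 addr0 mulr0.
- rewrite op_scale // scalerA mulrC -scalerA; congr (_ *: _).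
  rewrite /y op_add ?op_scale //; last exact: dom_scale.
  rewrite BZE (_ : B us = lam%:C *: us + Z us); last by rewrite /Z addrC subrK.
  by rewrite rcX rcD; lmod R H.
- by rewrite addrC addKr ger0_norm.
Qed.

End OnePerturbation.

Lemma eigenvectors_near (B : operator H) (eps : R) : selfadj B -> 0 <= eps ->
  graph_close eps B A -> graph_close eps A B ->
  eps * kappa <= (g - rho) / 4 -> eps * kappa <= 1 ->
  let tau := m%:R * (eps * (1 + `|lam|)) in
  2 * tau <= 1 -> 2 * tau * (1 + `|lam|) * 8 <= g - rho ->
  2 * tau * (1 + `|lam|) <= rho ->
  forall k, (k <= m)%N -> exists (e : 'I_k -> H) (nu : 'I_k -> R),
    [/\ orthonormal_family e, forall l, dom B (e l) /\ B (e l) = (nu l)%:C *: e l &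
        forall l, `|nu l - lam| <= rho].
Proof.
move=> sB eps0 BA AB h1 h2 tau h3 h4 h5; elim=> [|k ih] km.
  by exists (fun=> 0), (fun=> 0); split=> [[]|[]|[]].
have [e [nu [eo eB nul]]] := ih (ltnW km).
have [u [mu [Bu u1 ue uE mul]]] :=
  next_eigenvector sB eps0 BA AB h1 h2 h3 h4 h5 km eo eB.
pose ext (T : Type) (f : 'I_k -> T) x j := if unlift ord_max j is Some l then f l else x.
have eu l : ⟨e l, u⟩ = 0 by rewrite dotC ue conjc0.
exists (ext _ e u), (ext _ nu mu); split.
- move=> i j; rewrite /ext; case: unliftP => [i'|] ->; case: unliftP => [j'|] ->.
  + by rewrite eo (inj_eq lift_inj).
  + by rewrite eu eq_sym (negPf (neq_lift _ _)).
  + by rewrite ue (negPf (neq_lift _ _)).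
  + by rewrite dotE u1 expr1n eqxx.
- by move=> j; rewrite /ext; case: unliftP => [j'|] _.
- by move=> j; rewrite /ext; case: unliftP => [j'|] _.
Qed.

(** [del] is uniform over [B], which will range over the operators [H t]. The second part supplies
    [m] eigenvectors; the first, with [orthonormal_near_card], will exclude any more. *)
Theorem eigenvalue_cluster (eta : R) : 0 < eta ->
  exists2 del : R, 0 < del & forall B, selfadj B ->
    graph_close del B A -> graph_close del A B ->
    (forall u (mu : R), dom B u -> B u = mu%:C *: u -> `|mu - lam| <= rho ->
       `‖u - proj e0 u‖ <= eta * `‖u‖ /\ `|mu - lam| * `‖u‖ <= eta * `‖u‖) /\
    exists (e : 'I_m -> H) (nu : 'I_m -> R),
      [/\ orthonormal_family e, forall l, dom B (e l) /\ B (e l) = (nu l)%:C *: e l &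
          forall l, `|nu l - lam| <= rho].
Proof.
move=> eta0; have g1p : 0 < g - rho by rewrite subr_gt0.
have l0 := normr_ge0 lam.
pose K := kappa + 16 * (m%:R * (1 + `|lam|) ^+ 2) + 1.
have mp : 0 <= m%:R * (1 + `|lam|) :> R by rewrite mulr_ge0 // addr_ge0.
have mp2 : m%:R * (1 + `|lam|) <= m%:R * (1 + `|lam|) ^+ 2 :> R.
  by rewrite expr2 mulrA ler_peMr // lerDl.
have k0 := perturb_const_gt0.
have K0 : 0 < K by rewrite /K; lra.
(* The first three bounds are the smallness conditions of [eigenvectors_near], the other three make
   both estimates at most [eta]. [K] is such that [del * kappa] and [16 del m (1 + |lam|)^2], which
   is [8] times [2 tau (1 + |lam|)], are at most [b]. *)
pose b := Num.min (Num.min ((g - rho) / 4) (Num.min 1 rho))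
  (Num.min ((g - rho) * eta) (Num.min (eta / 2) ((g - rho) * eta / (2 * rho)))).
have b0 : 0 < b.
  by rewrite /b !lt_min rho0 ltr01 !divr_gt0 ?mulr_gt0.
have : b <= b by []; rewrite {2}/b !le_min.
case/andP=> /andP[b1 /andP[b2 b3]] /andP[b4 /andP[b5 b6]].
pose del := b / K; have d0 : 0 < del by rewrite divr_gt0.
have dK : del * K = b by rewrite divfK // gt_eqF.
have dk0 : 0 < del * kappa by rewrite mulr_gt0.
have dm : 16 * (del * (m%:R * (1 + `|lam|) ^+ 2)) <= b.
  have : 0 <= del * kappa + del by rewrite addr_ge0 ?ltW.
  by move: dK; rewrite /K; lra.
have dm0 : del * (m%:R * (1 + `|lam|)) <= del * (m%:R * (1 + `|lam|) ^+ 2).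
  by rewrite ler_wpM2l // ltW.
have dmp : 0 <= del * (m%:R * (1 + `|lam|)) by rewrite mulr_ge0 // ltW.
have dk : del * kappa <= b.
  have : 0 <= del * (m%:R * (1 + `|lam|) ^+ 2) by exact: le_trans dm0.
  by move: dK; rewrite /K; lra.
exists del => // B sB BA AB; split; last first.
  have := @eigenvectors_near B del sB (ltW d0) BA AB.
  by apply=> //; lra.
move=> u mu Bu uE mul.
have [] := @near_eigenspace B del mu u (ltW d0) BA Bu mul.
rewrite uE subrr rnorm0 !add0r => h1 h2.
have u0 := rnorm_ge0 u; have kb := ler_wpM2r u0 (le_trans dk b4).
split; first by rewrite -(ler_pM2l g1p); lra.
have h3 : `|mu - lam| * `‖u - proj e0 u‖ <= eta / 2 * `‖u‖.
  apply: le_trans (ler_wpM2r (rnorm_ge0 _) mul) _.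
  rewrite -(ler_pM2l g1p) mulrCA (le_trans (ler_wpM2l (ltW rho0) h1)) //.
  have := ler_wpM2r u0 (le_trans dk b6).
  move=> /(ler_wpM2l (ltW rho0)) /le_trans; apply.
  by rewrite le_eqVlt; apply/orP; left; apply/eqP; field; rewrite gt_eqF.
have h4 := ler_wpM2r u0 (le_trans dk b5).
have := ler_wpM2l (normr_ge0 (mu - lam)) (rnorm_le_dist u (proj e0 u)).
by lra.
Qed.

End Perturbation.

(** * The closed graph theorem *)

Section ClosedGraph.
Context (R : realType).
Local Notation C := R[i].

Lemma geometric_small (c e : R) : 0 <= c -> 0 < e -> exists n, c * 2^-1 ^+ n < e.
Proof.
move=> c0 e0; exists (Num.truncn (c / e)).+1.
rewrite exprVn ltr_pdivrMr ?exprn_gt0 // mulrC -ltr_pdivrMr //.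
apply: lt_trans (truncnS_gt _) _.
by rewrite -natrX ltr_nat ltn_expl.
Qed.

Context (U W : completeNormedModType C) (f : {linear U -> W}).

(** Baire's argument: otherwise every ball contains a smaller one on which [‖f‖] exceeds a
    prescribed integer, and nested balls would have a common point with [‖f‖] beyond all
    integers. *)
Lemma bounded_on_dense_ball : exists (M r : R) (x0 : U), 0 < r /\
  forall x, `‖x - x0‖ <= r ->
  forall e, 0 < e -> exists z, `‖z - x‖ < e /\ `‖f z‖ <= M.
Proof.
apply: contrapT => nex.
have step (b : nat * (U * R)) : exists b' : U * R, 0 < b.2.2 ->
    [/\ 0 < b'.2, b'.2 <= b.2.2 / 2, `‖b'.1 - b.2.1‖ <= b.2.2 / 2 &
     forall z, `‖z - b'.1‖ <= b'.2 -> b.1%:R < `‖f z‖].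
  case: b => n [x r] /=; have [r0|r0] := ltP 0 r; last first.
    by exists (x, r).
  apply: contrapT => nb; apply: nex; exists n%:R, (r / 2), x.
  split=> [|x' x'x e e0]; first by rewrite divr_gt0.
  apply: contrapT => nz; apply: nb; exists (x', Num.min (e / 2) (r / 2)) => _ /=.
  split=> //; first by rewrite lt_min !divr_gt0.
    by rewrite ge_min lexx orbT.
  move=> z zx'; rewrite ltNge; apply/negP => fz; apply: nz; exists z; split=> //.
  apply: le_lt_trans zx' _; rewrite gt_min ltr_pdivrMr //; apply/orP; left.
  by lra.
have [g gP] := choice step.
pose fix b n : U * R := if n is k.+1 then g (k, b k) else (0, 1).
have b0 n : 0 < (b n).2 by elim: n => [|n ih] //=; have [] := gP (n, b n) ih.
have bS n := gP (n, b n) (b0 n).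
have b_le n : (b n).2 <= 2^-1 ^+ n.
  elim: n => [|n ih]; first by rewrite expr0.
  by have [_ h _ _] := bS n; rewrite exprSr; apply: le_trans h _; rewrite /=; lra.
have ball_in n p x : `‖x - (b (n + p)%N).1‖ <= (b (n + p)%N).2 ->
    `‖x - (b n).1‖ <= (b n).2.
  elim: p => [|p ih]; first by rewrite addn0.
  rewrite addnS => h; apply: ih; have [_ h1 h2 _] := bS (n + p)%N.
  by have := rdist_triangle (b (n + p).+1).1 x (b (n + p)%N).1; move: h h1 h2 => /=; lra.
have center n p : (n <= p)%N -> `‖(b p).1 - (b n).1‖ <= (b n).2.
  move=> /subnKC pE; rewrite -pE; apply: ball_in (p - n)%N _ _.
  by rewrite pE subrr rnorm0 ltW.
have [|l lP] := @rcomplete_seq R U (fun n => (b n).1).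
  move=> e e0; have [n ne] := geometric_small (ler0n R 2) e0; exists n => p q np nq.
  have := rdist_triangle (b n).1 (b p).1 (b q).1; rewrite (rdistC (b n).1).
  by have := center _ _ np; have := center _ _ nq; have := b_le n => /=; lra.
have l_in n : `‖l - (b n).1‖ <= (b n).2.
  apply/ler_addgt0Pr => e /lP[p hp].
  have h1 := hp _ (leq_maxr n p); have h2 := center _ _ (leq_maxl n p).
  by have := rdist_triangle (b (maxn n p)).1 l (b n).1; rewrite (rdistC l (b (maxn n p)).1); move: h1 => /=; lra.
(* The ball of index [n.+1] forces [n < ‖f z‖], whence the shift of the index. *)
have : (Num.truncn `‖f l‖).+1%:R < `‖f l‖.
  have [_ _ _] := bS (Num.truncn `‖f l‖).+1; apply.
  exact: (l_in (Num.truncn `‖f l‖).+2).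
by move/(lt_trans (truncnS_gt _)); rewrite ltxx.
Qed.

(* Successive approximation: x is the sum of vectors whose images under f have
   geometrically decreasing norms. *)
Theorem closed_graph :
  (forall x y, (forall e : R, 0 < e ->
     exists z, `‖z - x‖ < e /\ `‖f z - y‖ < e) -> f x = y) ->
  exists2 c : R, 0 < c & forall x, `‖f x‖ <= c * `‖x‖.
Proof.
move=> cl; have [M0 [r [x0 [r0 dense0]]]] := bounded_on_dense_ball.
pose M := `|M0| + 1; have M_gt0 : 0 < M by rewrite ltr_wpDl.
have M0M : M0 <= M by have := ler_norm M0; rewrite /M; lra.
pose c := 2 * M / r; have c0 : 0 < c by rewrite divr_gt0 // mulr_gt0.
(* Differences move the ball from [x0] to the origin and double the bound. *)
have dense_ball x e : `‖x‖ <= r -> 0 < e ->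
    exists z, `‖z - x‖ < e /\ `‖f z‖ <= 2 * M.
  move=> xr e0; have e2 : 0 < e / 2 by rewrite divr_gt0.
  have [|z1 [z1x fz1]] := dense0 (x + x0) _ _ e2; first by rewrite addrK.
  have [|z2 [z2x fz2]] := dense0 x0 _ _ e2; first by rewrite subrr rnorm0 ltW.
  exists (z1 - z2); split; last by rewrite linearB; have := rnormB (f z1) (f z2); lra.
  have -> : z1 - z2 - x = (z1 - (x + x0)) - (z2 - x0) by lmod R U.
  by have := rnormB (z1 - (x + x0)) (z2 - x0); lra.
have approx (p : U * R) : exists z, 0 < p.2 ->
    `‖z - p.1‖ <= p.2 /\ `‖f z‖ <= c * `‖p.1‖.
  case: p => x e /=; have [->|x_neq0] := eqVneq x 0.
    by exists 0 => e0; rewrite subrr linear0 !rnorm0 mulr0 ltW.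
  have xp : 0 < `‖x‖ by rewrite rnorm_gt0.
  pose t := r / `‖x‖; have t0 : 0 < t by rewrite divr_gt0.
  have [e0|e0] := ltP 0 e; last by exists 0.
  have tx : `‖t%:C *: x‖ <= r.
    by rewrite rnormZ rnorm_real gtr0_norm // divfK // gt_eqF.
  have [z [zx fz]] := dense_ball _ _ tx (mulr_gt0 t0 e0).
  exists ((t^-1)%:C *: z) => _; split.
    have -> : (t^-1)%:C *: z - x = (t^-1)%:C *: (z - t%:C *: x).
      by rewrite scalerBr scalerA -rcM mulVf ?gt_eqF // scale1r.
    rewrite rnormZ rnorm_real gtr0_norm ?invr_gt0 // mulrC ler_pdivrMr //.
    by rewrite mulrC ltW.
  rewrite linearZ /= rnormZ rnorm_real gtr0_norm ?invr_gt0 // /t invf_div.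
  rewrite mulrAC ler_pdivrMr // /c -!mulrA (mulrCA r^-1) mulVf ?gt_eqF //.
  by rewrite mulr1 mulrA mulrC ler_wpM2r // ltW.
have [g gP] := choice approx.
exists (2 * c) => [|x]; first by rewrite mulr_gt0.
have [->|x_neq0] := eqVneq x 0; first by rewrite linear0 !rnorm0 mulr0.
have xp : 0 < `‖x‖ by rewrite rnorm_gt0.
pose h k : R := `‖x‖ * 2^-1 ^+ k.
have h0 k : 0 < h k by rewrite mulr_gt0 // exprn_gt0.
have hS k : h k = 2 * h k.+1 by rewrite /h exprSr; field.
pose fix rem k : U := if k is j.+1 then rem j - g (rem j, h j.+1) else x.
have remS k := gP (rem k, h k.+1) (h0 k.+1).
have rem_le k : `‖rem k‖ <= h k.
  case: k => [|k]; first by rewrite /h expr0 mulr1.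
  by have [h1 _] := remS k; rewrite /= rdistC.
have step_le k : `‖f (rem k) - f (rem k.+1)‖ <= c * h k.
  rewrite /= -linearB opprB addrC subrK.
  have [_ h1] := remS k; apply: le_trans h1 _.
  by apply: ler_wpM2l; [exact: ltW|exact: rem_le].
(* Since [h k = 2 h k.+1], each step [c h k] equals [2 c (h k - h k.+1)] and the sum telescopes. *)
have tail k p : `‖f (rem k) - f (rem (k + p)%N)‖ <= 2 * c * (h k - h (k + p)%N).
  elim: p => [|p ih]; first by rewrite addn0 !subrr rnorm0 mulr0.
  have := step_le (k + p)%N.
  have := rdist_triangle (f (rem (k + p)%N)) (f (rem k)) (f (rem (k + p).+1)).
  by rewrite addnS; have := hS (k + p)%N; nra.
have tail' k p : (k <= p)%N -> `‖f (rem k) - f (rem p)‖ <= 2 * c * h k.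
  move=> /subnKC pE; rewrite -pE; apply: le_trans (tail _ _) _.
  by apply: ler_wpM2l; [rewrite mulr_ge0 // ltW|rewrite gerBl ltW].
have small e : 0 < e -> exists k, 2 * (2 * c * h k) < e.
  move=> e0; have [|k hk] := @geometric_small (4 * c * `‖x‖) e _ e0.
    by rewrite mulr_ge0 ?rnorm_ge0 // mulr_ge0 // ltW.
  by exists k; rewrite /h; apply: le_lt_trans hk; rewrite le_eqVlt; apply/orP; left; apply/eqP; ring.
have fB u v : f (u - v) = f u - f v by exact: linearB.
have [|d dP] := @rcomplete_seq R W (fun k => f (x - rem k)).
  move=> e e0; have [k ke] := small _ e0; exists k => p q kp kq.
  have -> : f (x - rem p) - f (x - rem q) = (f (rem k) - f (rem p)) - (f (rem k) - f (rem q)).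
    by rewrite !fB; lmod R W.
  have := rnormB (f (rem k) - f (rem p)) (f (rem k) - f (rem q)).
  by have := tail' _ _ kp; have := tail' _ _ kq; lra.
have hle k p : (k <= p)%N -> h p <= h k.
  move=> kp; rewrite ler_pM2l // ler_wiXn2l ?invr_ge0 //.
  by rewrite invf_le1 // ler1n.
have -> : f x = d.
  apply: cl => e e0; have [n hn] := dP _ e0.
  have [k hk] := geometric_small (ltW xp) e0.
  exists (x - rem (maxn n k)); split; last exact: hn (leq_maxl _ _).
  rewrite rdistC opprB addrC subrK.
  by apply: le_lt_trans (rem_le _) _; apply: le_lt_trans hk; exact: hle (leq_maxr _ _).
apply/ler_addgt0Pr => e /dP[n hn].
have := hn _ (leqnn n); have := tail' _ _ (leq0n n).
rewrite /= -linearB /h expr0 mulr1.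
by have := rnorm_le_dist d (f (x - rem n)); rewrite rdistC; lra.
Qed.

End ClosedGraph.

(** * Matching two nearly coincident bases *)

Section Matching.
Context (R : realType).
Local Notation C := R[i].

Lemma rnorm_prod (I : Type) (r : seq I) (P : pred I) (F : I -> C) :
  `‖\prod_(k <- r | P k) F k‖ = \prod_(k <- r | P k) `‖F k‖.
Proof. by apply: (big_morph _ (@rnormM R)); exact: rnorm1. Qed.

Lemma prod_le_factor (I : finType) (F : I -> R) (k : I) :
  (forall j, 0 <= F j <= 1) -> \prod_j F j <= F k.
Proof.
move=> F01; rewrite (bigD1 k) //= ler_piMr //; first by case/andP: (F01 k).
by apply: prodr_ile1 => j _.
Qed.

Lemma prod_ge_bernoulli (I : Type) (r : seq I) (F : I -> R) (d : R) :
  0 <= d <= 1 -> (forall j, 1 - d <= F j) ->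
  1 - (size r)%:R * d <= \prod_(j <- r) F j /\ 0 <= \prod_(j <- r) F j.
Proof.
case/andP=> d0 d1 Fd; elim: r => [|j r [ih1 ih2]].
  by rewrite big_nil mul0r subr0.
rewrite big_cons /= -natr1; set p := \prod_(_ <- _) _ in ih1 ih2 *.
have := Fd j; have : 0 <= (size r)%:R :> R by []; move: (size r)%:R ih1 => n ih1 n0 Fj.
split; last by apply: mulr_ge0 => //; lra.
have h : (1 - d) * p <= F j * p by rewrite ler_wpM2r.
apply: le_trans h; have : (1 - d) * (1 - n * d) <= (1 - d) * p by rewrite ler_wpM2l // subr_ge0.
apply: le_trans; have : 0 <= n * (d * d) by rewrite !mulr_ge0.
by lra.
Qed.

Context (H : hilbertType R) (m : nat).

Definition matching_const : R := (2 * (m`!)%:R)^-1.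

Lemma matching_const_gt0 : 0 < matching_const.
Proof. by rewrite invr_gt0 mulr_gt0 // ltr0n fact_gt0. Qed.

(* The Gram matrix of the projected vectors is close to the identity, so the
   determinant of the coefficient matrix is at least 1/2 and one of the m!
   terms of its Leibniz expansion is at least 1/(2 m!). *)
Lemma near_bases_matching (e u : 'I_m -> H) (d : R) :
  orthonormal_family e -> orthonormal_family u -> 0 <= d <= 1 ->
  (m%:R + (m`!)%:R) * d <= 2^-1 ->
  (forall j, `‖e j - proj u (e j)‖ <= d) ->
  exists s : {perm 'I_m}, forall j, matching_const <= `‖⟨e j, u (s j)⟩‖.
Proof.
move=> eo uo d01 d_small ed; have [d0 d1] := andP d01.
pose M : 'M[C]_m := \matrix_(j, k) ⟨e j, u k⟩.
pose G : 'M[C]_m := \matrix_(j, l) ⟨proj u (e j), proj u (e l)⟩.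
have GE : G = M *m (map_mx (@conjc R) M)^T.
  apply/matrixP => j l; rewrite !mxE dot_sumr; apply: eq_bigr => k _.
  by rewrite !mxE dotZr dot_proj // mulrC.
have detG : `‖\det G‖ = `‖\det M‖ ^+ 2.
  by rewrite GE det_mulmx det_tr det_map_mx /= rnormM rnorm_conj.
have Gd j l : G j l = (j == l)%:R - ⟨e j - proj u (e j), e l - proj u (e l)⟩.
  rewrite mxE -eo (dotBr (e l)) [X in _ - (_ - X)](_ : _ = 0); last exact: dot_compl_comb.
  by rewrite subr0 dotBl opprB addrC subrK [RHS]dotC -[in RHS](proj_projl uo) -dotC.
have G1 j l : `‖G j l‖ <= 1.
  rewrite mxE; apply: le_trans (dot_cauchy _ _) _.
  rewrite -[leRHS]mulr1 ler_pM ?rnorm_ge0 //;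
    by apply: le_trans (rnorm_proj uo _) _; rewrite orthonormal_norm.
have err j l : `‖⟨e j - proj u (e j), e l - proj u (e l)⟩‖ <= d.
  apply: le_trans (dot_cauchy _ _) _; rewrite -[leRHS]mulr1.
  by rewrite ler_pM ?rnorm_ge0 // (le_trans (ed _)).
have Goff j l : j != l -> `‖G j l‖ <= d.
  by move=> jl; rewrite Gd (negPf jl) sub0r rnormN.
have Gdiag j : 1 - d <= `‖G j j‖.
  have := rnorm_le_dist (1 : C) (G j j); rewrite rnorm1.
  have -> : 1 - G j j = ⟨e j - proj u (e j), e j - proj u (e j)⟩.
    by rewrite Gd eqxx opprB addrC subrK.
  by have := err j j; lra.
(* The identity contributes at least [1 - m d]. Any other permutation has a factor off the diagonal,
   so the remaining terms sum to at most [m! d]. *)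
have detG_ge : 2^-1 <= `‖\det G‖.
  have prodG (s : {perm 'I_m}) : s != 1%g -> \prod_j `‖G j (s j)‖ <= d.
    move=> s1; have [j sj] : exists j, s j != j.
      apply/existsP; apply: contraNT s1; rewrite negb_exists => /forallP sE.
      by apply/eqP/permP => j; rewrite perm1; apply/eqP; have := sE j; rewrite negbK.
    apply: le_trans (prod_le_factor j _) _; first by move=> k; rewrite rnorm_ge0 G1.
    by apply: Goff; rewrite eq_sym.
  rewrite /determinant (bigD1 1%g) //= odd_perm1 expr0 mul1r.
  set p := \prod_i _; set q := \sum_(_ | _) _.
  have p_ge : 1 - m%:R * d <= `‖p‖.
    rewrite rnorm_prod; have [+ _] := @prod_ge_bernoulli 'I_m (index_enum _) (fun j => `‖G j j‖) d d01 Gdiag.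
    rewrite -[size _](_ : m = _); last by rewrite -[LHS]card_ord cardT enumT.
    by under [X in _ -> _ <= X]eq_bigr do rewrite perm1.
  have q_le : `‖q‖ <= (m`!)%:R * d.
    apply: le_trans (rnorm_sum _ _ _) _.
    apply: le_trans (_ : \sum_(s : {perm 'I_m}) d <= _); last first.
      by rewrite sumr_const card_Sn mulr_natl.
    rewrite [leRHS](bigID (fun s => s != 1%g)) /= -[leLHS]addr0; apply: lerD.
      apply: ler_sum => s /prodG; rewrite rnormM rnorm_prod.
      by rewrite [X in X * _](_ : _ = 1) ?mul1r //; case: (odd_perm s);
        rewrite ?expr0 ?expr1 ?rnormN rnorm1.
    by apply: sumr_ge0.
  have := rnorm_le_dist p (- q); rewrite opprK rnormN.
  by move: d_small; rewrite mulrDl; lra.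
have detM_ge : 2^-1 <= `‖\det M‖.
  by have := rnorm_ge0 (\det M); move: detG_ge; rewrite detG; nra.
have [s hs] : exists s : {perm 'I_m}, matching_const <= \prod_j `‖M j (s j)‖.
  apply: contrapT => /forallNP ns; have := detM_ge; rewrite leNgt => /negP; apply.
  apply: le_lt_trans (rnorm_sum _ _ _) _.
  apply: lt_le_trans (_ : \sum_(s : {perm 'I_m}) matching_const <= _); last first.
    rewrite sumr_const card_Sn -mulr_natl /matching_const le_eqVlt.
    apply/orP; left; apply/eqP; field.
    by rewrite pnatr_eq0 -lt0n fact_gt0.
  apply: ltr_sum => [|s _]; first by apply/hasP; exists 1%g.
  rewrite rnormM rnorm_prod [X in X * _](_ : _ = 1) ?mul1r.
    by rewrite ltNge; apply/negP; exact: ns.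
  by case: (odd_perm s); rewrite ?expr0 ?expr1 ?rnormN rnorm1.
exists s => j; apply: le_trans hs _.
apply: le_trans (prod_le_factor j _) _; last by rewrite mxE.
move=> k; rewrite rnorm_ge0 mxE; apply: le_trans (dot_cauchy _ _) _.
by rewrite !orthonormal_norm // mulr1.
Qed.

End Matching.

(** * Resolvents *)

Section Resolvent.
Context (R : realType) (H : hilbertType R).
Local Notation C := R[i].
Implicit Types (A : operator H) (u v w h : H).

Lemma selfadj_shift_inj A u v : selfadj A -> dom A u -> dom A v ->
  A u - 'i%C *: u = A v - 'i%C *: v -> u = v.
Proof.
move=> sA Au Av /eqP; rewrite -subr_eq0 => /eqP E.
have := selfadj_shift_sqr sA (dom_sub Au Av); rewrite op_sub //.
have -> : A u - A v - 'i%C *: (u - v) = 0 by rewrite -E; lmod R H.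
move=> h; apply/eqP; rewrite -subr_eq0 -rnorm_eq0 -sqrf_eq0.
move: h; rewrite rnorm0 expr0n /= => h.
by have := sqr_ge0 `‖A u - A v‖; have := sqr_ge0 `‖u - v‖; rewrite eq_le; lra.
Qed.

Lemma resolventP A h : selfadj A ->
  dom A (resolvent A 'i%C h) /\ A (resolvent A 'i%C h) - 'i%C *: resolvent A 'i%C h = h.
Proof.
move=> /(selfadj_surj h)[u uP].
exact: (@xgetI H 0 [set u | dom A u /\ A u - 'i%C *: u = h] u uP).
Qed.

Lemma resolventK A w : selfadj A -> dom A w ->
  resolvent A 'i%C (A w - 'i%C *: w) = w.
Proof.
move=> sA Aw; have [h1 h2] := resolventP (A w - 'i%C *: w) sA.
exact: selfadj_shift_inj h2.
Qed.

Lemma resolvent_linear A (a : C) h h' : selfadj A ->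
  resolvent A 'i%C (a *: h + h') = a *: resolvent A 'i%C h + resolvent A 'i%C h'.
Proof.
move=> sA; have [d1 e1] := resolventP h sA; have [d2 e2] := resolventP h' sA.
have [d3 e3] := resolventP (a *: h + h') sA.
apply: (selfadj_shift_inj sA) => //; first exact: dom_linear.
by rewrite e3 op_linear // -{1}e1 -{1}e2; lmod R H.
Qed.

Lemma resolvent_rnorm A h : selfadj A -> `‖resolvent A 'i%C h‖ <= `‖h‖.
Proof.
move=> sA; have [d e] := resolventP h sA.
rewrite -(@ler_pXn2r _ 2) ?nnegrE ?rnorm_ge0 // -{2}e selfadj_shift_sqr //.
by rewrite lerDr sqr_ge0.
Qed.

(** The partner of [w] is [f = (A2 - i)^-1 (A1 - i) w]: then [w - f] is a difference of resolvents
    at one vector, and [A1 w - A2 f = i (w - f)] needs no further estimate. *)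
Lemma resolvent_graph_close (A1 A2 : operator H) (V1 V2 : {linear H -> H})
    (eps c : R) : selfadj A1 -> selfadj A2 -> 0 <= eps <= 1 -> 0 <= c ->
  (forall h, `‖resolvent A1 'i%C h - resolvent A2 'i%C h‖ <= eps * `‖h‖) ->
  (forall h, `‖V1 h - V2 h‖ <= eps * `‖h‖) ->
  (forall h, `‖V1 h‖ <= c * `‖h‖) -> (forall h, `‖V2 h‖ <= c * `‖h‖) ->
  graph_close (eps * ((1 + c) ^+ 2 + 1)) (add_op A1 V1) (add_op A2 V2).
Proof.
move=> s1 s2 /andP[eps0 eps1] c0 Re Ve V1c V2c w Aw.
pose h := A1 w - 'i%C *: w; pose f := resolvent A2 'i%C h.
have [Af fE] := resolventP h s2; rewrite -/f in Af fE.
pose n := `‖add_op A1 V1 w‖ + `‖w‖; rewrite -/n.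
have w0 := rnorm_ge0 w; have a0 := rnorm_ge0 (add_op A1 V1 w).
have h_le : `‖h‖ <= (1 + c) * n.
  have -> : h = add_op A1 V1 w - (V1 w + 'i%C *: w) by rewrite /h /=; lmod R H.
  have := rnormB (add_op A1 V1 w) (V1 w + 'i%C *: w).
  have := rnormD (V1 w) ('i%C *: w); have := V1c w.
  rewrite rnormZ rnorm_i mul1r /n.
  by have := mulr_ge0 c0 a0; lra.
have wf : `‖w - f‖ <= eps * ((1 + c) * n).
  rewrite -{1}(resolventK s1 Aw); apply: le_trans (Re h) _.
  by rewrite ler_wpM2l.
have n0 : 0 <= n by rewrite addr_ge0.
exists f; split=> //=.
  apply: le_trans wf _; rewrite -mulrA ler_wpM2l //.
  by rewrite ler_wpM2r // expr2; nra.
have -> : A1 w + V1 w - (A2 f + V2 f) = 'i%C *: (w - f) + (V1 w - V2 w) + V2 (w - f).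
  have -> : A2 f = h + 'i%C *: f by rewrite -fE subrK.
  have -> : V2 (w - f) = V2 w - V2 f by exact: linearB.
  by rewrite /h; lmod R H.
have := rnormD ('i%C *: (w - f) + (V1 w - V2 w)) (V2 (w - f)).
have := rnormD ('i%C *: (w - f)) (V1 w - V2 w).
rewrite rnormZ rnorm_i mul1r; have := Ve w; have := V2c (w - f).
have : eps * `‖w‖ <= eps * n by rewrite ler_wpM2l // /n lerDr.
have := ler_wpM2l c0 wf.
by lra.
Qed.

End Resolvent.

(** * Finite-dimensional subspaces and their orthonormal bases *)

Section Dimension.
Context (R : realType) (H : hilbertType R) (S : set H) (m : nat).
Local Notation C := R[i].
Context (S_dim : has_dim S m).

Lemma has_dim_sub (a : C) u v : S u -> S v -> S (a *: u + v).
Proof.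
have [b [_ ->]] := S_dim; move=> [c _ <-] [d _ <-].
exists (fun k => a * c k + d k) => //.
rewrite scaler_sumr -big_split; apply: eq_bigr => k _.
by rewrite scalerDl scalerA.
Qed.

Lemma has_dim_comb n (c : 'I_n -> C) (e : 'I_n -> H) :
  (forall k, S (e k)) -> S (\sum_k c k *: e k).
Proof.
move=> Se; have S0 : S 0.
  have [b [_ ->]] := S_dim; exists (fun=> 0) => //.
  by rewrite big1 // => k _; rewrite scale0r.
elim/big_ind : _ => [|u v Su Sv|k _] //.
  by rewrite -[u]scale1r; exact: has_dim_sub.
by rewrite -[_ *: _]addr0; exact: has_dim_sub.
Qed.

Lemma orthonormal_in_subspace k : (k <= m)%N ->
  exists e : 'I_k -> H, orthonormal_family e /\ forall j, S (e j).
Proof.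
elim: k => [|k ih] km; first by exists (fun=> 0); split=> [[]|[]].
have [e [eo Se]] := ih (ltnW km).
have [b [b_free SE]] := S_dim.
have [v [[j vj] vA]] := exists_left_kernel (\matrix_(j, l) ⟨b j, e l⟩) km.
pose u := \sum_j v j *: b j.
have u0 : u != 0.
  by apply: contra_neq vj => /b_free /(_ j).
have Su : S u by rewrite SE; exists v.
have ue l : ⟨u, e l⟩ = 0.
  by rewrite dot_suml -[RHS](vA l); apply: eq_bigr => j' _; rewrite mxE dotZl.
pose u' := (`‖u‖^-1)%:C *: u.
have u'1 : ⟨u', u'⟩ = 1.
  rewrite dotE rnormZ rnorm_real ger0_norm ?invr_ge0 ?rnorm_ge0 //.
  by rewrite mulVf ?rnorm_eq0 // expr1n.
have u'e l : ⟨u', e l⟩ = 0 by rewrite dotZl ue mulr0.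
have eu' l : ⟨e l, u'⟩ = 0 by rewrite dotC u'e conjc0.
exists (fun j => if unlift ord_max j is Some l then e l else u'); split.
  move=> i i'; case: unliftP => [l|] ->; case: unliftP => [l'|] ->.
  + by rewrite eo (inj_eq lift_inj).
  + by rewrite eu' eq_sym (negPf (neq_lift _ _)).
  + by rewrite u'e (negPf (neq_lift _ _)).
  + by rewrite u'1 eqxx.
move=> i; case: unliftP => [l|] _ //.
have := @has_dim_comb 1 (fun=> (`‖u‖^-1)%:C) (fun=> u) (fun=> Su).
by rewrite big_ord1.
Qed.

(** A nonzero [u - proj e u] would extend [e] to [m.+1] nonzero orthogonal vectors, whose
    coordinates in a basis of [S] satisfy a nontrivial linear relation. *)
Lemma orthonormal_span (e : 'I_m -> H) : orthonormal_family e -> (forall j, S (e j)) ->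
  forall u, S u -> u = proj e u.
Proof.
move=> eo Se u Su; have [b [b_free SE]] := S_dim.
have coord v : S v -> exists c : 'I_m -> C, v = \sum_k c k *: b k.
  by rewrite SE => -[c _ <-]; exists c.
apply/eqP; rewrite -subr_eq0; apply/negPn/negP => w0.
pose w := u - proj e u.
have Sw : S w.
  rewrite /w -scaleN1r addrC; apply: has_dim_sub => //; exact: has_dim_comb.
pose x j := if unlift ord_max j is Some l then e l else w : H.
have Sx j : S (x j) by rewrite /x; case: unliftP.
have [c cP] := choice (fun j => coord (x j) (Sx j)).
have [v [[j vj] vA]] := exists_left_kernel (\matrix_(j, l) c j l) (ltnSn m).
have vx : \sum_j v j *: x j = 0.
  under eq_bigr do rewrite cP scaler_sumr.
  rewrite exchange_big big1 // => l _; under eq_bigr do rewrite scalerA.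
  rewrite -scaler_suml (_ : \sum_(j < m.+1) _ = 0) ?scale0r // -[RHS](vA l).
  by apply: eq_bigr => j' _; rewrite mxE.
have we l : ⟨w, e l⟩ = 0 by exact: dot_compl.
have ew l : ⟨e l, w⟩ = 0 by rewrite dotC we conjc0.
have xo a b' : a != b' -> ⟨x a, x b'⟩ = 0.
  rewrite /x; case: unliftP => [l|] ->; case: unliftP => [l'|] ->.
  + by rewrite (inj_eq lift_inj) eo => /negPf ->.
  + by rewrite ew.
  + by rewrite we.
  + by rewrite eqxx.
have : ⟨\sum_j v j *: x j, x j⟩ = v j * ⟨x j, x j⟩.
  rewrite dot_suml (bigD1 j) //= dotZl big1 ?addr0 // => j' j'j.
  by rewrite dotZl xo // mulr0.
rewrite vx dot0l => /esym/eqP; rewrite mulf_eq0 (negPf vj) /= => /eqP /dot_eq0 xj.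
move: xj; rewrite /x; case: unliftP => [l _|_] h.
  by have := eo l l; rewrite h dot0l eqxx => /esym/eqP; rewrite oner_eq0.
by move: w0; rewrite -/w h eqxx.
Qed.

End Dimension.

Lemma orthonormal_has_dim (R : realType) (H : hilbertType R) n (e : 'I_n -> H) :
  orthonormal_family e -> has_dim [set \sum_k c k *: e k | c in [set: 'I_n -> R[i]]] n.
Proof.
move=> eo; exists e; split=> // c c0 k.
by rewrite -(dot_combl c k eo) c0 dot0l.
Qed.

Section OpnormLimits.
Context (R : realType).
Local Notation C := R[i].
Context (U W : normedModType C).

(** Homogeneity is asked only near the limit, because differences of embedded resolvents have it
    only for parameters in the unit interval. *)
Lemma opnorm_cvg0 (T : Type) (F : set_system T) (FF : Filter F) (f : T -> U -> W) :
  opnorm (f t) @[t --> F] --> 0%E ->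
  (\forall t \near F, forall (a : C) x, f t (a *: x) = a *: f t x) ->
  forall e : R, 0 < e -> \forall t \near F, forall x, `‖f t x‖ <= e * `‖x‖.
Proof.
move=> f0 fZ e e0.
have : nbhs 0%E [set y : \bar R | (y < e%:E)%E].
  by apply: open_ereal_lt'; rewrite lte_fin.
move=> /f0 h; have {}h : F [set t | (opnorm (f t) < e%:E)%E] by exact: h.
apply: filterS (filterI h fZ) => t [/= fte fZt] x.
have [->|x0] := eqVneq x 0.
  by rewrite -[0](scale0r 0) fZt !scale0r !rnorm0 mulr0.
have xp : 0 < `‖x‖ by rewrite rnorm_gt0.
have : ((`‖f t ((`‖x‖^-1)%:C *: x)‖)%:E <= opnorm (f t))%E.
  apply: ereal_sup_ubound; exists ((`‖x‖^-1)%:C *: x) => //=.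
  rewrite rnormE rnormZ rnorm_real ger0_norm ?invr_ge0 ?rnorm_ge0 //.
  by rewrite mulVf // gt_eqF.
move=> /le_lt_trans /(_ fte); rewrite lte_fin fZt rnormZ rnorm_real.
rewrite ger0_norm ?invr_ge0 ?rnorm_ge0 // mulrC ltr_pdivrMr //; exact: ltW.
Qed.

End OpnormLimits.

(** * One-sided limits in the unit interval *)

Section UnitFilter.
Context (R : realType) (t0 : R) (t0_unit : unit_itv t0).

(** Properness turns estimates for [t] near [t0] into identities free of [t], as in
    [near_to_unit_eq0]; this is how relations are differentiated below. *)
Lemma to_unit_proper : ProperFilter (to_unit t0).
Proof.
apply: Build_ProperFilter_ex => P [e /= e0 he].
move: t0_unit; rewrite /unit_itv /= in_itv /= => /andP[h0 h1].
pose d := Num.min (e / 2) 2^-1; have d0 : 0 < d by rewrite lt_min divr_gt0 //= invr_gt0.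
have de : d < e by rewrite gt_min ltr_pdivrMr //; apply/orP; left; lra.
have d2 : d <= 2^-1 by rewrite ge_min lexx orbT.
have [t0h|t0h] := leP t0 2^-1.
  exists (t0 + d); apply: he => /=.
  - by rewrite opprD addrA subrr sub0r normrN gtr0_norm.
  - by rewrite gt_eqF // ltrDl.
  - by rewrite /unit_itv /= in_itv /=; lra.
exists (t0 - d); apply: he => /=.
- by rewrite opprB addrC subrK gtr0_norm.
- by rewrite lt_eqF // ltrBlDr ltrDl.
- by rewrite /unit_itv /= in_itv /=; lra.
Qed.

Lemma near_to_unit (P : R -> Prop) :
  (exists2 e : R, 0 < e & forall t, unit_itv t -> t != t0 -> `|t - t0| < e -> P t) ->
  \forall t \near to_unit t0, P t.
Proof.
move=> [e e0 h]; exists e => //= t /= te tt0 tu; apply: h => //.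
by rewrite distrC.
Qed.

Lemma near_full_unit (P : R -> Prop) : P t0 -> (\forall t \near to_unit t0, P t) ->
  \forall t \near within unit_itv (nbhs t0), P t.
Proof.
move=> P0 [e /= e0 h]; exists e => //= t te tu.
by have [->//|tt0] := eqVneq t t0; exact: h.
Qed.

Lemma near_to_unit_eq0 (V : normedZmodType R[i]) (x : V) (c : R) :
  (forall e : R, 0 < e -> \forall t \near to_unit t0, `‖x‖ <= e * c) -> x = 0.
Proof.
move=> h; apply: (@rnorm_eq0_eps _ _ _ c) => e /h /filter_ex.
by move/(_ to_unit_proper) => -[].
Qed.

Lemma near_dist (e : R) : 0 < e ->
  \forall t \near to_unit t0, [/\ unit_itv t, t - t0 != 0 & `|t - t0| <= e].
Proof.
by move=> e0; apply: near_to_unit; exists e => // t tu tt0 /ltW te; rewrite subr_eq0.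
Qed.

Lemma opnorm_derivativeP (U W : normedModType R[i]) (F : R -> {linear U -> W})
    (F' : {linear U -> W}) : opnorm_derivative F t0 F' ->
  forall e : R, 0 < e -> \forall t \near to_unit t0, forall x,
    `‖(t - t0)%:C^-1 *: (F t x - F t0 x) - F' x‖ <= e * `‖x‖.
Proof.
move=> [_ h] e e0; apply: (opnorm_cvg0 _ h) => //.
by apply: nearW => t a x; rewrite !linearZ /=; lmod R W.
Qed.

Lemma opnorm_derivative_cvg (U W : normedModType R[i]) (F : R -> {linear U -> W})
    (F' : {linear U -> W}) : opnorm_derivative F t0 F' ->
  forall e : R, 0 < e -> \forall t \near to_unit t0, forall x,
    `‖F t x - F t0 x‖ <= e * `‖x‖.
Proof.
move=> dF e e0; have [/continuous_rbounded[c c0 hc] _] := dF.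
have c1 : 0 < c + 1 by rewrite addr_gt0.
apply: filterS (filterI (near_dist (divr_gt0 e0 c1)) (opnorm_derivativeP dF ltr01)).
move=> t [[tu tt0 te] h] x; have := h x; have := hc x.
set y := F t x - F t0 x; set z := F' x; rewrite mul1r => zx yzx.
have -> : y = (t - t0)%:C *: ((t - t0)%:C^-1 *: y - z + z).
  by rewrite subrK scalerA -rcV -rcM divff // scale1r.
rewrite rnormZ rnorm_real; have := rnormD ((t - t0)%:C^-1 *: y - z) z.
have x0 := rnorm_ge0 x.
move=> /le_trans /(_ (lerD yzx zx)) hh.
apply: le_trans (ler_pM _ _ te hh) _; rewrite ?rnorm_ge0 //.
by rewrite le_eqVlt; apply/orP; left; apply/eqP; field; rewrite gt_eqF.
Qed.

End UnitFilter.

Section Projections.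
Context (R : realType) (H : hilbertType R) (P : {linear H -> H}).
Context (Pp : orthogonal_projection P).

Lemma orthoproj_dot u v : ⟨P u, v⟩ = ⟨P u, P v⟩.
Proof. by have [[_ Ps] PP] := Pp; rewrite -{1}PP Ps. Qed.

Lemma orthoproj_rnorm u : `‖P u‖ <= `‖u‖.
Proof.
have [->|Pu0] := eqVneq (P u) 0; first by rewrite rnorm0 rnorm_ge0.
have p : 0 < `‖P u‖ by rewrite rnorm_gt0.
rewrite -(ler_pM2l p) -expr2 -rdotE /rdot -orthoproj_dot.
exact: le_trans (ler_norm _) (rdot_cauchy _ _).
Qed.

Lemma orthoproj_range u : range P u -> P u = u.
Proof. by have [_ PP] := Pp => -[v _ <-]; rewrite PP. Qed.

End Projections.

(** * The symplectic form and Lagrangian projections *)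

Section SymplecticTheory.
Context (R : realType) (G : hilbertType R).
Local Notation C := R[i].
Implicit Types f g : hsum G.

Lemma hsum_dotE f g : ⟨f, g⟩ = ⟨f.1, g.1⟩ + ⟨f.2, g.2⟩.
Proof. by []. Qed.

Lemma JD f g : J (f + g) = J f + J g.
Proof. by congr (_, _); rewrite /= opprD. Qed.

Lemma JN f : J (- f) = - J f.
Proof. by congr (_, _). Qed.

Lemma JB f g : J (f - g) = J f - J g.
Proof. by rewrite JD JN. Qed.

Lemma JZ (a : C) f : J (a *: f) = a *: J f.
Proof. by congr (_, _); rewrite /= scalerN. Qed.

Lemma JJ f : J (J f) = - f.
Proof. by congr (_, _). Qed.

Lemma dotJ f g : ⟨J f, g⟩ = - ⟨f, J g⟩.
Proof. by rewrite !hsum_dotE /= dotNl dotNr opprD opprK addrC. Qed.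

Lemma rnormJ f : `‖J f‖ = `‖f‖.
Proof.
apply/eqP; rewrite -(@eqrXn2 _ 2) ?rnorm_ge0 // -!rdotE /rdot dotJ JJ dotNr.
by rewrite opprK.
Qed.

(** [J] exchanges the range of [Q] and its orthogonal complement: isotropy gives [Q J Q = 0], and
    maximality puts [J (ker Q)] into the range. *)
Lemma Lagrangian_projJ (Q : {linear hsum G -> hsum G}) :
  orthogonal_projection Q -> Lagrangian (range Q) ->
  forall f, Q (J f) = J (f - Q f).
Proof.
move=> Qp QL; have [[_ Qs] QQ] := Qp.
have QJQ f : Q (J (Q f)) = 0.
  apply: dot_eq0; rewrite Qs.
  have : range Q (Q f) by exists f.
  by rewrite QL; apply; exists (Q (J (Q f))) => //; rewrite QQ.
have JK f : Q f = 0 -> Q (J f) = J f.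
  move=> Qf; apply: orthoproj_range => //; rewrite QL => g [g' _ <-].
  by rewrite /omega JJ dotNl -Qs Qf dot0l oppr0.
move=> f; have : Q (f - Q f) = 0 by rewrite linearB /= QQ subrr.
move=> /JK <-; rewrite JB linearB /= QJQ subr0 //.
Qed.

End SymplecticTheory.

(** * The first variation *)

Section FirstVariation.
Context (R : realType) (H G : hilbertType R) (A : operator H).
Local Notation C := R[i].
Context (A_dense : dense (dom A)).
Context (D : completeNormedModType C) (i : {linear D -> H}).
Context (ci : R) (ci_gt0 : 0 < ci) (i_le : forall x, `‖i x‖ <= ci * `‖x‖).
Context (T : R -> {linear D -> hsum G}).
Context (T_bounded : forall t, unit_itv t -> continuous (T t)).
Context (T_green : forall t, unit_itv t -> forall u v : D,
  ⟨adjoint A (i u), i v⟩ - ⟨i u, adjoint A (i v)⟩ =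
  ⟨(T t u).2, (T t v).1⟩ - ⟨(T t u).1, (T t v).2⟩).
Context (Q : R -> {linear hsum G -> hsum G}).
Context (Q_proj : forall t, unit_itv t -> orthogonal_projection (Q t)).
Context (Q_Lagrangian : forall t, unit_itv t -> Lagrangian (range (Q t))).
Context (AA : R -> operator H).
Context (AA_selfadj : forall t, unit_itv t -> selfadj (AA t)).
Context (AA_extends : forall t, unit_itv t -> extends A (AA t)).
Context (AA_trace : forall t, unit_itv t ->
  closure (T t @` [set x | dom (AA t) (i x)]) = range (Q t)).
Context (V : R -> {linear H -> H}).
Context (V_sym : forall t, unit_itv t -> forall u v, ⟨V t u, v⟩ = ⟨u, V t v⟩).
Context (t0 : R) (t0_unit : unit_itv t0).
Context (T' : {linear D -> hsum G}) (T_diff : opnorm_derivative T t0 T').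
Context (V' : {linear H -> H}) (V_diff : opnorm_derivative V t0 V').
Context (Q' : {linear hsum G -> hsum G}) (Q_diff : opnorm_derivative Q t0 Q').

Let PF : ProperFilter (to_unit t0) := to_unit_proper t0_unit.
Local Notation H_ t := (add_op (AA t) (V t)).

Lemma trace_green t x y : unit_itv t ->
  ⟨adjoint A (i x), i y⟩ - ⟨i x, adjoint A (i y)⟩ = omega (T t x) (T t y).
Proof. by move=> tu; rewrite (T_green tu) /omega hsum_dotE /= dotNl. Qed.

Lemma adjoint_AA t x : unit_itv t -> dom (AA t) x -> adjoint A x = AA t x.
Proof. by move=> tu; apply: adjoint_extends; auto. Qed.

Lemma trace_range t x : unit_itv t -> dom (AA t) (i x) -> Q t (T t x) = T t x.
Proof.
move=> tu Ax; apply: orthoproj_range; first exact: Q_proj.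
by rewrite -AA_trace //; apply: subset_closure; exists x.
Qed.

Lemma QJ t f : unit_itv t -> Q t (J f) = J (f - Q t f).
Proof. by move=> tu; apply: Lagrangian_projJ; auto. Qed.

Lemma Q_rnorm t f : unit_itv t -> `‖Q t f‖ <= `‖f‖.
Proof. by move=> tu; apply: orthoproj_rnorm; exact: Q_proj. Qed.

(** The relation [Q J = J (1 - Q)], differentiated at [t0]. *)
Lemma dQJ f : Q' (J f) = - J (Q' f).
Proof.
apply/eqP; rewrite -subr_eq0; apply/eqP.
apply: (@near_to_unit_eq0 _ _ t0_unit _ _ (2 * `‖f‖)) => e e0.
apply: filterS (filterI (near_dist t0 e0) (opnorm_derivativeP Q_diff e0)).
move=> t [[tu _ _] h]; have h1 := h f; have h2 := h (J f).
set s := (t - t0)%:C^-1 in h1 h2.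
have -> : Q' (J f) - - J (Q' f) =
    - (s *: (Q t (J f) - Q t0 (J f)) - Q' (J f)) - J (s *: (Q t f - Q t0 f) - Q' f).
  by rewrite !QJ // !JB !JZ !JB; lmod R (hsum G).
have := rnormB (- (s *: (Q t (J f) - Q t0 (J f)) - Q' (J f))) (J (s *: (Q t f - Q t0 f) - Q' f)).
by move: h1 h2; rewrite rnormN !rnormJ; lra.
Qed.

Lemma dQ_sym f g : ⟨Q' f, g⟩ = ⟨f, Q' g⟩.
Proof.
apply/eqP; rewrite -subr_eq0; apply/eqP.
apply: (@near_to_unit_eq0 _ _ t0_unit _ _ (2 * `‖f‖ * `‖g‖)) => e e0.
apply: filterS (filterI (near_dist t0 e0) (opnorm_derivativeP Q_diff e0)).
move=> t [[tu _ _] h]; have h1 := h f; have h2 := h g.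
have sr : ((t - t0)%:C^-1)^*%C = (t - t0)%:C^-1 :> C by rewrite -rcV conjc_real.
set s := (t - t0)%:C^-1 in h1 h2 sr.
have [[_ Qs] _] := Q_proj tu; have [[_ Qs0] _] := Q_proj t0_unit.
have -> : ⟨Q' f, g⟩ - ⟨f, Q' g⟩ =
    ⟨f, s *: (Q t g - Q t0 g) - Q' g⟩ - ⟨s *: (Q t f - Q t0 f) - Q' f, g⟩.
  rewrite !dotBl !dotBr dotZl dotZr !dotBl !dotBr Qs Qs0 sr; ring.
apply: le_trans (rnormB _ _) _.
have := dot_cauchy f (s *: (Q t g - Q t0 g) - Q' g).
have := dot_cauchy (s *: (Q t f - Q t0 f) - Q' f) g.
have := ler_wpM2l (rnorm_ge0 f) h2; have := ler_wpM2r (rnorm_ge0 g) h1.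
by lra.
Qed.

Lemma T_bound t : unit_itv t -> exists2 c : R, 0 < c & forall x, `‖T t x‖ <= c * `‖x‖.
Proof. by move=> tu; apply: continuous_rbounded; exact: T_bounded. Qed.

(** By [trace_green] the number [omega (T t x) (T t y)] does not depend on [t], so its derivative
    vanishes. *)
Lemma dT_skew x y : omega (T' x) (T t0 y) + omega (T t0 x) (T' y) = 0.
Proof.
have [c c0 hc] := T_bound t0_unit.
have [/continuous_rbounded[c' c'0 hc'] _] := T_diff.
apply: (@near_to_unit_eq0 _ _ t0_unit _ _
  ((c + 1) * (`‖x‖ * `‖y‖) + c' * (`‖x‖ * `‖y‖) + c * (`‖x‖ * `‖y‖))) => e e0.
have m0 : 0 < Num.min e 1 by rewrite lt_min e0 ltr01.
apply: filterS (filterI (near_dist t0 e0)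
  (filterI (opnorm_derivativeP T_diff e0) (opnorm_derivative_cvg T_diff m0))).
move=> t [[tu tt0 _] [h hT]]; set s := (t - t0)%:C^-1 in h.
pose dx := s *: (T t x - T t0 x); pose dy := s *: (T t y - T t0 y).
have sr : s^*%C = s by rewrite /s -rcV conjc_real.
have E : omega dx (T t y) + omega (T t0 x) dy = 0.
  rewrite /omega /dx /dy JZ JB dotZl dotZr dotBl dotBr sr -mulrDr.
  rewrite -!/(omega _ _) -!trace_green //.
  by rewrite addrA subrK subrr mulr0.
have -> : omega (T' x) (T t0 y) + omega (T t0 x) (T' y) =
  - omega (dx - T' x) (T t y) - omega (T' x) (T t y - T t0 y) - omega (T t0 x) (dy - T' y).
  rewrite -[LHS]subr0 -E /omega !JB !dotBl !dotBr; ring.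
have b (f g : hsum G) : `‖omega f g‖ <= `‖f‖ * `‖g‖.
  by rewrite /omega -[`‖f‖ in leRHS]rnormJ dot_cauchy.
have x0 := rnorm_ge0 x; have y0 := rnorm_ge0 y.
have Tty : `‖T t y‖ <= (c + 1) * `‖y‖.
  have := rnorm_le_dist (T t y) (T t0 y); have := hc y.
  have := hT y; have : Num.min e 1 * `‖y‖ <= 1 * `‖y‖ by rewrite ler_wpM2r // ge_min lexx orbT.
  by lra.
have dTy : `‖T t y - T t0 y‖ <= e * `‖y‖.
  by apply: le_trans (hT y) _; rewrite ler_wpM2r // ge_min lexx.
have h1 := ler_pM (rnorm_ge0 _) (rnorm_ge0 _) (h x) Tty.
have h2 := ler_pM (rnorm_ge0 _) (rnorm_ge0 _) (hc' x) dTy.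
have h3 := ler_pM (rnorm_ge0 _) (rnorm_ge0 _) (hc x) (h y).
have := b (dx - T' x) (T t y); have := b (T' x) (T t y - T t0 y).
have := b (T t0 x) (dy - T' y).
have := rnormB (- omega (dx - T' x) (T t y) - omega (T' x) (T t y - T t0 y)) (omega (T t0 x) (dy - T' y)).
have := rnormB (- omega (dx - T' x) (T t y)) (omega (T' x) (T t y - T t0 y)).
by rewrite rnormN; rewrite -/dx in h1; rewrite -/dy in h3; lra.
Qed.

Lemma omegaC (f g : hsum G) : omega f g = - (omega g f)^*%C :> C.
Proof. by rewrite /omega dotJ dotC. Qed.

(** The sesquilinear form of [T1] on the eigenspace, lifted to [D] (see [first_order_dot]). By
    [dT_skew] the last term equals [+ omega (T t0 x) (T' y)]. *)
Definition variation (x y : D) : C :=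
  ⟨V' (i x), i y⟩ + omega (Q' (T t0 x)) (T t0 y) - omega (T' x) (T t0 y).

Lemma variation_suml n (c : 'I_n -> C) (x : 'I_n -> D) y :
  variation (\sum_j c j *: x j) y = \sum_j c j * variation (x j) y.
Proof.
have lin (a : C) x1 x2 : variation (a *: x1 + x2) y = a * variation x1 y + variation x2 y.
  by rewrite /variation /omega !linearP !JD !JZ !dotDl !dotZl; ring.
have var0 : variation 0 y = 0.
  by have := lin (-1) 0 0; rewrite scaler0 addr0 mulN1r addNr.
elim: n c x => [|n ih] c x; first by rewrite !big_ord0.
by rewrite !big_ord_recl lin ih.
Qed.

Lemma dV_sym u v : ⟨V' u, v⟩ = ⟨u, V' v⟩.
Proof.
apply/eqP; rewrite -subr_eq0; apply/eqP.
apply: (@near_to_unit_eq0 _ _ t0_unit _ _ (2 * `‖u‖ * `‖v‖)) => e e0.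
apply: filterS (filterI (near_dist t0 e0) (opnorm_derivativeP V_diff e0)).
move=> t [[tu _ _] h]; have h1 := h u; have h2 := h v.
have sr : ((t - t0)%:C^-1)^*%C = (t - t0)%:C^-1 :> C by rewrite -rcV conjc_real.
set s := (t - t0)%:C^-1 in h1 h2 sr.
have -> : ⟨V' u, v⟩ - ⟨u, V' v⟩ =
    ⟨u, s *: (V t v - V t0 v) - V' v⟩ - ⟨s *: (V t u - V t0 u) - V' u, v⟩.
  rewrite !dotBl !dotBr dotZl dotZr !dotBl !dotBr !V_sym // sr; ring.
apply: le_trans (rnormB _ _) _.
have := dot_cauchy u (s *: (V t v - V t0 v) - V' v).
have := dot_cauchy (s *: (V t u - V t0 u) - V' u) v.
have := ler_wpM2l (rnorm_ge0 u) h2; have := ler_wpM2r (rnorm_ge0 v) h1.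
by lra.
Qed.

(** [Q'] is symmetric and anticommutes with [J], which settles its term; the [T'] term is
    [dT_skew]. *)
Lemma variation_herm x y : variation x y = (variation y x)^*%C.
Proof.
have cD (a b : C) : (a + b)^*%C = a^*%C + b^*%C by exact: rmorphD.
have cB (a b : C) : (a - b)^*%C = a^*%C - b^*%C by exact: rmorphB.
rewrite /variation cB cD -(dotC (i x) (V' (i y))) -dV_sym.
congr (_ + _ - _).
  rewrite [in RHS]/omega [in RHS]dotC conjcK.
  by rewrite /omega dotJ dQ_sym dQJ dotNr opprK.
rewrite [in RHS]omegaC rmorphN /= conjcK.
by apply/eqP; rewrite -subr_eq0 opprK dT_skew.
Qed.

Lemma variation_diag x : variation x x =
  ⟨V' (i x), i x⟩ + omega (Q' (T t0 x)) (T t0 x) + omega (T t0 x) (T' x).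
Proof.
rewrite /variation; congr (_ + _); apply/esym/eqP.
by rewrite -subr_eq0 opprK addrC dT_skew.
Qed.

Let dTx x := T' x - Q t0 (T' x) - Q' (T t0 x).

(* dTx x is the derivative at t0 of t |-> (1 - Q t) (T t x). *)
Lemma trace_defect_cvg x : dom (AA t0) (i x) ->
  forall e : R, 0 < e -> \forall t \near to_unit t0,
    `‖(t - t0)%:C^-1 *: (T t x - Q t (T t x)) - dTx x‖ <= e.
Proof.
move=> Ax e e0; pose K := 2 * `‖x‖ + `‖T' x‖ + `‖T t0 x‖ + 1.
have K0 : 0 < K.
  have := rnorm_ge0 x; have := rnorm_ge0 (T' x); have := rnorm_ge0 (T t0 x).
  by rewrite /K; lra.
have a0 : 0 < e / K by rewrite divr_gt0.
apply: filterS (filterI (near_dist t0 a0) (filterI (opnorm_derivativeP T_diff a0)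
  (filterI (opnorm_derivativeP Q_diff a0) (opnorm_derivative_cvg Q_diff a0)))).
move=> t [[tu _ _] [h1 [h2 h3]]].
set s := (t - t0)%:C^-1 in h1 h2 *.
pose q := s *: (T t x - T t0 x) - T' x.
have -> : s *: (T t x - Q t (T t x)) - dTx x = q - Q t q -
    (Q t (T' x) - Q t0 (T' x)) - (s *: (Q t (T t0 x) - Q t0 (T t0 x)) - Q' (T t0 x)).
  have -> : Q t q = s *: (Q t (T t x) - Q t (T t0 x)) - Q t (T' x).
    by rewrite /q linearB linearZ /= linearB.
  by rewrite (trace_range t0_unit Ax) /q /dTx; lmod R (hsum G).
have qx : `‖q‖ <= e / K * `‖x‖ := h1 x.
have := rnormB (q - Q t q - (Q t (T' x) - Q t0 (T' x)))
  (s *: (Q t (T t0 x) - Q t0 (T t0 x)) - Q' (T t0 x)).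
have := rnormB (q - Q t q) (Q t (T' x) - Q t0 (T' x)).
have := rnormB q (Q t q); have := Q_rnorm q tu.
have := h2 (T t0 x); have := h3 (T' x).
have : e / K * K = e by rewrite divfK // gt_eqF.
by rewrite /K; lra.
Qed.

(** [J (Q t0 (T' x))] is orthogonal to the range of [Q t0], which contains [T t0 y]; so only two
    terms of [dTx] survive. *)
Lemma defect_variation x y : dom (AA t0) (i y) ->
  variation x y = ⟨V' (i x), i y⟩ - ⟨J (dTx x), T t0 y⟩.
Proof.
move=> Ay; rewrite /variation -addrA; congr (_ + _).
have QT : ⟨J (Q t0 (T' x)), T t0 y⟩ = 0.
  have [[_ Qs] _] := Q_proj t0_unit.
  have -> : J (Q t0 (T' x)) = J (T' x) - Q t0 (J (T' x)).
    by rewrite QJ // JB opprB addrC subrK.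
  by rewrite dotBl Qs (trace_range t0_unit Ay) subrr.
by rewrite /omega /dTx !JB !dotBl QT; ring.
Qed.

(* For y in the domain at t, Q J = J (1 - Q) rewrites the boundary term of Green's
   identity as <J (1 - Q t) (T t x), T t y>, whose left entry vanishes at t0;
   hence only convergence of y, without any rate, is needed. *)
Lemma first_variation x (c : R) : dom (AA t0) (i x) -> 0 <= c ->
  forall e : R, 0 < e -> exists2 d : R, 0 < d &
  \forall t \near to_unit t0, forall y y0, dom (AA t) (i y) -> dom (AA t0) (i y0) ->
    `‖y0‖ <= c -> `‖y - y0‖ <= d ->
    `‖(t - t0)%:C^-1 * (⟨i x, H_ t (i y)⟩ - ⟨H_ t0 (i x), i y⟩) - variation x y0‖ <= e.
Proof.
move=> Ax c0 e e0; have [cT cT0 hT] := T_bound t0_unit.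
pose K := `‖i x‖ * (ci * (c + 1)) + `‖V' (i x)‖ * ci + (cT + 1) * (c + 1) +
  `‖dTx x‖ * (c + 1 + cT) + 1.
have x0 := rnorm_ge0 (i x); have V0 := rnorm_ge0 (V' (i x)).
have dT0 := rnorm_ge0 (dTx x).
have K0 : 0 < K.
  by rewrite /K ltr_wpDl // !addr_ge0 ?mulr_ge0 ?addr_ge0 // ltW.
pose d := Num.min 1 (e / K).
have d0 : 0 < d by rewrite lt_min ltr01 divr_gt0.
have d1 : d <= 1 by rewrite ge_min lexx.
have dK : d * K <= e by rewrite -ler_pdivlMr // ge_min lexx orbT.
exists d => //.
apply: filterS (filterI (near_dist t0 d0) (filterI (trace_defect_cvg Ax d0)
  (filterI (opnorm_derivativeP V_diff d0) (opnorm_derivative_cvg T_diff d0)))).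
move=> t [[tu _ _] [hb [hV hTt]]] y y0 Ay Ay0 y0c yy0.
set s := (t - t0)%:C^-1 in hb hV *.
have yc : `‖y‖ <= c + 1 by have := rnorm_le_dist y y0; lra.
have iyc : `‖i y‖ <= ci * (c + 1) by apply: le_trans (i_le y) _; rewrite ler_pM2l.
pose b := s *: (T t x - Q t (T t x)).
have [[_ Qs] _] := Q_proj tu.
have -> : s * (⟨i x, H_ t (i y)⟩ - ⟨H_ t0 (i x), i y⟩) =
    ⟨s *: (V t (i x) - V t0 (i x)), i y⟩ - ⟨J b, T t y⟩.
  have G1 := trace_green x y tu; rewrite !(adjoint_AA t0_unit Ax, adjoint_AA tu Ay) in G1.
  have -> : ⟨J b, T t y⟩ = s * omega (T t x) (T t y).
    rewrite /b JZ dotZl -QJ // Qs (trace_range tu Ay).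
    by [].
  rewrite -G1 /= dotDl dotDr dotZl dotBl -(V_sym tu).
  rewrite -mulrBr; congr (_ * _).
  have swap (a b' c' d' : C) : a + b' - (c' + d') = b' - d' - (c' - a) by ring.
  exact: swap.
rewrite (defect_variation _ Ay0).
(* Each of the four terms on the right has one factor that is small with [d], the other being
   bounded. *)
have -> : ⟨s *: (V t (i x) - V t0 (i x)), i y⟩ - ⟨J b, T t y⟩ -
    (⟨V' (i x), i y0⟩ - ⟨J (dTx x), T t0 y0⟩) =
    ⟨s *: (V t (i x) - V t0 (i x)) - V' (i x), i y⟩ + ⟨V' (i x), i (y - y0)⟩
    - ⟨J (b - dTx x), T t y⟩ - ⟨J (dTx x), T t y - T t0 y0⟩.
  have split (u v w1 w2 : H) (p q r1 r2 : hsum G) :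
      ⟨u, w1⟩ - ⟨p, r1⟩ - (⟨v, w2⟩ - ⟨q, r2⟩) =
      ⟨u - v, w1⟩ + ⟨v, w1 - w2⟩ - ⟨p - q, r1⟩ - ⟨q, r1 - r2⟩.
    by rewrite !dotBl !dotBr; ring.
  have -> : i (y - y0) = i y - i y0 by exact: linearB.
  by rewrite (JB b (dTx x)); exact: split.
have Tty : `‖T t y‖ <= (cT + 1) * (c + 1).
  have := rnorm_le_dist (T t y) (T t0 y); have := hTt y; have := hT y.
  have := ler_wpM2r (rnorm_ge0 y) d1; have := ler_wpM2l (ltW cT0) yc.
  by lra.
have dTy : `‖T t y - T t0 y0‖ <= d * (c + 1 + cT).
  have := rdist_triangle (T t0 y) (T t y) (T t0 y0); rewrite -(linearB (T t0)).
  have := hT (y - y0); have := hTt y.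
  have := ler_wpM2l (ltW cT0) yy0; have := ler_wpM2l (ltW d0) yc.
  by lra.
have iyy0 : `‖i (y - y0)‖ <= ci * d.
  by apply: le_trans (i_le _) _; rewrite ler_pM2l.
have p1 : `‖⟨s *: (V t (i x) - V t0 (i x)) - V' (i x), i y⟩‖ <= d * `‖i x‖ * (ci * (c + 1)).
  by apply: le_trans (dot_cauchy _ _) _; apply: ler_pM; rewrite ?rnorm_ge0.
have p2 : `‖⟨V' (i x), i (y - y0)⟩‖ <= `‖V' (i x)‖ * (ci * d).
  by apply: le_trans (dot_cauchy _ _) _; apply: ler_wpM2l.
have p3 : `‖⟨J (b - dTx x), T t y⟩‖ <= d * ((cT + 1) * (c + 1)).
  by apply: le_trans (dot_cauchy _ _) _; apply: ler_pM; rewrite ?rnorm_ge0 ?rnormJ.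
have p4 : `‖⟨J (dTx x), T t y - T t0 y0⟩‖ <= `‖dTx x‖ * (d * (c + 1 + cT)).
  by apply: le_trans (dot_cauchy _ _) _; rewrite rnormJ; apply: ler_wpM2l.
apply: le_trans (rnormB _ _) _; apply: le_trans (lerD (rnormB _ _) (lexx _)) _.
apply: le_trans (lerD (lerD (rnormD _ _) (lexx _)) (lexx _)) _.
move: p1 p2 p3 p4 dK; rewrite /K.
move: (`‖_‖) (`‖_‖) (`‖_‖) (`‖_‖) => P1 P2 P3 P4; lra.
Qed.

End FirstVariation.

(** * Eigenbases and lists of eigenvalues *)

Section EigenFamilies.
Context (R : realType) (H : hilbertType R).
Local Notation C := R[i].
Local Notation comb e := [set \sum_k c k *: e k | c in [set: 'I__ -> C]].

Lemma comb_proj m (e : 'I_m -> H) v :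
  orthonormal_family e -> comb e v -> v = proj e v.
Proof. by move=> eo [c _ <-]; rewrite proj_comb. Qed.

(** In the basis [e], [L] sends the row of coordinates [c] to [c N]; the rows of the unitary [U]
    with [U N = diag_mx d U] are therefore the coordinates of eigenvectors. *)
Lemma hermitian_eigenbasis m (e : 'I_m -> H) (L : H -> H) : orthonormal_family e ->
  (forall c : 'I_m -> C, L (\sum_j c j *: e j) = \sum_j c j *: L (e j)) ->
  (forall j, L (e j) = proj e (L (e j))) ->
  (forall j k, ⟨L (e j), e k⟩ = ⟨L (e k), e j⟩^*%C) ->
  exists (l : 'I_m -> C) (u : 'I_m -> H), orthonormal_eigenbasis L (comb e) l u.
Proof.
move=> eo Llin Le Lherm.
pose N : 'M[C]_m := \matrix_(j, k) ⟨L (e j), e k⟩.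
have Nn : N \is normalmx.
  apply: hermitian_normalmx; apply/is_hermitianmxP; rewrite expr0 scale1r.
  by apply/matrixP => j k; rewrite !mxE Lherm conjE.
have Uu := spectral_unitarymx N; move/orthomx_spectralP : Nn => dE.
move: (spectralmx N) (spectral_diag N) Uu dE => U d Uu dE.
have UN : U *m N = diag_mx d *m U.
  by rewrite {1}dE !mulmxA mulmxV ?mul1mx // unitarymx_unit.
pose u a := \sum_j U a j *: e j.
have uo : orthonormal_family u.
  move=> a b; rewrite /u dot_suml; have := unitarymxP Uu.
  move=> /matrixP /(_ a b); rewrite !mxE => <-; apply: eq_bigr => j _.
  rewrite dotZl -/(u b) dotC dot_combl //; congr (_ * _).
  by rewrite !mxE conjE.
have Su a : comb e (u a) by exists (U a).
have Sdim := orthonormal_has_dim eo.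
exists (fun a => d 0 a), u; split=> //.
  apply/seteqP; split=> [v Sv|_ [c _ <-]]; last exact: has_dim_comb Sdim _ _ _ _.
  exists (fun k => ⟨v, u k⟩) => //.
  by rewrite [RHS](orthonormal_span Sdim uo Su Sv).
move=> a; rewrite Llin; under eq_bigr do rewrite Le /proj scaler_sumr.
rewrite exchange_big /u scaler_sumr; apply: eq_bigr => k _.
have := congr1 (fun M : 'M[C]_m => M a k) UN; rewrite mul_diag_mx !mxE => UNak.
rewrite scalerA -UNak scaler_suml; apply: eq_bigr => j _.
by rewrite !mxE scalerA.
Qed.

(** An eigenvector for [z] minus its projection on the [e j] with [nu j = z] is orthogonal to these,
    and to the other [e j] by symmetry; the last hypothesis makes it 0. *)
Lemma lists_eigenvalues_family (A : operator H) (B : set C) m (e : 'I_m -> H)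
    (nu : 'I_m -> R) :
  (forall u v, dom A u -> dom A v -> ⟨A u, v⟩ = ⟨u, A v⟩) ->
  orthonormal_family e ->
  (forall j, dom A (e j) /\ A (e j) = (nu j)%:C *: e j) ->
  (forall j, B (nu j)%:C) ->
  (forall z u, B z -> eigspace A z u -> (forall j, ⟨u, e j⟩ = 0) -> u = 0) ->
  lists_eigenvalues A B (fun j => (nu j)%:C).
Proof.
move=> As eo eA Bnu compl; split=> // z Bz.
pose f (k : 'I_#|[pred j | (nu j)%:C == z]|) := e (enum_val k).
have fo : orthonormal_family f by move=> a b; rewrite /f eo (inj_eq enum_val_inj).
have fA k : eigspace A z (f k).
  rewrite /f; have [d E] := eA (enum_val k).
  have /eqP nuz : (nu (enum_val k))%:C == z by have := enum_valP k; rewrite inE.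
  by split=> //; rewrite E nuz.
exists f; split=> [c c0 k|]; first by rewrite -(dot_combl c k fo) c0 dot0l.
have comb_eig (c : _ -> C) : eigspace A z (\sum_k c k *: f k).
  split; first by apply: dom_sum => k _; apply: dom_scale; have [] := fA k.
  rewrite op_sum => [|k _]; last by apply: dom_scale; have [] := fA k.
  rewrite scaler_sumr; apply: eq_bigr => k _; have [d E] := fA k.
  by rewrite op_scale // E !scalerA mulrC.
apply/seteqP; split=> [u zu|_ [c _ <-]]; last exact: comb_eig.
exists (fun k => ⟨u, f k⟩) => //.
have zp : eigspace A z (proj f u) by exact: comb_eig.
have [[du uE] [dp pE]] := (zu, zp).
apply/eqP; rewrite eq_sym -subr_eq0; apply/eqP.
have zw : eigspace A z (u - proj f u).
  by split; [exact: dom_sub|rewrite op_sub // uE pE scalerBr].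
apply: (compl z) => // j; have [zj|zj] := eqVneq (nu j)%:C z.
  have jA : j \in [pred j | (nu j)%:C == z] by rewrite inE zj.
  by rewrite -(enum_rankK_in jA jA) -/(f _) dot_compl.
have [dw wE] := zw; have [dj jE] := eA j.
have := As _ _ dw dj; rewrite wE jE dotZl dotZr conjc_real => /eqP.
rewrite -subr_eq0 -mulrBl mulf_eq0 subr_eq0 eq_sym (negPf zj) /=.
by move=> /eqP.
Qed.

End EigenFamilies.

(** * The first-order operator and its form *)

Section FirstOrderOperator.
Context (R : realType) (H G : hilbertType R).
Local Notation C := R[i].
Context (D : completeNormedModType C) (i : {linear D -> H}) (i_inj : injective i).

Lemma emb_invK x : emb_inv i (i x) = x.
Proof. by apply: i_inj; exact: (@xgetI D 0 [set y | i y = i x] x). Qed.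

Lemma emb_invE u : range i u -> i (emb_inv i u) = u.
Proof. by move=> [x _ <-]; rewrite emb_invK. Qed.

Lemma emb_inv_sum m (c : 'I_m -> C) (e : 'I_m -> H) : (forall k, range i (e k)) ->
  emb_inv i (\sum_k c k *: e k) = \sum_k c k *: emb_inv i (e k).
Proof.
move=> ie; rewrite -[RHS]emb_invK linear_sum; congr emb_inv.
by apply: eq_bigr => k _; rewrite linearZ /= emb_invE.
Qed.

Context (P : {linear H -> H}) (Pp : orthogonal_projection P).
Context (Pi : range P `<=` range i).
Context (m : nat) (e : 'I_m -> H) (eo : orthonormal_family e) (Pe : forall k, range P (e k)).
Context (Pspan : forall u, range P u -> u = proj e u).
Context (V' : {linear H -> H}) (T : R -> {linear D -> hsum G}) (t0 : R).
Context (T' : {linear D -> hsum G}).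
Context (Q' : {linear hsum G -> hsum G}).
Context (Q'J : forall f, Q' (J f) = - J (Q' f)).

Lemma orthoproj_proj u : P u = proj e u.
Proof.
have [[_ Ps] _] := Pp; rewrite [LHS]Pspan; last by exists u.
apply: eq_bigr => k _; rewrite Ps; congr (⟨_, _⟩ *: _).
by apply: orthoproj_range.
Qed.

Local Notation T0 := (T t0).
Let TP v := T0 (emb_inv i (P v)).

(** [bounded_adjoint] is a choice with default 0, so an adjoint has to be exhibited; [TP] factors
    through the span of the [e k], which gives the explicit [w]. Its values lie in the range of [P]
    because [TP (P v) = TP v]. *)
Lemma bounded_adjointP f :
  (forall v, ⟨TP v, f⟩ = ⟨v, bounded_adjoint TP f⟩) /\
  P (bounded_adjoint TP f) = bounded_adjoint TP f.
Proof.
have [[_ Ps] PP] := Pp.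
have adj v : ⟨TP v, f⟩ = ⟨v, bounded_adjoint TP f⟩.
  pose w := \sum_k ⟨f, T0 (emb_inv i (e k))⟩ *: e k.
  suff wP : forall u, ⟨TP u, f⟩ = ⟨u, w⟩.
    exact: (@xgetI H 0 [set w | forall u, ⟨TP u, f⟩ = ⟨u, w⟩] w wP v).
  move=> u; rewrite /TP orthoproj_proj /proj emb_inv_sum; last by auto.
  rewrite linear_sum dot_suml dot_sumr; apply: eq_bigr => k _.
  by rewrite linearZ /= dotZl dotZr -dotC mulrC.
split=> //; set w := bounded_adjoint TP f in adj *.
apply/eqP; rewrite -subr_eq0; apply/eqP; apply: dot_eq0.
have TPP v : TP (P v) = TP v by rewrite /TP PP.
by rewrite dotBr -Ps -adj -adj TPP subrr.
Qed.

Local Notation T1 := (first_order_operator i P V' T0 T' Q').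

Let T1E u : T1 u = P (V' (P u)) - bounded_adjoint TP (Q' (J (TP u)))
  - bounded_adjoint TP (J (T' (emb_inv i (P u)))).
Proof. by []. Qed.

(** For the sign: [Q'] anticommutes with [J], which turns [- Q' J] into [J Q'], the operator behind
    [omega (Q' _) _]. *)
Lemma first_order_dot x y : range P (i x) -> range P (i y) ->
  ⟨T1 (i x), i y⟩ = variation i T t0 T' V' Q' x y.
Proof.
move=> Px Py; have [[_ Ps] _] := Pp.
have Pix := orthoproj_range Pp Px; have Piy := orthoproj_range Pp Py.
have TPx : TP (i x) = T0 x by rewrite /TP Pix emb_invK.
have TPy : TP (i y) = T0 y by rewrite /TP Piy emb_invK.
have adj f : ⟨bounded_adjoint TP f, i y⟩ = ⟨f, T0 y⟩.
  by rewrite dotC -(bounded_adjointP f).1 TPy -dotC.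
rewrite T1E TPx !dotBl !adj Ps Piy Pix emb_invK.
rewrite /variation /omega Q'J dotNl opprK.
by [].
Qed.

Lemma first_order_range x : range P (i x) -> P (T1 (i x)) = T1 (i x).
Proof.
move=> Px; rewrite T1E !linearB /= !(bounded_adjointP _).2.
by have [_ ->] := Pp.
Qed.

End FirstOrderOperator.

(** * The spectral disc *)

Section SpectralDisc.
Context (R : realType) (H : hilbertType R) (A : operator H) (sA : selfadj A).
Local Notation C := R[i].

Lemma selfadj_eigenvalue_real z u : eigspace A z u -> u != 0 -> z = (complex.Re z)%:C.
Proof.
move=> [Au uE] u0; have [As _] := sA; have := As _ _ Au Au.
rewrite uE dotZl dotZr dotE => /(mulIf _) E.
have {}E : z = z^*%C.
  by apply: E; rewrite (inj_eq (@complexI R) _ 0) sqrf_eq0 rnorm_eq0.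
by move: E; case: z {uE} => a b [] /= E; congr Complex; lra.
Qed.

Context (lam : R) (m : nat) (A_dense : dense (dom A)).
Context (K_dim : has_dim (eigspace A lam%:C) m).
Context (e0 : 'I_m -> H) (e0o : orthonormal_family e0).
Context (e0K : forall k, eigspace A lam%:C (e0 k)).
Context (lam_isolated : isolated (spectrum A : set C^o) lam%:C).

Lemma spectral_disc_gap : exists rho g : R, [/\ 0 < rho, rho < g,
  forall y, dom A y -> (forall k, ⟨y, e0 k⟩ = 0) ->
    g * `‖y‖ <= `‖A y - lam%:C *: y‖,
  forall z, `‖z - lam%:C‖ < rho -> spectral_disc A lam%:C z &
  forall z, spectral_disc A lam%:C z ->
    (* the disc is the whole plane when the spectrum is {lam} *)
    `‖z - lam%:C‖ < rho \/ forall w, w = proj e0 w].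
Proof.
have [eps eps0 heps] : exists2 eps : R, 0 < eps &
    forall z, spectrum A z -> z != lam%:C -> eps <= `‖lam%:C - z‖.
  have [_ [U /(@nbhs_ballP C C^o)[e /= + eU] UE]] := lam_isolated.
  rewrite ltcE => /andP[/eqP /= e_im e_re]; exists (complex.Re e) => // z Sz zl.
  rewrite leNgt; apply: contraNN zl => ze; apply/eqP.
  have : (U `&` spectrum A) z.
    split=> //; apply: eU; rewrite -ball_normE /= rnormE.
    by rewrite [e]complexE e_im mulr0 addr0 ltcR.
  by rewrite UE.
pose S := spectrum A `\ lam%:C; pose dd := dist_to lam%:C S.
have dd_le z : S z -> (dd <= (`‖lam%:C - z‖)%:E)%E.
  by move=> Sz; apply: ereal_inf_lbound; exists z.
have dd_ge : (eps%:E <= dd)%E.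
  apply: le_ereal_inf_tmp => _ [z [Sz zl] <-]; rewrite lee_fin; apply: heps => //.
  exact/eqP.
have res (d : R) : (d%:E <= dd)%E ->
    forall z : R, z != lam -> `|z - lam| < d -> resolvent_set A z%:C.
  move=> dle z zl zd; apply: contrapT => nres.
  have Sz : S z%:C by split=> // /complexI /eqP; rewrite (negPf zl).
  have := le_trans dle (dd_le _ Sz).
  by rewrite lee_fin -rcB rnorm_real distrC leNgt zd.
have gap (d : R) y : 0 < d -> (d%:E <= dd)%E -> dom A y ->
    (forall k, ⟨y, e0 k⟩ = 0) ->
    d ^+ 2 * `‖y‖ ^+ 2 <= 2 * `‖A y - lam%:C *: y‖ ^+ 2.
  move=> d0 dle Ay ye; apply: (isolated_gap sA (res d dle)) => // k Kk.
  rewrite (orthonormal_span K_dim e0o e0K Kk) dot_sumr big1 // => j _.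
  by rewrite dotZr ye mulr0.
(* [1 / sqrt 2] is rounded down to [7 / 10], which still exceeds the ratio [1 / 2] of the radius of
   the disc to [d]. *)
have gap' (d : R) y : 0 < d -> (d%:E <= dd)%E -> dom A y ->
    (forall k, ⟨y, e0 k⟩ = 0) ->
    7 / 10 * d * `‖y‖ <= `‖A y - lam%:C *: y‖.
  move=> d0 dle Ay ye; have := gap d y d0 dle Ay ye => h.
  rewrite -(@ler_pXn2r _ 2) ?nnegrE ?mulr_ge0 ?rnorm_ge0 ?(ltW d0) //.
  have := mulr_ge0 (sqr_ge0 d) (sqr_ge0 `‖y‖).
  rewrite !exprMn; lra.
have discE z : spectral_disc A lam%:C z = ((2 * `‖z - lam%:C‖)%:E < dd)%E by [].
have [[d dE]|ddE|ddE] : [\/ exists d, dd = d%:E, dd = +oo%E | dd = -oo%E].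
- by case: (dd) => [d||]; [apply: Or31; exists d|apply: Or32|apply: Or33].
- have d0 : 0 < d by move: dd_ge; rewrite dE lee_fin; exact: lt_le_trans.
  exists (d / 2), (7 / 10 * d); split.
  + by rewrite divr_gt0.
  + by lra.
  + by move=> y; apply: gap' => //; rewrite dE.
  + by move=> z zd; rewrite discE dE lte_fin; lra.
  + by move=> z; rewrite discE dE lte_fin => zd; left; lra.
(* With no spectrum besides [lam] the gap holds for every [d]; the values 1 and 2 are arbitrary. *)
- have big (d : R) : (d%:E <= dd)%E by rewrite ddE leey.
  exists 1, 2; split=> //.
  + by rewrite ltr1n.
  + move=> y Ay ye; have := gap' 4 y (ltr0Sn _ 3) (big 4) Ay ye.
    by have := rnorm_ge0 y; lra.
  + by move=> z _; rewrite discE ddE ltry.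
  move=> z _; right=> w; apply/eqP; rewrite -subr_eq0; apply/eqP.
  apply: (dense_orth A_dense) => v Av.
  (* A gap with every constant leaves nothing orthogonal to the eigenspace in [dom A], which is
     dense. *)
  have vp : v - proj e0 v = 0.
    pose y := v - proj e0 v; rewrite -/y.
    have Ay : dom A y.
      by apply: dom_sub => //; apply: dom_sum => k _; apply: dom_scale; have [] := e0K k.
    have ye k : ⟨y, e0 k⟩ = 0 by exact: dot_compl.
    apply/eqP; rewrite -rnorm_eq0 eq_le rnorm_ge0 andbT leNgt; apply/negP => y0.
    pose q := `‖A y - lam%:C *: y‖; have q0 : 0 <= q := rnorm_ge0 _.
    have q1 : 0 < 2 * q + 1 by lra.
    (* For this [d] the gap reads [7/10 (2 q + 1) <= q], which is impossible. *)
    have := gap' ((2 * q + 1) / `‖y‖) y (divr_gt0 q1 y0) (big _) Ay ye.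
    rewrite -mulrA divfK ?gt_eqF // -/q; lra.
  move/eqP : vp; rewrite subr_eq0 => /eqP ->.
  rewrite dotC; have -> : ⟨w - proj e0 w, proj e0 v⟩ = 0 by exact: dot_compl_comb.
  by rewrite conjc0.
by move: dd_ge; rewrite ddE.
Qed.

End SpectralDisc.

(** * Eigenvalue branches *)

Section Asymptotics.
Context (R : realType) (H G : hilbertType R) (A : operator H).
Local Notation C := R[i].
Context (A_dense : dense (dom A)).
Context (D : completeNormedModType C) (i : {linear D -> H}) (i_inj : injective i).
Context (ci : R) (ci_gt0 : 0 < ci) (i_le : forall x, `‖i x‖ <= ci * `‖x‖).
Context (T : R -> {linear D -> hsum G}).
Context (T_bounded : forall t, unit_itv t -> continuous (T t)).
Context (T_green : forall t, unit_itv t -> forall u v : D,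
  ⟨adjoint A (i u), i v⟩ - ⟨i u, adjoint A (i v)⟩ =
  ⟨(T t u).2, (T t v).1⟩ - ⟨(T t u).1, (T t v).2⟩).
Context (Q : R -> {linear hsum G -> hsum G}).
Context (Q_proj : forall t, unit_itv t -> orthogonal_projection (Q t)).
Context (Q_Lagrangian : forall t, unit_itv t -> Lagrangian (range (Q t))).
Context (AA : R -> operator H).
Context (AA_selfadj : forall t, unit_itv t -> selfadj (AA t)).
Context (AA_extends : forall t, unit_itv t -> extends A (AA t)).
Context (AA_dom : forall t, unit_itv t -> dom (AA t) `<=` range i).
Context (AA_trace : forall t, unit_itv t ->
  closure (T t @` [set x | dom (AA t) (i x)]) = range (Q t)).
Context (V : R -> {linear H -> H}).
Context (V_self_adjoint : forall t, unit_itv t -> bounded_self_adjoint (V t)).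
Context (t0 : R) (t0_unit : unit_itv t0).
Context (AA_cvg : opnorm (fun v : H => emb_inv i (resolvent (AA t) 'i%C v)
                               - emb_inv i (resolvent (AA t0) 'i%C v))
              @[t --> to_unit t0] --> 0%E).
Context (T' : {linear D -> hsum G}) (T_diff : opnorm_derivative T t0 T').
Context (V' : {linear H -> H}) (V_diff : opnorm_derivative V t0 V').
Context (Q' : {linear hsum G -> hsum G}) (Q_diff : opnorm_derivative Q t0 Q').

Let PF : ProperFilter (to_unit t0) := to_unit_proper t0_unit.
Local Notation H_ t := (add_op (AA t) (V t)).
Local Notation emb := (emb_inv i).
Local Notation r t h := (emb (resolvent (AA t) 'i%C h)).

Lemma V_sym t : unit_itv t -> forall u v, ⟨V t u, v⟩ = ⟨u, V t v⟩.
Proof. by move=> /V_self_adjoint[]. Qed.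

Lemma H_selfadj t : unit_itv t -> selfadj (H_ t).
Proof. by move=> tu; apply: selfadj_add_op; [exact: AA_selfadj|exact: V_sym]. Qed.

Lemma embE t w : unit_itv t -> dom (AA t) w -> i (emb w) = w.
Proof. by move=> tu Aw; apply: emb_invE => //; exact: AA_dom Aw. Qed.

Lemma resolvent_emb t h : unit_itv t -> i (r t h) = resolvent (AA t) 'i%C h.
Proof.
by move=> tu; apply: (embE tu); have [] := resolventP h (AA_selfadj tu).
Qed.

Lemma resolvent_emb_linear t : unit_itv t -> linear (fun h => r t h).
Proof.
move=> tu a h h'; apply: i_inj.
by rewrite linearP !resolvent_emb // resolvent_linear //; exact: AA_selfadj.
Qed.

Lemma resolvent_emb_cvg (e : R) : 0 < e ->
  \forall t \near to_unit t0, forall h, `‖r t h - r t0 h‖ <= e * `‖h‖.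
Proof.
apply: (opnorm_cvg0 _ AA_cvg).
apply: filterS (near_dist t0 ltr01) => t [tu _ _] a h.
have rZ s : unit_itv s -> r s (a *: h) = a *: r s h.
  move=> su; have lin := resolvent_emb_linear su.
  have r0 : r s 0 = 0.
    by apply: (@addrI _ (r s 0)); rewrite addr0; have := lin 1 0 0; rewrite !scale1r addr0.
  by have := lin a h 0; rewrite r0 !addr0.
by rewrite !rZ // scalerBr.
Qed.

(** The convergence hypothesis controls only differences of resolvents as maps into [D]. The graph
    at [t0] is closed because [i] is injective and bounded and the resolvent is bounded in [H]. *)
Lemma resolvent_emb_bounded : exists2 c : R, 0 < c & forall h, `‖r t0 h‖ <= c * `‖h‖.
Proof.
pose f : {linear H -> D} := HB.pack (fun h => r t0 h)
  (GRing.isLinear.Build _ _ _ _ _ (resolvent_emb_linear t0_unit)).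
have := @closed_graph R H D f; apply => x y h.
apply: i_inj; rewrite [LHS]resolvent_emb //.
apply/eqP; rewrite -subr_eq0; apply/eqP.
apply: (@rnorm_eq0_eps _ _ _ (1 + ci)) => e /h[z [zx fz]].
have fzE : i (f z) = resolvent (AA t0) 'i%C z by exact: resolvent_emb.
have -> : resolvent (AA t0) 'i%C x - i y = i (f z - y) - resolvent (AA t0) 'i%C (z - x).
  have -> : i (f z - y) = i (f z) - i y by exact: linearB.
  have -> : resolvent (AA t0) 'i%C (z - x) =
      resolvent (AA t0) 'i%C z - resolvent (AA t0) 'i%C x.
    rewrite -[z - x]addrC -scaleN1r resolvent_linear ?scaleN1r 1?addrC //.
    exact: AA_selfadj.
  by rewrite fzE; lmod R H.
apply: le_trans (rnormB _ _) _.
have := i_le (f z - y); have := resolvent_rnorm (z - x) (AA_selfadj t0_unit).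
have := ler_wpM2l (ltW ci_gt0) (ltW fz).
by lra.
Qed.

Lemma V0_bounded : exists2 c : R, 0 < c & forall h, `‖V t0 h‖ <= c * `‖h‖.
Proof. by apply: continuous_rbounded; have [] := V_self_adjoint t0_unit. Qed.

(** The neighbourhood includes [t0], where the branches also have to list the eigenvalues. *)
Lemma H_graph_close (d : R) : 0 < d -> \forall t \near within unit_itv (nbhs t0),
  unit_itv t /\ graph_close d (H_ t) (H_ t0) /\ graph_close d (H_ t0) (H_ t).
Proof.
move=> d0; apply: near_full_unit.
  split=> //; split=> w Aw; exists w; rewrite !subrr rnorm0;
    by split=> //; rewrite mulr_ge0 ?(ltW d0) // addr_ge0 ?rnorm_ge0.
have [c c0 Vc] := V0_bounded.
pose K := (1 + (c + 1)) ^+ 2 + 1.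
have K0 : 0 < K by rewrite ltr_wpDl // sqr_ge0.
pose e := Num.min 1 (d / K); have e0 : 0 < e by rewrite lt_min ltr01 divr_gt0.
have e1 : e <= 1 by rewrite ge_min lexx.
have eK : e * K <= d by rewrite -ler_pdivlMr // ge_min lexx orbT.
have e01 : 0 <= e <= 1 by rewrite ltW.
apply: filterS (filterI (near_dist t0 ltr01) (filterI
  (resolvent_emb_cvg (divr_gt0 e0 ci_gt0)) (opnorm_derivative_cvg V_diff e0))).
move=> t [[tu _ _] [hr hV]].
have hR h : `‖resolvent (AA t) 'i%C h - resolvent (AA t0) 'i%C h‖ <= e * `‖h‖.
  rewrite -(resolvent_emb h tu) -(resolvent_emb h t0_unit) -linearB; apply: le_trans (i_le _) _.
  apply: le_trans (ler_wpM2l (ltW ci_gt0) (hr h)) _.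
  by rewrite le_eqVlt; apply/orP; left; apply/eqP; field; rewrite gt_eqF.
have Vt h : `‖V t h‖ <= (c + 1) * `‖h‖.
  have := rnorm_le_dist (V t h) (V t0 h); have := hV h; have := Vc h.
  by have := ler_wpM2r (rnorm_ge0 h) e1; lra.
have V0 h : `‖V t0 h‖ <= (c + 1) * `‖h‖.
  by apply: le_trans (Vc h) _; rewrite ler_wpM2r ?rnorm_ge0 // lerDl.
have c1 : 0 <= c + 1 by rewrite addr_ge0 // ltW.
have weaken A1 A2 : graph_close (e * K) A1 A2 -> graph_close d A1 A2.
  move=> h w /h[f [h1 h2 h3]]; exists f; split=> //.
    by apply: le_trans h2 _; rewrite ler_wpM2r // addr_ge0 ?rnorm_ge0.
  by apply: le_trans h3 _; rewrite ler_wpM2r // addr_ge0 ?rnorm_ge0.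
have st := AA_selfadj tu; have s0 := AA_selfadj t0_unit.
split=> //; split; apply: weaken; apply: resolvent_graph_close => // h.
  by rewrite rdistC.
by rewrite rdistC.
Qed.

Context (lam : R) (m : nat).
Context (K_dim : has_dim (eigspace (H_ t0) lam%:C) m).
Context (e0 : 'I_m -> H) (e0o : orthonormal_family e0).
Context (e0K : forall k, eigspace (H_ t0) lam%:C (e0 k)).
Context (rho g : R) (rho0 : 0 < rho) (rho_g : rho < g).
Context (gap : forall y, dom (H_ t0) y -> (forall k, ⟨y, e0 k⟩ = 0) ->
    g * `‖y‖ <= `‖H_ t0 y - lam%:C *: y‖).

Lemma H_cluster (eta : R) : 0 < eta -> \forall t \near within unit_itv (nbhs t0),
  unit_itv t /\
  (forall u (mu : R), dom (H_ t) u -> H_ t u = mu%:C *: u -> `|mu - lam| <= rho ->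
     `‖u - proj e0 u‖ <= eta * `‖u‖ /\ `|mu - lam| * `‖u‖ <= eta * `‖u‖) /\
  exists (e : 'I_m -> H) (nu : 'I_m -> R),
    [/\ orthonormal_family e, forall l, dom (H_ t) (e l) /\ H_ t (e l) = (nu l)%:C *: e l &
        forall l, `|nu l - lam| <= rho].
Proof.
move=> eta0; have [d d0 hd] := eigenvalue_cluster (H_selfadj t0_unit) e0o e0K
  rho0 rho_g gap eta0.
apply: filterS (H_graph_close d0) => t [tu [h1 h2]]; split=> //.
by apply: hd => //; exact: H_selfadj.
Qed.

Lemma eigenspace_emb_bounded : exists2 c : R, 0 < c &
  forall p, eigspace (H_ t0) lam%:C p -> `‖emb p‖ <= c * `‖p‖.
Proof.
have [c c0 rc] := resolvent_emb_bounded; have [cV cV0 Vc] := V0_bounded.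
have l0 := normr_ge0 lam.
exists (c * (`|lam| + cV + 1)) => [|p [Ap pE]]; first by rewrite mulr_gt0 //; lra.
have <- : resolvent (AA t0) 'i%C (AA t0 p - 'i%C *: p) = p.
  by rewrite resolventK //; exact: AA_selfadj.
apply: le_trans (rc _) _; rewrite -mulrA ler_pM2l // resolventK //; last exact: AA_selfadj.
have -> : AA t0 p - 'i%C *: p = lam%:C *: p - V t0 p - 'i%C *: p.
  by rewrite -pE /= addrK.
have := rnormB (lam%:C *: p - V t0 p) ('i%C *: p).
have := rnormB (lam%:C *: p) (V t0 p); have := Vc p.
by rewrite !rnormZ rnorm_real rnorm_i; lra.
Qed.

(** The eigenvalue equation removes the unbounded operator from
    [h = (AA t - i) w = (nu - V t - i) w], so [h] is close to the corresponding [h0] in [H]; the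
    resolvents carry this closeness into [D]. *)
Lemma eigenvector_emb_cvg (d : R) : 0 < d -> \forall t \near to_unit t0,
  forall w (nu : R), dom (H_ t) w -> H_ t w = nu%:C *: w -> `‖w‖ = 1 ->
    `|nu - lam| <= rho -> `‖emb w - emb (proj e0 w)‖ <= d.
Proof.
move=> d0; have [c c0 rc] := resolvent_emb_bounded; have [cV cV0 Vc] := V0_bounded.
have l0 := normr_ge0 lam.
pose K := (`|lam| + rho + cV + 2) + c * (3 + `|lam| + cV).
have K0 : 0 < K.
  by apply: addr_gt0; [move: rho0; lra|apply: mulr_gt0 => //; lra].
pose e := Num.min 1 (d / K); have ep : 0 < e by rewrite lt_min ltr01 divr_gt0.
have e1 : e <= 1 by rewrite ge_min lexx.
have eK : e * K <= d by rewrite -ler_pdivlMr // ge_min lexx orbT.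
have near_cl : \forall t \near to_unit t0, unit_itv t /\
  (forall u (mu : R), dom (H_ t) u -> H_ t u = mu%:C *: u -> `|mu - lam| <= rho ->
     `‖u - proj e0 u‖ <= e * `‖u‖ /\ `|mu - lam| * `‖u‖ <= e * `‖u‖).
  have [x /= x0 hx] := H_cluster ep.
  apply: near_to_unit; exists x => // t tu _ tx.
  have [|_ [h _]] := hx t _ tu; first by rewrite /= distrC.
  by split.
apply: filterS (filterI near_cl (filterI (resolvent_emb_cvg ep)
  (opnorm_derivative_cvg V_diff ep))).
move=> t [[tu cl] [hr hV]] w nu Aw wE w1 nul.
have [wp nu_e] := cl _ _ Aw wE nul; rewrite w1 !mulr1 in wp nu_e.
set p := proj e0 w in wp *.
have [Ap pE] : eigspace (H_ t0) lam%:C p by exact: has_dim_comb K_dim _ _ _ e0K.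
pose h := AA t w - 'i%C *: w; pose h0 := AA t0 p - 'i%C *: p.
have hE : h = nu%:C *: w - V t w - 'i%C *: w by rewrite /h -wE /= addrK.
have h0E : h0 = lam%:C *: p - V t0 p - 'i%C *: p by rewrite /h0 -pE /= addrK.
have -> : emb w = r t h by rewrite resolventK //; exact: AA_selfadj.
have -> : emb p = r t0 h0 by rewrite resolventK //; exact: AA_selfadj.
have nu_le : `|nu| <= `|lam| + rho.
  by rewrite -(subrK lam nu) (le_trans (ler_normD _ _)) // addrC lerD2l.
have Vtw : `‖V t w‖ <= cV + 1.
  have := rnorm_le_dist (V t w) (V t0 w); have := hV w; have := Vc w.
  by rewrite w1; lra.
have h_le : `‖h‖ <= `|lam| + rho + cV + 2.
  rewrite hE; have := rnormB (nu%:C *: w - V t w) ('i%C *: w).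
  have := rnormB (nu%:C *: w) (V t w).
  by rewrite !rnormZ rnorm_real rnorm_i w1; lra.
have hh0 : `‖h - h0‖ <= e * (3 + `|lam| + cV).
  have -> : h - h0 = (nu - lam)%:C *: w + lam%:C *: (w - p) - (V t w - V t0 w)
      - V t0 (w - p) - 'i%C *: (w - p).
    have -> : V t0 (w - p) = V t0 w - V t0 p by exact: linearB.
    by rewrite hE h0E rcB; lmod R H.
  have := rnormB ((nu - lam)%:C *: w + lam%:C *: (w - p) - (V t w - V t0 w)
      - V t0 (w - p)) ('i%C *: (w - p)).
  have := rnormB ((nu - lam)%:C *: w + lam%:C *: (w - p) - (V t w - V t0 w))
    (V t0 (w - p)).
  have := rnormB ((nu - lam)%:C *: w + lam%:C *: (w - p)) (V t w - V t0 w).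
  have := rnormD ((nu - lam)%:C *: w) (lam%:C *: (w - p)).
  rewrite !rnormZ !rnorm_real rnorm_i w1.
  have := hV w; have := Vc (w - p); rewrite w1.
  have := ler_wpM2l l0 wp; have := ler_wpM2l (ltW cV0) wp.
  by lra.
have r0B : r t0 (h - h0) = r t0 h - r t0 h0.
  have lin := resolvent_emb_linear t0_unit.
  have -> : h - h0 = (-1) *: h0 + h by lmod R H.
  by have /= -> := lin (-1) h0 h; lmod R D.
have -> : r t h - r t0 h0 = (r t h - r t0 h) + r t0 (h - h0).
  by rewrite r0B; lmod R D.
apply: le_trans (rnormD _ _) _; have := hr h; have := rc (h - h0).
have := ler_wpM2l (ltW ep) h_le; have := ler_wpM2l (ltW c0) hh0.
by move: eK; rewrite /K; lra.
Qed.

Context (P : {linear H -> H}) (Pp : orthogonal_projection P).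
Context (PK : range P = eigspace (H_ t0) lam%:C).
Local Notation T1 := (first_order_operator i P V' (T t0) T' Q').
Local Notation var := (variation i T t0 T' V' Q').

Lemma Pspan u : range P u -> u = proj e0 u.
Proof. by rewrite PK; exact: (orthonormal_span K_dim e0o e0K). Qed.

Lemma Pe0 k : range P (e0 k).
Proof. by rewrite PK. Qed.

Lemma P_range_i : range P `<=` range i.
Proof. by rewrite PK => u [Au _]; exact: AA_dom Au. Qed.

Lemma T1_dot u v : range P u -> range P v -> ⟨T1 u, v⟩ = var (emb u) (emb v).
Proof.
move=> Pu Pv; rewrite -{1}(emb_invE i_inj (P_range_i Pu)) -{1}(emb_invE i_inj (P_range_i Pv)).
apply: (first_order_dot i_inj Pp P_range_i Pe0 Pspan).
- by move=> f; exact: (dQJ Q_proj Q_Lagrangian t0_unit Q_diff f).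
- by rewrite emb_invE //; exact: P_range_i.
- by rewrite emb_invE //; exact: P_range_i.
Qed.

Lemma T1_proj u : range P u -> T1 u = proj e0 (T1 u).
Proof.
move=> Pu; apply: Pspan; exists (T1 u) => //.
rewrite -(emb_invE i_inj (P_range_i Pu)).
apply: (first_order_range i_inj Pp P_range_i Pe0 Pspan).
by rewrite emb_invE //; exact: P_range_i.
Qed.

(** Linearity of [T1] on the range of [P] is read off from the coordinates [var (emb u) (emb v)],
    since [bounded_adjoint] is a mere choice. *)
Lemma first_order_eigenbasis :
  exists (l1 : 'I_m -> C) (u : 'I_m -> H), orthonormal_eigenbasis T1 (range P) l1 u.
Proof.
have Pcomb (c : 'I_m -> C) : range P (\sum_k c k *: e0 k).
  by rewrite PK; exact: has_dim_comb K_dim _ _ _ e0K.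
have -> : range P = [set \sum_k c k *: e0 k | c in [set: 'I_m -> C]].
  apply/seteqP; split=> [u Pu|_ [c _ <-]] //.
  by exists (fun k => ⟨u, e0 k⟩) => //; rewrite [RHS](Pspan Pu).
apply: hermitian_eigenbasis => // [c|j|j k].
- transitivity (\sum_j c j *: proj e0 (T1 (e0 j))); last first.
    by apply: eq_bigr => j _; rewrite -(T1_proj (Pe0 j)).
  rewrite T1_proj // -proj_sum /proj; apply: eq_bigr => k _; congr (_ *: _).
  rewrite (T1_dot (Pcomb c) (Pe0 k)).
  rewrite (emb_inv_sum i_inj); last by move=> j; exact: P_range_i (Pe0 j).
  rewrite variation_suml dot_suml; apply: eq_bigr => j _.
  by rewrite dotZl (T1_dot (Pe0 j) (Pe0 k)).
- exact: T1_proj (Pe0 j).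
rewrite (T1_dot (Pe0 j) (Pe0 k)) (T1_dot (Pe0 k) (Pe0 j)).
exact: (variation_herm T_bounded T_green Q_proj Q_Lagrangian V_sym t0_unit T_diff V_diff Q_diff).
Qed.

Lemma first_order_eigenvalue (l1 : 'I_m -> C) (u : 'I_m -> H) j :
  orthonormal_eigenbasis T1 (range P) l1 u ->
  l1 j = ⟨V' (u j), u j⟩
    + omega (Q' (T t0 (emb (u j)))) (T t0 (emb (u j)))
    + omega (T t0 (emb (u j))) (T' (emb (u j))).
Proof.
move=> [uo Pu uE]; have Puj : range P (u j).
  rewrite Pu; exists (fun k => (k == j)%:R) => //.
  by rewrite (bigD1 j) //= eqxx scale1r big1 ?addr0 // => k /negPf ->; rewrite scale0r.
have <- : ⟨T1 (u j), u j⟩ = l1 j by rewrite uE dotZl uo eqxx mulr1.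
rewrite T1_dot // (variation_diag T_bounded T_green t0_unit T_diff).
by rewrite !emb_invE //; exact: P_range_i.
Qed.

(** The overlap [⟨w, u k⟩] stays as a factor, since it may vanish for some pairs; the matching later
    selects pairs where it does not. The bound is uniform in the eigenpair and in [k]. *)
Lemma eigenvalue_variation (l1 : 'I_m -> C) (u : 'I_m -> H) (eta : R) :
  orthonormal_eigenbasis T1 (range P) l1 u -> 0 < eta ->
  \forall t \near to_unit t0,
  forall w (nu : R) k, dom (H_ t) w -> H_ t w = nu%:C *: w -> `‖w‖ = 1 ->
    `|nu - lam| <= rho ->
    `‖((nu - lam) / (t - t0))%:C - l1 k‖ * `‖⟨w, u k⟩‖ <= eta.
Proof.
move=> [uo Pu uE] eta0; have [c c0 Kc] := eigenspace_emb_bounded.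
have Puk k : range P (u k).
  rewrite Pu; exists (fun j => (j == k)%:R) => //.
  by rewrite (bigD1 k) //= eqxx scale1r big1 ?addr0 // => j /negPf ->; rewrite scale0r.
have Kuk k : eigspace (H_ t0) lam%:C (u k) by rewrite -PK.
have iuk k : i (emb (u k)) = u k by apply: (embE t0_unit); have [] := Kuk k.
have Auk k : dom (AA t0) (i (emb (u k))) by rewrite iuk; have [] := Kuk k.
pose ok k t := forall w (nu : R), dom (H_ t) w -> H_ t w = nu%:C *: w ->
  `‖w‖ = 1 -> `|nu - lam| <= rho ->
  `‖((nu - lam) / (t - t0))%:C - l1 k‖ * `‖⟨w, u k⟩‖ <= eta.
suff hk k : \forall t \near to_unit t0, ok k t.
  have : \forall t \near to_unit t0, forall k, ok k t by exact: filter_forall.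
  by apply: filterS => t h w nu k; exact: h.
have [d d0 fv] := first_variation A_dense ci_gt0 i_le T_bounded T_green
  Q_proj Q_Lagrangian AA_selfadj AA_extends AA_trace V_sym t0_unit T_diff V_diff Q_diff
  (Auk k) (ltW c0) eta0.
apply: filterS (filterI (near_dist t0 ltr01) (filterI (eigenvector_emb_cvg d0) fv)).
move=> t [[tu _ _] [hd {}fv]] w nu Aw wE w1 nul.
set p := proj e0 w.
have Kp : eigspace (H_ t0) lam%:C p by exact: has_dim_comb K_dim _ _ _ e0K.
have iw : i (emb w) = w by exact: embE tu Aw.
have ip : i (emb p) = p by apply: (embE t0_unit); have [] := Kp.
have := fv (emb w) (emb p); rewrite iw ip !iuk => /(_ Aw Kp.1) fv'.
have emb_p : `‖emb p‖ <= c.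
  apply: le_trans (Kc p Kp) _; rewrite ler_piMr ?(ltW c0) //.
  by rewrite -w1; exact: rnorm_proj.
have := fv' emb_p (hd w nu Aw wE w1 nul).
rewrite -T1_dot ?PK // uE wE (Kuk k).2 !dotZl !dotZr conjc_real.
have -> : ⟨u k, p⟩ = ⟨u k, w⟩.
  apply/esym/eqP; rewrite -subr_eq0 -dotBr dotC [u k]Pspan //.
  have -> : ⟨w - p, proj e0 (u k)⟩ = 0 by exact: dot_compl_comb.
  by rewrite conjc0.
rewrite [⟨w, u k⟩]dotC rnorm_conj -rnormM rcM rcV rcB.
by apply: le_trans; rewrite le_eqVlt; apply/orP; left; apply/eqP; congr rnorm; ring.
Qed.

Lemma eigenvalue_branches (l1 : 'I_m -> C) (u : 'I_m -> H) (B : set C) :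
  orthonormal_eigenbasis T1 (range P) l1 u ->
  (forall z, `‖z - lam%:C‖ < rho -> B z) ->
  (forall z, B z -> `‖z - lam%:C‖ < rho \/ forall w, w = proj e0 w) ->
  exists l : 'I_m -> R -> R, [/\
    \forall t \near within unit_itv (nbhs t0),
      lists_eigenvalues (H_ t) B (fun j => (l j t)%:C),
    forall j, l j t0 = lam &
    forall j (eps : R), 0 < eps -> \forall t \near to_unit t0,
      `‖((l j t - lam) / (t - t0))%:C - l1 j‖ <= eps].
Proof.
move=> ub B1 B2; have [uo Pu uE] := ub.
have proj_u v : proj u v = proj e0 v.
  have Puk k : range P (u k).
    rewrite Pu; exists (fun j => (j == k)%:R) => //.
    by rewrite (bigD1 k) //= eqxx scale1r big1 ?addr0 // => j /negPf ->; rewrite scale0r.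
  rewrite -(orthoproj_proj Pp Pe0 Pspan) (@orthoproj_proj _ _ _ Pp _ u) // => v'.
  by rewrite Pu; exact: comb_proj.
(* With [eta1 = 1 / (2 N)], one number is below [rho], meets the condition of [near_bases_matching],
   and makes [(m + 1) eta1 < 1] for the count of eigenvectors. *)
pose N : R := 2 * (m%:R + (m`!)%:R + 1) + rho^-1.
have N0 : 0 < N by rewrite addr_gt0 ?invr_gt0 // mulr_gt0 // ltr_wpDl // addr_ge0.
pose eta1 : R := (2 * N)^-1.
have eta1_gt0 : 0 < eta1 by rewrite invr_gt0 mulr_gt0.
have etaN : eta1 * N = 2^-1 by rewrite /eta1; field; rewrite gt_eqF.
have ir0 : 0 < rho^-1 by rewrite invr_gt0.
have em : 0 <= eta1 * m%:R by rewrite mulr_ge0 // ltW.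
have ef : eta1 <= eta1 * (m`!)%:R.
  by rewrite ler_peMr ?(ltW eta1_gt0) // ler1n fact_gt0.
have er : 0 < eta1 * rho^-1 by rewrite mulr_gt0.
have eta1_rho : eta1 < rho.
  by rewrite -[ltRHS]mul1r -ltr_pdivrMr //; move: etaN; rewrite /N; lra.
have eta1_1 : eta1 <= 1 by move: etaN; rewrite /N; lra.
have eta1_m : (m%:R + (m`!)%:R) * eta1 <= 2^-1 by move: etaN; rewrite /N; lra.
have eta1_m1 : m.+1%:R * eta1 < 1 by rewrite -natr1; move: etaN; rewrite /N; lra.
pose good t (p : ('I_m -> H) * ('I_m -> R) * {perm 'I_m}) :=
  [/\ orthonormal_family p.1.1,
      forall j, dom (H_ t) (p.1.1 j) /\ H_ t (p.1.1 j) = (p.1.2 j)%:C *: p.1.1 j,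
      forall j, `|p.1.2 j - lam| <= rho &
      forall j, matching_const R m <= `‖⟨p.1.1 j, u (p.2 j)⟩‖].
have good_near : \forall t \near within unit_itv (nbhs t0), exists p, good t p.
  apply: filterS (H_cluster eta1_gt0) => t [tu [cl [e [nu [eo eE nul]]]]].
  have [||j|s sP] := @near_bases_matching R H m e u eta1 eo uo.
  - by rewrite ltW.
  - exact: eta1_m.
  - rewrite proj_u; have [Aj jE] := eE j.
    by have [+ _] := cl _ _ Aj jE (nul j); rewrite orthonormal_norm // mulr1.
  by exists (e, nu, s).
(* A triple is chosen for each [t] separately; where none exists the value is a dummy. *)
have ex_pick t : exists p, (exists p', good t p') -> good t p.
  have [[p gp]|ng] := pselect (exists p, good t p); first by exists p.
  by exists (fun=> 0, fun=> 0, 1%g).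
have [pick pickP] := choice ex_pick.
have cluster_t0 (eta : R) : 0 < eta ->
    forall w (nu : R), dom (H_ t0) w -> H_ t0 w = nu%:C *: w -> `|nu - lam| <= rho ->
    `|nu - lam| * `‖w‖ <= eta * `‖w‖.
  move=> /H_cluster[x /= x0 hx]; have [|_ [h _]] := hx t0 _ t0_unit.
    by rewrite /= subrr normr0.
  by move=> w nu Aw wE nul; have [] := h w nu Aw wE nul.
have good_t0 : exists p, good t0 p.
  by have [x /= x0 hx] := good_near; apply: hx => //=; rewrite subrr normr0.
have near_deleted (S : R -> Prop) : (\forall t \near within unit_itv (nbhs t0), S t) ->
    \forall t \near to_unit t0, S t.
  move=> [x /= x0 hx]; apply: near_to_unit; exists x => // t tu _ tx.
  by apply: hx => //=; rewrite distrC.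
(* The permutation sends the index of an eigenvector to that of a [u] it overlaps with, so its
   inverse labels the branches by the [u j]. *)
exists (fun j t => (pick t).1.2 ((pick t).2^-1%g j)); split.
- apply: filterS (filterI good_near (H_cluster eta1_gt0)).
  move=> t [/pickP[eo eE nul _] [tu [cl _]]].
  move: (pick t) eo eE nul => [[e nu] s] /= eo eE nul.
  have e_near j : `‖e j - proj e0 (e j)‖ <= eta1 /\ `|nu j - lam| <= eta1.
    have [Aj jE] := eE j; have := cl _ _ Aj jE (nul j).
    by rewrite orthonormal_norm // !mulr1.
  have sym := (H_selfadj tu).1.
  apply: (@lists_eigenvalues_family _ _ _ _ _ (fun j => e ((s^-1)%g j)) (fun j => nu ((s^-1)%g j))).
  + exact: sym.
  + by move=> j k; rewrite eo (inj_eq perm_inj).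
  + by move=> j; exact: eE.
  + move=> j; apply: B1; rewrite -rcB rnorm_real.
    by apply: le_lt_trans eta1_rho; have [] := e_near ((s^-1)%g j).
  (* A further eigenvector orthogonal to all [e j] would give [m.+1] orthonormal vectors near an
     [m]-dimensional space. *)
  move=> z v Bz Kv ve; apply/eqP/negPn/negP => v0.
  have vp : 0 < `‖v‖ by rewrite rnorm_gt0.
  have [Av vE] := Kv; have zr := selfadj_eigenvalue_real (H_selfadj tu) Kv v0.
  pose w := (`‖v‖^-1)%:C *: v.
  have w1 : `‖w‖ = 1.
    rewrite rnormZ rnorm_real ger0_norm ?invr_ge0 ?rnorm_ge0 //.
    by rewrite mulVf // gt_eqF.
  have w_near : `‖w - proj e0 w‖ <= eta1.
    (* When the disc is the whole plane nothing bounds [z], but then every vector lies in the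
       eigenspace. *)
    have [zl|<-] := B2 _ Bz; last by rewrite subrr rnorm0 ltW.
    have Aw : dom (H_ t) w by exact: dom_scale.
    have wE : H_ t w = (complex.Re z)%:C *: w.
      by rewrite op_scale // vE -zr !scalerA mulrC.
    have [|+ _] := cl w (complex.Re z) Aw wE; last by rewrite w1 mulr1.
    by rewrite -rnorm_real rcB -zr ltW.
  have ew j : ⟨e j, w⟩ = 0.
    by rewrite dotZr dotC -[e j](congr1 e (permK s j)) ve conjc0 mulr0.
  have we j : ⟨w, e j⟩ = 0 by rewrite dotC ew conjc0.
  pose f (j : 'I_m.+1) := if unlift ord_max j is Some k then e k else w.
  have fo : orthonormal_family f.
    move=> j k; rewrite /f; case: unliftP => [j'|] ->; case: unliftP => [k'|] ->.
    - by rewrite eo (inj_eq lift_inj).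
    - by rewrite ew eq_sym (negPf (neq_lift _ _)).
    - by rewrite we (negPf (neq_lift _ _)).
    - by rewrite dotE w1 expr1n eqxx.
  have f_near j : `‖f j - proj e0 (f j)‖ <= eta1.
    by rewrite /f; case: unliftP => [k|] _ //; have [] := e_near k.
  by have := orthonormal_near_card fo e0o f_near eta1_m1; rewrite ltnn.
- move=> j; have [eo eE nul _] := pickP _ good_t0.
  set k := ((pick t0).2^-1)%g j; have [Ak kE] := eE k.
  (* At [t0] itself the cluster estimate holds for every [eps], so the eigenvalue is [lam]. *)
  apply/eqP; rewrite -subr_eq0 -normr_eq0 eq_le normr_ge0 andbT.
  apply/ler_addgt0Pr => eps eps0; rewrite add0r.
  by have := cluster_t0 eps eps0 _ _ Ak kE (nul k); rewrite orthonormal_norm // !mulr1.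
move=> j eps eps0.
have kp := matching_const_gt0 R m.
(* The factor [matching_const] is cancelled against the lower bound of the matched overlap. *)
apply: filterS (filterI (near_deleted _ good_near)
  (eigenvalue_variation ub (mulr_gt0 eps0 kp))).
move=> t [/pickP[eo eE nul match_ge] var_le].
set k := ((pick t).2^-1)%g j; have [Ak kE] := eE k.
have := var_le _ _ j Ak kE (orthonormal_norm k eo) (nul k).
have := match_ge k; rewrite permKV => h1 h2.
rewrite -(ler_pM2r kp); apply: le_trans h2.
by rewrite ler_wpM2l // rnorm_ge0.
Qed.

End Asymptotics.

Theorem theorem3p25 (R : realType) (H G : hilbertType R)
  (H_separable : separable_space H) (G_separable : separable_space G)
  (A : operator H)
  (A_symmetric : symmetric_operator A)
  (A_closed : closed_operator A)
  (A_deficiency : equal_deficiency_indices A)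
  (D : completeNormedModType R[i]) (i : {linear D -> H})
  (i_inj : injective i)
  (D_sub : forall x, adjoint_dom A (i x))
  (D_bounded : exists M : R, forall x, graph_norm A (i x) <= M%:C * `|x|)
  (D_dense : forall v, adjoint_dom A v ->
     forall e : R, 0 < e -> exists x, graph_norm A (i x - v) < e%:C)
  (D_dom : dom A `<=` range i)
  (T : R -> {linear D -> hsum G})
  (T_bounded : forall t, unit_itv t -> continuous (T t))
  (T_dense : forall t, unit_itv t -> dense (range (T t)))
  (T_green : forall t, unit_itv t -> forall u v : D,
     ⟨adjoint A (i u), i v⟩ - ⟨i u, adjoint A (i v)⟩ =
     ⟨(T t u).2, (T t v).1⟩ - ⟨(T t u).1, (T t v).2⟩)
  (Q : R -> {linear hsum G -> hsum G})
  (Q_proj : forall t, unit_itv t -> orthogonal_projection (Q t))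
  (Q_Lagrangian : forall t, unit_itv t -> Lagrangian (range (Q t)))
  (AA : R -> operator H)
  (AA_self_adjoint : forall t, unit_itv t -> self_adjoint (AA t))
  (AA_extends : forall t, unit_itv t -> extends A (AA t))
  (AA_dom : forall t, unit_itv t -> dom (AA t) `<=` range i)
  (AA_trace : forall t, unit_itv t ->
     closure (T t @` [set x | dom (AA t) (i x)]) = range (Q t))
  (V : R -> {linear H -> H})
  (V_self_adjoint : forall t, unit_itv t -> bounded_self_adjoint (V t))
  (t0 : R) (t0_unit : unit_itv t0)
  (AA_cvg : opnorm (fun v : H => emb_inv i (resolvent (AA t) 'i%C v)
                               - emb_inv i (resolvent (AA t0) 'i%C v))
              @[t --> to_unit t0] --> 0%E)
  (lam : R[i]) (m : nat)
  (lam_eig : eigval (add_op (AA t0) (V t0)) lam)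
  (lam_isolated : isolated (spectrum (add_op (AA t0) (V t0)) : set R[i]^o) lam)
  (lam_mult : has_dim (eigspace (add_op (AA t0) (V t0)) lam) m)
  (T' : {linear D -> hsum G}) (T_diff : opnorm_derivative T t0 T')
  (V' : {linear H -> H}) (V_diff : opnorm_derivative V t0 V')
  (Q' : {linear hsum G -> hsum G}) (Q_diff : opnorm_derivative Q t0 Q')
  (P : {linear H -> H}) (P_proj : orthogonal_projection P)
  (P_range : range P = eigspace (add_op (AA t0) (V t0)) lam) :
  let T1 := first_order_operator i P V' (T t0) T' Q' in
  let B := spectral_disc (add_op (AA t0) (V t0)) lam in
  (exists (l1 : 'I_m -> R[i]) (u : 'I_m -> H),
     orthonormal_eigenbasis T1 (range P) l1 u) /\
  forall (l1 : 'I_m -> R[i]) (u : 'I_m -> H),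
    orthonormal_eigenbasis T1 (range P) l1 u ->
    exists l : 'I_m -> R -> R[i]^o,
      [/\ \forall t \near within unit_itv (nbhs t0),
            lists_eigenvalues (add_op (AA t) (V t)) B (l ^~ t),
          forall j,
            (fun t => l j t - (lam + l1 j * (t - t0)%:C))
              =o_ (to_unit t0) (fun t => (t - t0)%:C : R[i]^o) &
          forall j, derivative_at (l j) t0
            (⟨V' (u j), u j⟩
             + omega (Q' (T t0 (emb_inv i (u j)))) (T t0 (emb_inv i (u j)))
             + omega (T t0 (emb_inv i (u j))) (T' (emb_inv i (u j))))].
Proof.
move=> T1 B; have [A_dense A_sym] := A_symmetric.
have AA_sa t : unit_itv t -> selfadj (AA t).
  by move=> tu; apply: self_adjoint_selfadj; exact: AA_self_adjoint.
have [ci ci0 i_le] : exists2 ci : R, 0 < ci & forall x, `‖i x‖ <= ci * `‖x‖.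
  have [M hM] := D_bounded; exists (`|M| + 1); first by rewrite ltr_wpDl.
  move=> x; have : `‖i x‖ <= M * `‖x‖.
    rewrite -lecR rcM -!rnormE; apply: le_trans (hM x).
    rewrite /graph_norm -[X in X <= _]sqrCK // dotform_norm.
    rewrite ler_sqrtC ?nnegrE ?addr_ge0 // -?dotform_norm ?exprn_ge0 //.
    by rewrite lerDl exprn_ge0.
  move=> h; apply: le_trans h _; rewrite ler_wpM2r ?rnorm_ge0 //.
  by rewrite (le_trans (ler_norm _)) // lerDl.
have H0_sa := H_selfadj AA_sa V_self_adjoint t0_unit.
have [v0 Kv0 v0_neq0] := lam_eig.
(* [lam] is real, being an eigenvalue of a self-adjoint operator; replacing it by [lr%:C] gives
   access to the real estimates. *)
have lamE := selfadj_eigenvalue_real H0_sa Kv0 v0_neq0.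
set lr := complex.Re lam in lamE.
have [e0 [e0o e0K]] := orthonormal_in_subspace lam_mult (leqnn m).
rewrite lamE in lam_isolated lam_mult P_range e0K *.
have H0_dense : dense (dom (add_op (AA t0) (V t0))).
  by have [] := AA_self_adjoint _ t0_unit.
have [rho [g [rho0 rho_g gap B1 B2]]] :=
  spectral_disc_gap H0_sa H0_dense lam_mult e0o e0K lam_isolated.
split.
  exact: (first_order_eigenbasis i_inj T_bounded T_green Q_proj Q_Lagrangian AA_dom
    V_self_adjoint t0_unit T_diff V_diff Q_diff lam_mult e0o e0K P_proj P_range).
move=> l1 u ub.
have [l [l_lists l_t0 l_le]] := eigenvalue_branches A_dense i_inj ci0 i_le T_bounded
  T_green Q_proj Q_Lagrangian AA_sa AA_extends AA_dom AA_trace V_self_adjoint t0_unit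
  AA_cvg T_diff V_diff Q_diff lam_mult e0o e0K rho0 rho_g gap P_proj P_range ub B1 B2.
have l1E j := first_order_eigenvalue i_inj T_bounded T_green Q_proj Q_Lagrangian AA_dom
  t0_unit T_diff Q_diff lam_mult e0o e0K P_proj P_range j ub.
exists (fun j t => (l j t)%:C); split=> [|j|j].
- by rewrite /B lamE.
- apply/eqoP => eps; rewrite ltcE => /andP[/eqP /= eps_im eps_re].
  apply: filterS (filterI (near_dist t0 ltr01) (l_le j _ eps_re)) => t [[_ tt0 _] lt] /=.
  have -> : (l j t)%:C - (lr%:C + l1 j * (t - t0)%:C) =
      (((l j t - lr) / (t - t0))%:C - l1 j) * (t - t0)%:C.
    by rewrite mulrBl -rcM divfK // rcB; ring.
  rewrite normrM ler_wpM2r // rnormE [eps]complexE eps_im mulr0 addr0 lecR.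
  exact: lt.
rewrite /derivative_at -l1E; apply/cvgrPdist_le => eps.
rewrite ltcE => /andP[/eqP /= eps_im eps_re].
apply: filterS (filterI (near_dist t0 ltr01) (l_le j _ eps_re)) => t [_ lt] /=.
rewrite l_t0 -rcB -rcV /= /GRing.scale /= -rcM mulrC distrC rnormE.
by rewrite [eps]complexE eps_im mulr0 addr0 lecR.
Qed.
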